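(* Let $\mathbf S_n\sim\mathcal U(\mathcal M_n^{[0,1]})$ and, for $k<n$ ($k$ fixed), let $\mathbf S_k^{(n)}$ denote the projection of $\mathbf S_n$ onto the first $k$ coordinates. Then, as $n\to\infty$, $(\mathbf S_k^{(n)})_n$ satisfies a large deviation principle in $(\mathcal S_p^+(\mathbb C))^k$ with speed $n$ and good rate function $$\mathcal I_{\mathbf S}(\mathbf S_k)=\begin{cases}-p\log\det(S_{k+1}^+-S_{k+1}^-)-2kp^2\log2,&\text{if }\mathbf S_k=(S_1,\dots,S_k)\in\mathrm{Int}\,\mathcal M_k^{[0,1]},\\ \infty,&\text{otherwise.}\end{cases}$$
   Context: Fix an integer $p\ge1$. $\mathcal S_p(\mathbb C)$ (resp. $\mathcal S_p^+(\mathbb C)$) is the set of Hermitian (resp. nonnegative definite Hermitian) $p\times p$ matrices. $\mathcal P([0,1])$ is the set of measures $\mu$ on $[0,1]$ with values in $\mathcal S_p^+(\mathbb C)$ and $\int d\mu=I_p$. The moment space is $\mathcal M_n^{[0,1]}=\{(S_1,\dots,S_n): S_j=\int_0^1x^jd\mu(x),\ \mu\in\mathcal P([0,1])\}$, a compact subset of $(\mathcal S_p^+(\mathbb C))^n$ with nonempty interior in $(\mathcal S_p(\mathbb C))^n$; $\mathcal U(\mathcal M_n^{[0,1]})$ is the uniform distribution on it with respect to $dS_1\cdots dS_n$, where $dS=\prod_{i\le j}d\,\mathrm{Re}(s_{ij})\prod_{i<j}d\,\mathrm{Im}(s_{ij})$. Definition of $S_{k+1}^\pm$. For $(S_1,\dots,S_k)\in\mathrm{Int}\,\mathcal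 M_k^{[0,1]}$ put $S_0=I_p$ and define block Hankel matrices $\underline H_{2m}=(S_{i+j})_{0\le i,j\le m}$, $\overline H_{2m}=(S_{i+j+1}-S_{i+j+2})_{0\le i,j\le m-1}$, $\underline H_{2m+1}=(S_{i+j+1})_{0\le i,j\le m}$, $\overline H_{2m+1}=(S_{i+j}-S_{i+j+1})_{0\le i,j\le m}$, and block rows $\underline h_{2m}^*=(S_{m+1},\dots,S_{2m})$, $\underline h_{2m-1}^*=(S_m,\dots,S_{2m-1})$, $\bar h_{2m}^*=(S_m-S_{m+1},\dots,S_{2m-1}-S_{2m})$, $\bar h_{2m-1}^*=(S_m-S_{m+1},\dots,S_{2m-2}-S_{2m-1})$, with $\underline h_j,\bar h_j$ their conjugate transposes. Then $S_{j+1}^-=\underline h_j^*\underline H_{j-1}^{-1}\underline h_j$ for $j\ge1$, $S_2^+=S_1$, and $S_{j+1}^+=S_j-\bar h_j^*\overline H_{j-1}^{-1}\bar h_j$ for $j\ge2$. A sequence of random variables with laws $Q_n$ on a Hausdorff space $U$ satisfies a large deviation principle with speed $n$ and rate function $I:U\to[0,\infty]$ if $I$ is lower semicontinuous and for every Borel $A$: $-\inf_{\mathrm{Int}A}I\le\liminf_n\frac1n\log Q_n(A)\le\limsup_n\frac1n\log Q_n(A)\le-\inf_{\overline A}I$; $I$ is good if its level sets $\{I\le x\}$ are compact. *)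

(* Defs.v *)
From HB Require Import structures.
From mathcomp Require Import all_boot all_order all_algebra.
From mathcomp Require Import sesquilinear spectral.
From mathcomp Require Import all_classical all_reals all_analysis.
From mathcomp Require Import complex.

Set Implicit Arguments.
Unset Strict Implicit.
Unset Printing Implicit Defensive.

Import Order.TTheory GRing.Theory Num.Theory.
Import numFieldNormedType.Exports.

Local Open Scope classical_set_scope.
Local Open Scope complex_scope.
Local Open Scope sesquilinear_scope.
Local Open Scope ring_scope.

(* The usual topology of the complex numbers, generated by the modulus balls;
   matrices ['M_p] and row vectors ['rV_n] of matrices then carry the product
   topology. *)
HB.instance Definition _ (R : realType) :=
  PseudoPointedMetric.copy R[i] (R[i]^o).

(* [0 <= z] in [R[i]] means that [z] is real and nonnegative. *)
Definition psdmx (C : numClosedFieldType) (p : nat) (A : 'M[C]_p) : Prop :=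
  A \is hermsymmx /\ forall v : 'rV[C]_p, 0 <= (v *m A *m v ^t*) 0 0.

Lemma psdmx0 (C : numClosedFieldType) (p : nat) : psdmx (0 : 'M[C]_p).
Proof.
split; first by apply/is_hermitianmxP; rewrite trmx0 map_mx0 scaler0.
by move=> v; rewrite mulmx0 mul0mx mxE.
Qed.

Section MatrixTuples.
Variables (R : realType) (p : nat).

Definition herm_tuples (n : nat) : set 'rV['M[R[i]]_p]_n :=
  [set S | forall j, S 0 j \is hermsymmx].

Definition psd_tuples (n : nat) : set 'rV['M[R[i]]_p]_n :=
  [set S | forall j, psdmx (S 0 j)].

Arguments herm_tuples : clear implicits.
Arguments psd_tuples : clear implicits.

(* The space of n-tuples of nonnegative definite matrices, with the subspace
   topology. *)
Definition psd_tuple (n : nat) : Type := set_type (psd_tuples n).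

HB.instance Definition _ (n : nat) := Choice.on (psd_tuple n).
HB.instance Definition _ (n : nat) :=
  Topological.copy (psd_tuple n) (set_type (psd_tuples n)).

Lemma psd_tuples0 (n : nat) : psd_tuples n 0.
Proof. by move=> j; rewrite mxE; exact: psdmx0. Qed.

HB.instance Definition _ (n : nat) :=
  isPointed.Build (psd_tuple n) (exist _ 0 (mem_set (@psd_tuples0 n))).

Definition psd_tuple_val (n : nat) (S : psd_tuple n) : 'rV['M[R[i]]_p]_n :=
  set_val S.

(* Total in [k] and [n]: the coordinates beyond the n-th are filled with 0. *)
Definition first_coords_row (n k : nat) (S : 'rV['M[R[i]]_p]_n) :
    'rV['M[R[i]]_p]_k :=
  \row_(i < k) if insub (val i) is Some j then S 0 j else 0.

Lemma first_coords_psd (n k : nat) (S : psd_tuple n) :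
  psd_tuples k (first_coords_row k (psd_tuple_val S)).
Proof.
move=> i; rewrite mxE; case: insub => [j|]; last exact: psdmx0.
by case: S => S SP; move/set_mem: (SP); exact.
Qed.

Definition first_coords (n k : nat) (S : psd_tuple n) : psd_tuple k :=
  exist (fun T => T \in psd_tuples k) (first_coords_row k (psd_tuple_val S))
    (mem_set (@first_coords_psd n k S)).

(* Interior relative to the space of n-tuples of Hermitian matrices. *)
Definition herm_interior (n : nat) (A : set 'rV['M[R[i]]_p]_n) :
    set 'rV['M[R[i]]_p]_n :=
  [set S | herm_tuples n S /\ within (herm_tuples n) (nbhs S) A].

End MatrixTuples.

Arguments psd_tuple R p n : clear implicits.
Notation borel_of U := (g_sigma_algebraType (@open U)).

Section MatrixMeasures.
Variable R : realType.

(* Integral against a signed measure, through a Jordan decomposition; it does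
   not depend on the Hahn decomposition that is chosen
   (Hahn_decomposition_uniq). *)
Definition charge_integral (d : measure_display) (T : measurableType d)
    (nu : {charge set T -> \bar R}) (D : set T) (f : T -> R) : R :=
  let: exist _ hP := cid (Hahn_decomposition nu) in
  let: exist _ nuPN := cid hP in
  (\int[jordan_pos nuPN]_(x in D) f x) - (\int[jordan_neg nuPN]_(x in D) f x).

(* A matrix of complex measures on the Borel sets of R, given by the real and
   imaginary parts of its entries. *)
Record matrix_charge (p : nat) := MatrixCharge {
  mc_re : 'I_p -> 'I_p -> {charge set (measurableTypeR R) -> \bar R} ;
  mc_im : 'I_p -> 'I_p -> {charge set (measurableTypeR R) -> \bar R} }.

Definition mc_val (p : nat) (mu : matrix_charge p) (A : set R) : 'M[R[i]]_p :=
  \matrix_(a, b) (fine (mc_re mu a b A) +i* fine (mc_im mu a b A)).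

Definition mc_integral (p : nat) (mu : matrix_charge p) (D : set R)
    (f : R -> R) : 'M[R[i]]_p :=
  \matrix_(a, b) (charge_integral (mc_re mu a b) D f
                  +i* charge_integral (mc_im mu a b) D f).

(* P([0,1]): a measure on [0,1] is seen as a measure on R that does not charge
   the complement of [0,1]. *)
Definition matrix_probability01 (p : nat) : set (matrix_charge p) :=
  [set mu | [/\ forall A : set (measurableTypeR R),
                  measurable A -> psdmx (mc_val mu A),
                mc_val mu (~` `[0, 1]) = 0
              & mc_integral mu `[0, 1] (fun=> 1) = 1%:M]].

Definition moment_space (p n : nat) : set 'rV['M[R[i]]_p]_n :=
  [set S | exists2 mu, matrix_probability01 mu &
    forall j : 'I_n, S 0 j = mc_integral mu `[0, 1] (fun x => x ^+ j.+1)].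

End MatrixMeasures.

Section UniformDistribution.
Variable R : realType.

(* m-dimensional Lebesgue measure, as the m-fold product measure: iterated
   Lebesgue measure of the sections. *)
Fixpoint lebesgue_tuple (m : nat) : set (m.-tuple R) -> \bar R :=
  match m with
  | 0 => fun A => \d_([tuple] : 0.-tuple R) A
  | m'.+1 => fun A =>
      (\int[@lebesgue_measure R]_x
         lebesgue_tuple [set t : m'.-tuple R | A [tuple of x :: t]])%E
  end.

(* The real coordinates of an n-tuple of Hermitian matrices are indexed by
   (l, (a, b)): for a <= b the coordinate is Re (S_l)_ab, and for a > b it is
   Im (S_l)_ba. *)
Definition herm_coords (p n : nat)
    (t : #|{: 'I_n * ('I_p * 'I_p)}|.-tuple R) : 'rV['M[R[i]]_p]_n :=
  let c l a b := tnth t (enum_rank (l, (a, b))) in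
  \row_(l < n) \matrix_(a < p, b < p)
    (if (a < b)%N then c l a b +i* c l b a
     else if (b < a)%N then c l b a -i* c l a b
     else (c l a a)%:C).

(* The measure dS_1 ... dS_n on n-tuples of Hermitian matrices. *)
Definition herm_volume (p n : nat) (A : set 'rV['M[R[i]]_p]_n) : \bar R :=
  lebesgue_tuple (@herm_coords p n @^-1` A).

Definition uniform_on_moment_space (p n : nat)
    (Q : set (psd_tuple R p n) -> \bar R) : Prop :=
  forall A : set (psd_tuple R p n), <<s open >> A ->
    Q A = (fine (herm_volume
                   ((@psd_tuple_val R p n @` A) `&` @moment_space R p n))
           / fine (herm_volume (@moment_space R p n)))%:E.

End UniformDistribution.

Section Hankel.
Variables (R : realType) (p : nat).
Implicit Types (s : nat -> 'M[R[i]]_p) (j : nat).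

(* [lower_hankel s j] and [upper_hankel s j] are the block Hankel matrices of
   index j; [lower_row s j] and [upper_row s j] are the block rows
   (S_m, ..., S_{2m-1}) etc. of index j, before conjugate transposition. The
   number of blocks and the first index depend on the parity of j. *)
Definition lower_hankel s j :=
  \mxblock_(a < j./2.+1, b < j./2.+1)
    (if odd j then s (a + b).+1 else s (a + b)%N).

Definition upper_hankel s j :=
  \mxblock_(a < uphalf j, b < uphalf j)
    (if odd j then s (a + b)%N - s (a + b).+1
     else s (a + b).+1 - s (a + b).+2).

Definition lower_row s j := \mxrow_(b < uphalf j) s (j./2.+1 + b)%N.

Definition upper_row s j :=
  \mxrow_(b < j./2) (s (uphalf j + b)%N - s (uphalf j + b).+1).

(* [S_minus s j] and [S_plus s j] are S_j^- and S_j^+. They are only meaningful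
   for j >= 2 and are given the value 0 otherwise. *)
Definition S_minus s j : 'M[R[i]]_p :=
  match j with
  | i.+2 => lower_row s i.+1 *m invmx (lower_hankel s i)
              *m (lower_row s i.+1) ^t*
  | _ => 0
  end.

Definition S_plus s j : 'M[R[i]]_p :=
  match j with
  | 2 => s 1%N
  | i.+3 => s i.+2 - upper_row s i.+2 *m invmx (upper_hankel s i.+1)
                       *m (upper_row s i.+2) ^t*
  | _ => 0
  end.

(* (S_0, S_1, ..., S_k, 0, 0, ...) with S_0 = I_p. *)
Definition moment_seq (k : nat) (S : 'rV['M[R[i]]_p]_k) (j : nat) :
    'M[R[i]]_p :=
  if j is i.+1 then (if insub i is Some l then S 0 l else 0) else 1%:M.

Definition moment_rate (k : nat) (S : psd_tuple R p k) : \bar R :=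
  let s := moment_seq (psd_tuple_val S) in
  if `[< herm_interior (@moment_space R p k) (psd_tuple_val S) >] then
    (- p%:R * ln (complex.Re (\det (S_plus s k.+1 - S_minus s k.+1)))
     - 2 * k%:R * p%:R ^+ 2 * ln 2)%:E
  else +oo%E.

End Hankel.

Section LargeDeviations.
Variables (R : realType) (U : topologicalType).
Local Open Scope ereal_scope.

(* The speed is n; only the values of [Q n] on Borel sets matter. *)
Definition large_deviation_principle (Q : nat -> set U -> \bar R)
    (I : U -> \bar R) : Prop :=
  [/\ hausdorff_space U,
      forall x, 0 <= I x,
      lower_semicontinuous I
    & forall A : set U, <<s open >> A ->
        - ereal_inf (I @` A°) <= limn_einf (fun n => n%:R^-1%:E * lne (Q n A))
        /\ limn_esup (fun n => n%:R^-1%:E * lne (Q n A))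
             <= - ereal_inf (I @` closure A)].

Definition good_rate_function (I : U -> \bar R) : Prop :=
  forall x : R, compact [set u | I u <= x%:E].

End LargeDeviations.

(* Main.v *)
(* Put D_j = S_j^+ - S_j^-, Y_j = S_j - S_j^- and Z_j = S_j^+ - S_j. Matrix
   orthogonal polynomials give D_{j+1} = (Y_j^-1 + Z_j^-1)^-1, hence
   det D_{j+1} = det Y_j det Z_j / det D_j <= 4^-p det D_j, with equality when
   S_j is the midpoint. Up to a Lebesgue null set, the moment space consists of
   the tuples for which all Y_j and Z_j are positive definite: one inclusion is
   a Gauss quadrature, the other the positivity of the block Hankel matrices of
   a matrix measure. The congruence by a Cholesky factor of D_j normalises
   0 < Y_j < D_j to 0 < U < I_p with Jacobian det(D_j)^p; integrating out S_n,
   S_{n-1}, ..., S_{k+1} in this way, the density of the first k moments is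
   proportional to det(D_{k+1})^(p(n-k)). The large deviation principle is then
   Laplace's method, 4^(-kp) being the maximum of det D_{k+1}; a lower bound on
   det D_{k+1} bounds all det Y_j and det Z_j from below, which makes the level
   sets compact. *)
Require Import Defs.
From HB Require Import structures.
From mathcomp Require Import all_boot all_order all_algebra.
From mathcomp Require Import sesquilinear spectral.
From mathcomp Require Import all_classical all_reals all_analysis.
From mathcomp Require Import measurable_realfun.
From mathcomp Require Import complex.
From mathcomp Require Import ring lra zify.

Set Implicit Arguments.
Unset Strict Implicit.
Unset Printing Implicit Defensive.

Import Order.TTheory GRing.Theory Num.Theory.
Import numFieldNormedType.Exports.

Local Open Scope classical_set_scope.
Local Open Scope sesquilinear_scope.
Local Open Scope ring_scope.

(** * Positive definite matrices *)

(** Two obstacles shape the development. The moment space is given by the existence of a matrix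
    measure, and its measurability is not established; [herm_volume] is therefore used on arbitrary
    sets, where it is merely monotone, and a piece of the moment space is squeezed between good
    sequences and a measurable hull. Moreover volumes are iterated one-dimensional integrals, so the
    change of variables has to be a chain of affine substitutions in one coordinate each; the
    triangular shape of a Cholesky factor provides exactly that. The exponent grows by $p$ per
    integration because $\det(Y)^q\det(Z)^q$ with $Y+Z=D$ fixed integrates to a constant times
    $\det(D)^{p+2q}$, the $p$ being the Jacobian, while the recurrence leaves $\det(D)^{-q}$ in
    front. The constants are matrix beta integrals; as the law is a ratio of volumes, it suffices
    that they are positive and finite. Matrix measures enter through Riemann sums with nonnegative
    definite weights, which depend on the values of the charges and not on a Jordan
    decomposition. *)

Section Adjoint.
Variable C : numClosedFieldType.

Lemma ctrM m n p (A : 'M[C]_(m, n)) (B : 'M[C]_(n, p)) :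
  (A *m B)^t* = B^t* *m A^t*.
Proof. by rewrite trmx_mul map_mxM. Qed.

Lemma ctrD m n (A B : 'M[C]_(m, n)) : (A + B)^t* = A^t* + B^t*.
Proof. by rewrite linearD /= map_mxD. Qed.

Lemma ctrN m n (A : 'M[C]_(m, n)) : (- A)^t* = - A^t*.
Proof. by rewrite linearN /= map_mxN. Qed.

Lemma ctrB m n (A B : 'M[C]_(m, n)) : (A - B)^t* = A^t* - B^t*.
Proof. by rewrite ctrD ctrN. Qed.

Lemma ctr0 m n : (0 : 'M[C]_(m, n))^t* = 0.
Proof. by rewrite trmx0 map_mx0. Qed.

Lemma ctr1 n : (1%:M : 'M[C]_n)^t* = 1%:M.
Proof. by rewrite trmx1 map_mx1. Qed.

Lemma ctrZ m n (a : C) (A : 'M[C]_(m, n)) : (a *: A)^t* = a^* *: A^t*.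
Proof. by rewrite linearZ /= map_mxZ. Qed.

Lemma ctr_sum m n I (r : seq I) (P : pred I) (F : I -> 'M[C]_(m, n)) :
  (\sum_(i <- r | P i) F i)^t* = \sum_(i <- r | P i) (F i)^t*.
Proof. by rewrite raddf_sum raddf_sum. Qed.

Lemma ctr_inv n (A : 'M[C]_n) : (invmx A)^t* = invmx (A^t*).
Proof. by rewrite trmx_inv map_invmx. Qed.

Lemma unitmx_adj n (A : 'M[C]_n) : (A^t* \in unitmx) = (A \in unitmx).
Proof. by rewrite map_unitmx unitmx_tr. Qed.

Lemma det_adj n (A : 'M[C]_n) : \det (A^t*) = (\det A)^*.
Proof. by rewrite det_map_mx det_tr. Qed.

Lemma hermsymP n (A : 'M[C]_n) : (A \is hermsymmx) <-> (A^t* = A).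
Proof.
split=> [/is_hermitianmxP|hA]; first by rewrite expr0 scale1r.
by apply/is_hermitianmxP; rewrite expr0 scale1r.
Qed.

Lemma mx11_adj_real (A : 'M[C]_1) : A^t* = A -> A 0 0 \is Num.real.
Proof.
by move=> /matrixP/(_ 0 0); rewrite !mxE => h; apply/CrealP.
Qed.

Lemma row_normE n (v : 'rV[C]_n) : (v *m v^t*) 0 0 = \sum_i `|v 0 i| ^+ 2.
Proof. by rewrite mxE; apply: eq_bigr => i _; rewrite !mxE normCK. Qed.

Lemma row_norm_ge0 n (v : 'rV[C]_n) : 0 <= (v *m v^t*) 0 0.
Proof. by rewrite row_normE; apply: sumr_ge0 => i _; rewrite exprn_ge0. Qed.

Lemma row_norm_gt0 n (v : 'rV[C]_n) : v != 0 -> 0 < (v *m v^t*) 0 0.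
Proof.
move=> v0; rewrite lt0r row_norm_ge0 andbT; apply: contra v0.
rewrite row_normE psumr_eq0 => [/allP h|i _]; last by rewrite exprn_ge0.
apply/eqP/rowP => i; rewrite mxE; apply/eqP.
by have := h i (mem_index_enum _); rewrite expf_eq0 /= normr_eq0.
Qed.

Lemma diag_formE n (d : 'rV[C]_n) (v : 'rV[C]_n) :
  (v *m diag_mx d *m v^t*) 0 0 = \sum_i d 0 i * `|v 0 i| ^+ 2.
Proof.
rewrite mul_mx_diag mxE; apply: eq_bigr => i _.
by rewrite !mxE normCK mulrAC mulrC.
Qed.

End Adjoint.

Definition pdmx (C : numClosedFieldType) (p : nat) (A : 'M[C]_p) : Prop :=
  A^t* = A /\ forall v : 'rV[C]_p, v != 0 -> 0 < (v *m A *m v^t*) 0 0.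

Section PositiveDefinite.
Variable C : numClosedFieldType.

Lemma psd_herm n (A : 'M[C]_n) : psdmx A -> A^t* = A.
Proof. by case=> /hermsymP. Qed.

Lemma psdP n (A : 'M[C]_n) :
  psdmx A <-> A^t* = A /\ forall v : 'rV[C]_n, 0 <= (v *m A *m v^t*) 0 0.
Proof. by split=> -[hA h]; split=> //; apply/hermsymP. Qed.

Lemma pd_psd n (A : 'M[C]_n) : pdmx A -> psdmx A.
Proof.
case=> hA h; apply/psdP; split=> // v; have [->|/h/ltW//] := eqVneq v 0.
by rewrite !mul0mx mxE.
Qed.

Lemma psd_congr m n (B : 'M[C]_(m, n)) (A : 'M[C]_n) :
  psdmx A -> psdmx (B *m A *m B^t*).
Proof.
move/psdP=> [hA h]; apply/psdP; split=> [|v]; first by rewrite !ctrM trmxCK hA !mulmxA.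
by have := h (v *m B); rewrite ctrM !mulmxA.
Qed.

Lemma pd_congr m n (B : 'M[C]_(m, n)) (A : 'M[C]_n) :
  row_free B -> pdmx A -> pdmx (B *m A *m B^t*).
Proof.
move=> rB [hA h]; split=> [|v v0]; first by rewrite !ctrM trmxCK hA !mulmxA.
have vB : v *m B != 0.
  by apply: contra v0 => /eqP vB; apply/eqP/(row_free_inj rB); rewrite vB mul0mx.
by have := h (v *m B) vB; rewrite ctrM !mulmxA.
Qed.

Lemma pd_congr_unit n (B A : 'M[C]_n) :
  B \in unitmx -> pdmx A -> pdmx (B *m A *m B^t*).
Proof. by move=> uB; apply: pd_congr; rewrite row_free_unit. Qed.

Lemma pd_add_psd n (A B : 'M[C]_n) : pdmx A -> psdmx B -> pdmx (A + B).
Proof.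
move=> [hA h] /psdP[hB g]; split=> [|v v0]; first by rewrite ctrD hA hB.
by rewrite mulmxDr mulmxDl mxE ltr_wpDr ?g ?h.
Qed.

Lemma pdD n (A B : 'M[C]_n) : pdmx A -> pdmx B -> pdmx (A + B).
Proof. by move=> hA /pd_psd; apply: pd_add_psd. Qed.

Lemma psdD n (A B : 'M[C]_n) : psdmx A -> psdmx B -> psdmx (A + B).
Proof.
move=> /psdP[hA h] /psdP[hB g]; apply/psdP; split=> [|v]; first by rewrite ctrD hA hB.
by rewrite mulmxDr mulmxDl mxE addr_ge0 ?g ?h.
Qed.

Lemma psdZ n (a : C) (A : 'M[C]_n) : 0 <= a -> psdmx A -> psdmx (a *: A).
Proof.
move=> a0 /psdP[hA h]; apply/psdP; split=> [|v].
  by rewrite ctrZ hA (conj_Creal (ger0_real _)).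
by rewrite -scalemxAr -scalemxAl mxE mulr_ge0.
Qed.

Lemma pdZ n (a : C) (A : 'M[C]_n) : 0 < a -> pdmx A -> pdmx (a *: A).
Proof.
move=> a0 [hA h]; split=> [|v v0]; first by rewrite ctrZ hA (conj_Creal (gtr0_real _)).
by rewrite -scalemxAr -scalemxAl mxE mulr_gt0 ?h.
Qed.

Lemma pd_unit n (A : 'M[C]_n) : pdmx A -> A \in unitmx.
Proof.
case=> _ h; rewrite -row_free_unit -kermx_eq0; apply/eqP/row_matrixP => i.
rewrite row0; apply/eqP/negP => /negP/h.
by rewrite -row_mul mulmx_ker row0 mul0mx mxE ltxx.
Qed.

Lemma pd_inv n (A : 'M[C]_n) : pdmx A -> pdmx (invmx A).
Proof.
move=> pA; have uA := pd_unit pA; case: (pA) => hA _.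
have -> : invmx A = invmx A *m A *m (invmx A)^t*.
  by rewrite mulVmx // mul1mx ctr_inv hA.
by apply: pd_congr_unit => //; rewrite unitmx_inv.
Qed.

Lemma pd_diag n (d : 'rV[C]_n) : (forall i, 0 < d 0 i) -> pdmx (diag_mx d).
Proof.
move=> d0; split=> [|v v0].
  rewrite tr_diag_mx map_diag_mx; congr diag_mx; apply/rowP => i.
  by rewrite mxE /= (conj_Creal (gtr0_real _)).
have [i vi0] : exists i, v 0 i != 0.
  apply/existsP; apply: contraR v0; rewrite negb_exists => /forallP h.
  by apply/eqP/rowP => i; rewrite mxE; apply/eqP; have := h i; rewrite negbK.
rewrite diag_formE (bigD1 i) //= ltr_pwDl //.
  by rewrite mulr_gt0 // exprn_gt0 // normr_gt0.
by apply: sumr_ge0 => j _; rewrite mulr_ge0 ?exprn_ge0 // ltW.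
Qed.

Lemma pd1 n : pdmx (1%:M : 'M[C]_n).
Proof.
by rewrite -diag_const_mx; apply: pd_diag => i; rewrite mxE.
Qed.

Lemma pd_gram n (L : 'M[C]_n) : L \in unitmx -> pdmx (L *m L^t*).
Proof. by move=> uL; rewrite -[L in L *m _]mulmx1; apply/pd_congr_unit/pd1. Qed.

Lemma psd_gram m n (L : 'M[C]_(m, n)) : psdmx (L *m L^t*).
Proof. by rewrite -[L in L *m _]mulmx1; apply/psd_congr/pd_psd/pd1. Qed.

(** The last clause writes each eigenvalue as a value of the form at a row of the unitary matrix, so
    that sign conditions on the form pass to the spectrum. *)
Lemma herm_spectral n (A : 'M[C]_n) : A^t* = A ->
  exists (W : 'M[C]_n) (d : 'rV[C]_n), [/\ W \is unitarymx, A = W^t* *m diag_mx d *m W,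
    forall i, d 0 i \is Num.real & forall i, d 0 i = (row i W *m A *m (row i W : 'rV[C]_n)^t*) 0 0].
Proof.
move/hermsymP => hA; have uW := spectral_unitarymx A.
set W := spectralmx A in uW *; set d := spectral_diag A.
have eA : A = W^t* *m diag_mx d *m W.
  by rewrite -invmx_unitary //; apply/orthomx_spectralP/hermitian_normalmx.
exists W, d; split=> // i.
  by move/mxOverP: (hermitian_spectral_diag_real hA); exact.
have eD : W *m A *m W^t* = diag_mx d.
  by rewrite eA -!mulmxA (unitarymxP uW) mulmx1 mulmxA (unitarymxP uW) mul1mx.
have -> : d 0 i = (W *m A *m W^t*) i i by rewrite eD !mxE eqxx.
by rewrite -row_mul !mxE; apply: eq_bigr => j _; rewrite !mxE.
Qed.

(** The eigenvalues are nonnegative with nonzero product. This is how strict positivity survives a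
    limit along which a determinant is controlled. *)
Lemma psd_det_pd n (A : 'M[C]_n) : psdmx A -> \det A != 0 -> pdmx A.
Proof.
move=> /psdP[hA h] dA; have [W [d [uW eA dR dE]]] := herm_spectral hA.
have d0 i : 0 < d 0 i.
  rewrite lt0r dE h andbT -dE; apply: contra dA => /eqP di.
  by rewrite eA !det_mulmx det_diag (bigD1 i) //= di mul0r mulr0 mul0r.
rewrite eA -[W in X in pdmx (_ *m X)]trmxCK; apply: pd_congr_unit (pd_diag d0).
by rewrite unitmx_adj unitarymx_unit.
Qed.

(** Induction on the size by the Schur complement of the top left entry. The triangular shape of the
    factor, and not only the factorisation, is what the change of variables relies on. *)
Lemma cholesky n (A : 'M[C]_n) : pdmx A ->
  exists L, [/\ is_trig_mx L, forall i, 0 < L i i & A = L *m L^t*].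
Proof.
elim: n A => [|n IH] A.
  by move=> _; exists 0; split=> [||]; rewrite ?mx0_is_trig ?flatmx0 // => -[].
rewrite -[n.+1]add1n in A *; rewrite -(submxK A).
set a := ulsubmx A; set v := ursubmx A; set w := dlsubmx A; set B := drsubmx A.
move=> [hA pA].
have := hA; rewrite tr_block_mx map_block_mx => /eq_block_mx[ha hw hv hB].
have form (x : 'rV_1) (y : 'rV_n) : row_mx x y *m block_mx a v w B *m (row_mx x y)^t*
   = x *m a *m x^t* + y *m w *m x^t* + (x *m v *m y^t* + y *m B *m y^t*).
  by rewrite mul_row_block tr_row_mx map_col_mx mul_row_col !mulmxDl.
have a0 : 0 < a 0 0.
  have : row_mx (1%:M : 'M[C]_1) (0 : 'rV_n) != 0.
    apply/eqP => /eqP; rewrite -[X in _ == X]row_mx0 => /eqP/eq_row_mx[/eqP + _].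
    by rewrite oner_eq0.
  by move=> /pA; rewrite form !mul0mx ctr0 !mulmx0 !addr0 ctr1 mulmx1 mul1mx.
have ua : a \in unitmx by rewrite unitmxE det_mx11 unitfE gt_eqF.
pose B' := B - w *m invmx a *m v.
have [L [tL L0 eL]] : exists L : 'M[C]_n,
    [/\ is_trig_mx L, forall i, 0 < L i i & B' = L *m L^t*].
  apply: IH; split=> [|y y0].
    by rewrite /B' ctrB hB !ctrM ctr_inv ha hv hw mulmxA.
  (* This choice of the first coordinate cancels two terms of the form, so that its value at
     [row_mx x y] is that of the Schur complement at [y]. *)
  pose x := - (y *m w *m invmx a).
  have /pA : row_mx x y != 0.
    by apply: contra y0 => /eqP; rewrite -[0]row_mx0 => /eq_row_mx[_ ->].
  rewrite form; have -> : x *m a = - (y *m w) by rewrite mulNmx mulmxKV.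
  rewrite mulNmx addNr add0r /B' mulmxBr mulmxBl /x !mulNmx !mulmxA.
  by rewrite [X in 0 < X -> _]mxE [X in _ -> 0 < X]mxE addrC.
pose s := sqrtC (a 0 0).
have s0 : 0 < s by rewrite sqrtC_gt0.
have us : (s%:M : 'M[C]_1) \in unitmx by rewrite unitmxE det_scalar1 unitfE gt_eqF.
have ea : a = s%:M *m s%:M.
  by rewrite -scalar_mxM -expr2 sqrtCK; exact: mx11_scalar.
exists (block_mx s%:M 0 (s^-1 *: w) L); split.
- by rewrite is_trig_block_mx // eqxx tL mx11_is_trig.
- move=> i; rewrite -(splitK i); case: (fintype.split i) => j /=.
    by rewrite block_mxEul ord1 mxE eqxx.
  by rewrite block_mxEdr.
rewrite tr_block_mx map_block_mx mulmx_block ctr0 !mulmx0 !mul0mx !addr0.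
rewrite tr_scalar_mx map_scalar_mx /= (conj_Creal (gtr0_real _)) //.
rewrite -ea; congr block_mx.
- by rewrite ctrZ hw mul_scalar_mx scalerA (conj_Creal (ger0_real _)) ?invr_ge0 ?ltW // divff ?gt_eqF // scale1r.
- by rewrite mul_mx_scalar scalerA divff ?gt_eqF // scale1r.
rewrite -eL /B' ctrZ hw (conj_Creal (ger0_real _)) ?invr_ge0 ?ltW // -scalemxAl -scalemxAr scalerA.
have -> : invmx a = (s^-1 * s^-1)%:M.
  apply: (can_inj (mulKmx ua)); rewrite mulmxV // ea -!scalar_mxM.
  by congr (_%:M); field; rewrite gt_eqF.
by rewrite mul_mx_scalar -scalemxAl addrC subrK.
Qed.

Lemma pd_cholesky_unit n (L : 'M[C]_n) :
  is_trig_mx L -> (forall i, 0 < L i i) -> L \in unitmx.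
Proof.
move=> tL L0; rewrite unitmxE det_trig // unitfE.
by apply/prodf_neq0 => i _; rewrite gt_eqF.
Qed.

Lemma pd_det n (A : 'M[C]_n) : pdmx A -> 0 < \det A.
Proof.
move=> /cholesky[L [tL L0 ->]]; rewrite det_mulmx det_adj -normCK exprn_gt0 //.
by rewrite normr_gt0 -unitfE -unitmxE pd_cholesky_unit.
Qed.

(** A Cholesky factor of [Y + Z] normalises the sum to the identity, and the spectral theorem then
    diagonalises the image of [Y]. Both the determinant inequalities and the nodes of the quadrature
    come from this normal form. *)
Lemma pd_simultaneous n (Y Z : 'M[C]_n) : pdmx Y -> pdmx Z ->
  exists (L : 'M[C]_n) (d : 'rV[C]_n), [/\ L \in unitmx,
    Y = L *m diag_mx d *m L^t*, Z = L *m diag_mx (const_mx 1 - d) *m L^t*,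
    Y + Z = L *m L^t* & forall i, 0 < d 0 i < 1].
Proof.
move=> pY pZ; have [L [tL L0 eL]] := cholesky (pdD pY pZ).
have uL := pd_cholesky_unit tL L0.
pose U := invmx L *m Y *m (invmx L)^t*.
have pU : pdmx U by apply: pd_congr_unit => //; rewrite unitmx_inv.
have eU : Y = L *m U *m L^t*.
  by rewrite /U !mulmxA mulmxV // mul1mx ctr_inv mulmxKV ?unitmx_adj.
have pV : pdmx (1%:M - U).
  have -> : 1%:M - U = invmx L *m Z *m (invmx L)^t*.
    have -> : Z = L *m L^t* - Y by rewrite -eL addrC addKr.
    rewrite mulmxBr mulmxBl -/U !mulmxA mulVmx // mul1mx ctr_inv mulmxV //.
    by rewrite unitmx_adj.
  by apply: pd_congr_unit => //; rewrite unitmx_inv.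
have [W [d [uW eA dR dE]]] := herm_spectral pU.1.
have rW i : row i W != 0.
  apply/eqP => r0; have /row_unitarymxP/(_ i i) := uW.
  by rewrite r0 eqxx dotmxE mul0mx mxE => /eqP; rewrite eq_sym oner_eq0.
have nW i : (row i W *m (row i W)^t*) 0 0 = 1.
  by have /row_unitarymxP/(_ i i) := uW; rewrite eqxx dotmxE.
have WW : W^t* *m W = 1%:M.
  by rewrite -invmx_unitary // mulVmx // unitarymx_unit.
exists (L *m W^t*), d; split.
- by rewrite unitmx_mul uL unitmx_adj unitarymx_unit.
- by rewrite eU {1}eA ctrM trmxCK !mulmxA.
- have -> : Z = L *m L^t* - Y by rewrite -eL addrC addKr.
  rewrite linearB /= diag_const_mx mulmxBr mulmxBl mulmx1 ctrM trmxCK.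
  congr (_ - _); first by rewrite -mulmxA (mulmxA _ W) WW mul1mx.
  by rewrite eU {1}eA !mulmxA.
- by rewrite eL ctrM trmxCK -mulmxA (mulmxA _ W) WW mul1mx.
move=> i; rewrite dE (pU.2 _ (rW i)) /= -subr_gt0 -(nW i).
by have := pV.2 _ (rW i); rewrite mulmxBr mulmxBl mulmx1 mxE [X in _ + X]mxE.
Qed.

Lemma pd_det_le n (Y Z : 'M[C]_n) : pdmx Y -> pdmx Z -> \det Y <= \det (Y + Z).
Proof.
move=> pY pZ; have [L [d [uL -> _ -> d0]]] := pd_simultaneous pY pZ.
rewrite !det_mulmx det_diag det_adj mulrAC -normCK ler_piMr ?exprn_ge0 //.
by apply: prodr_ile1 => i _; have /andP[a b] := d0 i; rewrite !ltW.
Qed.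

(** In the common diagonal form the quotient of the two sides is a product of factors
    $4d_i(1-d_i)=1-(1-2d_i)^2\le1$; this is the origin of the constant $4^{-p}$. *)
Lemma pd_det_parallel_le n (Y Z : 'M[C]_n) : pdmx Y -> pdmx Z ->
  4 ^+ n * (\det Y * \det Z) <= \det (Y + Z) ^+ 2.
Proof.
move=> pY pZ; have [L [d [uL -> -> -> d0]]] := pd_simultaneous pY pZ.
rewrite !det_mulmx !det_diag det_adj.
rewrite [X in X <= _](_ : _ = (\det L * (\det L)^*) ^+ 2 *
   \prod_i (4 * (d 0 i * (1 - d 0 i)))).
  rewrite ler_piMr //; first by rewrite -normCK !exprn_ge0.
  apply: prodr_ile1 => i _; have /andP[a b] := d0 i.
  have r : d 0 i \is Num.real by rewrite gtr0_real.
  rewrite !mulr_ge0 ?subr_ge0 ?(ltW a) ?(ltW b) //= -subr_ge0.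
  rewrite (_ : 1 - _ = (1 - d 0 i *+ 2) ^+ 2); last by ring.
  by apply: real_exprn_even_ge0 => //; rewrite rpredB ?rpred1 ?rpredMn.
rewrite !big_split /= prodr_const card_ord.
have -> : \prod_i (const_mx 1 - d) 0 i = \prod_i (1 - d 0 i).
  by apply: eq_bigr => i _; rewrite !mxE.
by ring.
Qed.

(** $|vEv^*|\le\varepsilon(\sum_i|v_i|)^2\le\varepsilon n|v|^2$, and $\varepsilon n<1$ for the
    chosen bound. It makes positive definiteness an open condition on the entries. *)
Lemma pd_near1 n (E : 'M[C]_n) : E^t* = E ->
  (forall i j, `|E i j| <= (n.+1%:R *+ 2)^-1) -> pdmx (1%:M + E).
Proof.
move=> hE bE; split=> [|v v0]; first by rewrite ctrD hE ctr1.
rewrite mulmxDr mulmx1 mulmxDl mxE.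
set x := (v *m E *m v^t*) 0 0; set y := (v *m v^t*) 0 0.
have y0 : 0 < y by rewrite row_norm_gt0.
have xr : x \is Num.real.
  by apply: mx11_adj_real; rewrite !ctrM trmxCK hE mulmxA.
suff : `|x| < y by rewrite real_ltr_norml // => /andP[+ _]; rewrite -subr_gt0 opprK addrC.
have e0 : 0 < (n.+1%:R *+ 2 : C)^-1 by rewrite invr_gt0 pmulrn_lgt0.
pose w i := `|v 0 i|.
have w2 i j : w i * w j *+ 2 <= w i ^+ 2 + w j ^+ 2.
  rewrite -subr_ge0 (_ : _ - _ = (w i - w j) ^+ 2); last by ring.
  by apply: real_exprn_even_ge0 => //; rewrite rpredB // normr_real.
apply: (@le_lt_trans _ _ ((n.+1%:R *+ 2)^-1 * \sum_i \sum_j w i * w j)).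
  rewrite /x mxE (le_trans (ler_norm_sum _ _ _)) // mulr_sumr.
  rewrite [X in _ <= X](eq_bigr (fun i => \sum_j (n.+1%:R *+ 2)^-1 * (w i * w j))); last first.
    by move=> i _; rewrite mulr_sumr.
  rewrite exchange_big; apply: ler_sum => j _; rewrite normrM mxE.
  rewrite (le_trans (ler_wpM2r (normr_ge0 _) (ler_norm_sum _ _ _))) // mulr_suml.
  apply: ler_sum => i _; rewrite normrM !mxE norm_conjC -/(w j) -/(w i) [w i * _]mulrC -mulrA.
  by rewrite mulrCA [w j * _]mulrC ler_wpM2r ?mulr_ge0 ?normr_ge0.
apply: (@le_lt_trans _ _ ((n.+1%:R *+ 2)^-1 * (n%:R * y))).
  rewrite ler_wpM2l ?(ltW e0) //.
  have ey : y = \sum_i w i ^+ 2 by exact: row_normE.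
  rewrite -(ler_pM2r (_ : 0 < 2)) // mulr_suml.
  rewrite (@le_trans _ _ (\sum_i \sum_j (w i ^+ 2 + w j ^+ 2))) //.
    apply: ler_sum => i _; rewrite mulr_suml; apply: ler_sum => j _.
    by rewrite mulr_natr w2.
  rewrite (eq_bigr (fun i => n%:R * w i ^+ 2 + y)).
    by rewrite big_split /= -mulr_sumr -ey sumr_const card_ord -[y *+ n]mulr_natl mulr_natr mulr2n.
  by move=> i _; rewrite big_split /= sumr_const card_ord -ey mulr_natl.
rewrite mulrA gtr_pMl // mulrC ltr_pdivrMr ?pmulrn_lgt0 // mul1r -mulrnA.
by rewrite ltr_nat; lia.
Qed.

(** From $Y^{-1}+Z^{-1}=Y^{-1}(Y+Z)Z^{-1}$. *)
Lemma pd_parallel n (Y Z : 'M[C]_n) : pdmx Y -> pdmx Z ->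
  \det (invmx (invmx Y + invmx Z)) = \det Y * \det Z / \det (Y + Z).
Proof.
move=> pY pZ; have uY := pd_unit pY; have uZ := pd_unit pZ.
have -> : invmx Y + invmx Z = invmx Y *m (Y + Z) *m invmx Z.
  by rewrite mulmxDr mulVmx // mulmxDl mul1mx mulmxK // addrC.
rewrite det_inv !det_mulmx !det_inv.
have Y0 := pd_det pY; have Z0 := pd_det pZ; have D0 := pd_det (pdD pY pZ).
by field; rewrite !gt_eqF.
Qed.

End PositiveDefinite.

(** * Block Hankel matrices and canonical gaps *)

Section HankelSchur.
Variables (C : numClosedFieldType) (p : nat).
Implicit Types (f g s P Q : nat -> 'M[C]_p) (m n b : nat) (u v w : nat -> 'rV[C]_p).

Definition hankel f m := \mxblock_(a < m, b < m) f (a + b)%N.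
Definition hankel_row f m := \mxrow_(b < m) f (m + b)%N.

(** The Schur complement of [hankel f m] in [hankel f m.+1]. The argument of [hankel] counts blocks,
    so that $\underline H_{2m}$ is [hankel s m.+1]. *)
Definition schur f m : 'M[C]_p :=
  f (m + m)%N - hankel_row f m *m invmx (hankel f m) *m (hankel_row f m)^t*.

Definition herm_seq f := forall a, (f a)^t* = f a.

(* [act N P f b] is the integral of P(x) x^b against the functional with
   moments f, for the matrix polynomial P = sum_(a < N) P_a x^a. *)
Definition act N P f b : 'M[C]_p := \sum_(a < N) P a *m f (a + b)%N.

Definition monic_at m P := P m = 1%:M /\ forall a, (m < a)%N -> P a = 0.

Definition monic_orthogonal f m P :=
  monic_at m P /\ forall b, (b < m)%N -> act m.+1 P f b = 0.

Definition mulX P a : 'M[C]_p := if a is a'.+1 then P a' else 0.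

Lemma act_mulX N P f b : act N.+1 (mulX P) f b = act N P f b.+1.
Proof.
rewrite /act big_ord_recl /= mul0mx add0r; apply: eq_bigr => i _.
by rewrite /bump /= add1n addSn addnS.
Qed.

Lemma act_comb N (A B : 'M[C]_p) P Q f b :
  act N (fun a => A *m P a + B *m Q a) f b = A *m act N P f b + B *m act N Q f b.
Proof.
rewrite /act !mulmx_sumr -big_split; apply: eq_bigr => i _.
by rewrite mulmxDl !mulmxA.
Qed.

Lemma actB N P Q f b : act N (fun a => P a - Q a) f b = act N P f b - act N Q f b.
Proof. by rewrite /act -sumrB; apply: eq_bigr => i _; rewrite mulmxBl. Qed.

Lemma act_seqB N P f g b :
  act N P (fun a => f a - g a) b = act N P f b - act N P g b.
Proof. by rewrite /act -sumrB; apply: eq_bigr => i _; rewrite mulmxBr. Qed.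

Lemma act_shift N P f b : act N P (fun a => f a.+1) b = act N P f b.+1.
Proof. by apply: eq_bigr => i _; rewrite addnS. Qed.

Lemma act_widen N N' P f b : (N <= N')%N -> (forall a, (N <= a)%N -> P a = 0) ->
  act N' P f b = act N P f b.
Proof.
move=> lN P0; rewrite /act (big_ord_widen _ (fun a => P a *m f (a + b)%N) lN).
rewrite [RHS]big_mkcond; apply: eq_bigr => i _.
by case: ltnP => // /P0 ->; rewrite mul0mx.
Qed.

Lemma act_monic m P f b : monic_at m P ->
  act m.+1 P f b = act m P f b + f (m + b)%N.
Proof. by case=> P1 _; rewrite /act big_ord_recr /= P1 mul1mx. Qed.

Lemma hankel_herm f m : herm_seq f -> (hankel f m)^t* = hankel f m.
Proof.
move=> hf; apply/matrixP => i j; rewrite !mxE addnC.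
by rewrite -[in RHS](hf (_ + _)%N) !mxE.
Qed.

Lemma hankel_row_adj f m : herm_seq f ->
  (hankel_row f m)^t* = \mxcol_(b < m) f (m + b)%N.
Proof.
by move=> hf; apply/matrixP => i j; rewrite !mxE -[in RHS](hf (_ + _)%N) !mxE.
Qed.

Lemma mxrow_hankel f m P :
  \mxrow_(a < m) P a *m hankel f m = \mxrow_(b < m) act m P f b.
Proof. by rewrite mul_mxrow_mxblock. Qed.

(** Orthogonality determines the lower coefficients through the Hankel system; the Schur complement
    is thus the squared norm of the monic orthogonal polynomial. *)
Lemma schur_monic f m P : herm_seq f -> hankel f m \in unitmx ->
  monic_orthogonal f m P -> schur f m = act m.+1 P f m.
Proof.
move=> hf uH [mP oP].
have eP : \mxrow_(a < m) P a = - (hankel_row f m *m invmx (hankel f m)).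
  rewrite -mulNmx; apply: (canRL (mulmxK uH)); rewrite mxrow_hankel.
  have e b : (b < m)%N -> act m P f b = - f (m + b)%N.
    by move=> bm; apply/eqP; rewrite -subr_eq0 opprK -act_monic // oP.
  by apply/matrixP => i j; rewrite !mxE e // mxE.
rewrite act_monic // /schur addrC; congr (_ + _).
rewrite -mulNmx -eP hankel_row_adj // mul_mxrow_mxcol.
by apply: eq_bigr => i _; rewrite addnC.
Qed.

Lemma monic_orthogonal_exists f m : hankel f m \in unitmx ->
  exists P, monic_orthogonal f m P.
Proof.
move=> uH; pose V := - (hankel_row f m *m invmx (hankel f m)).
pose P a : 'M[C]_p := if insub a is Some i then submxrow V (i : 'I_m)
                      else if a == m then 1%:M else 0.
have mP : monic_at m P.
  split; first by rewrite /P insubF ?ltnn // eqxx.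
  move=> a ma; rewrite /P insubF ?ltnNge ?(ltnW ma) //.
  by rewrite gtn_eqF.
have eP : \mxrow_(a < m) P a = V.
  rewrite -[RHS]submxrowK; apply: eq_mxrow => i; rewrite /P.
  by rewrite insubT //= => hi; congr submxrow; apply/val_inj.
exists P; split=> // b bm; rewrite act_monic //.
have : \mxrow_(a < m) P a *m hankel f m = - hankel_row f m.
  by rewrite eP mulNmx mulmxKV.
rewrite mxrow_hankel /hankel_row.
have -> : - \mxrow_(c < m) f (m + c)%N = \mxrow_(c < m) - f (m + c)%N.
  by apply/matrixP => i j; rewrite !mxE.
move=> /eq_mxrowP/(_ (Ordinal bm)) /= ->.
by rewrite addNr.
Qed.

(** The Hankel form on vector polynomials $\sum_a u_ax^a$. Sequences of row vectors let the degree
    vary without casts between block matrices of different sizes. *)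
Definition hform f m u v : 'M[C]_1 :=
  \sum_(a < m) \sum_(b < m) u a *m f (a + b)%N *m (v b)^t*.

Lemma hform_hankel f m u v :
  \mxrow_(a < m) u a *m hankel f m *m (\mxrow_(a < m) v a)^t* = hform f m u v.
Proof.
rewrite mul_mxrow_mxblock.
have -> : (\mxrow_(a < m) v a)^t* = \mxcol_(a < m) (v a)^t*.
  by apply/matrixP => i j; rewrite !mxE.
rewrite mul_mxrow_mxcol /hform exchange_big; apply: eq_bigr => b _.
by rewrite mulmx_suml.
Qed.

Lemma hformDl f m u v w :
  hform f m (fun a => u a + v a) w = hform f m u w + hform f m v w.
Proof.
rewrite /hform -big_split; apply: eq_bigr => a _; rewrite -big_split.
by apply: eq_bigr => b _; rewrite !mulmxDl.
Qed.

Lemma hform_adj f m u v : herm_seq f -> (hform f m u v)^t* = hform f m v u.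
Proof.
move=> hf; rewrite /hform ctr_sum.
rewrite (eq_bigr (fun a : 'I_m => \sum_(b < m) (u a *m f (a + b)%N *m (v b)^t*)^t*)); last first.
  by move=> a _; rewrite ctr_sum.
rewrite exchange_big; apply: eq_bigr => b _; apply: eq_bigr => a _.
by rewrite !ctrM trmxCK hf mulmxA addnC.
Qed.

Lemma hformDr f m u v w : herm_seq f ->
  hform f m w (fun a => u a + v a) = hform f m w u + hform f m w v.
Proof. by move=> hf; rewrite -hform_adj // hformDl ctrD !hform_adj. Qed.

Lemma hform_rec f m u v : (forall i, i = m -> u i = 0) -> (forall i, i = m -> v i = 0) ->
  hform f m.+1 u v = hform f m u v.
Proof.
move=> u0 v0; rewrite /hform big_ord_recr /= [X in _ + X]big1 ?addr0; last first.
  by move=> b _; rewrite u0 // !mul0mx.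
by apply: eq_bigr => a _; rewrite big_ord_recr /= v0 // ctr0 mulmx0 addr0.
Qed.

Lemma hform_act f m (x : 'rV[C]_p) P v :
  hform f m (fun a => x *m P a) v = \sum_(b < m) x *m act m P f b *m (v b)^t*.
Proof.
rewrite /hform exchange_big; apply: eq_bigr => b _.
rewrite mulmx_sumr mulmx_suml; apply: eq_bigr => a _.
by rewrite !mulmxA.
Qed.

Lemma pd_hankelP f m : herm_seq f ->
  pdmx (hankel f m) <->
  forall u, (exists2 a, (a < m)%N & u a != 0) -> 0 < hform f m u u 0 0.
Proof.
move=> hf; split=> [[_ h] u [a am ua]|h].
  rewrite -hform_hankel; apply: h; apply: contra ua => /eqP e.
  have := mxrowK (fun i : 'I_m => u i) (Ordinal am).
  by rewrite e => <-; apply/eqP/matrixP => i j; rewrite !mxE.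
split=> [|v v0]; first exact: hankel_herm.
pose u a := if insub a is Some i then submxrow v (i : 'I_m) else 0.
have eu : \mxrow_(a < m) u a = v.
  rewrite -[RHS]submxrowK; apply: eq_mxrow => i; rewrite /u.
  by rewrite insubT //= => hi; congr submxrow; apply/val_inj.
rewrite -eu hform_hankel; apply: h; apply/not_exists2P => nu.
have u0 (i : 'I_m) : u i = 0.
  by case: (nu i) => [|/negP]; rewrite ?ltn_ord // negbK => /eqP.
by move/eqP: v0; apply; rewrite -eu; apply/matrixP => i j; rewrite !mxE u0 mxE.
Qed.

(** The multiple [u m *m P] of the orthogonal polynomial carries the whole leading coefficient; the
    remainder has lower degree and is orthogonal to it. *)
Lemma hform_complete_square f m P u : herm_seq f -> monic_orthogonal f m P ->
  hform f m.+1 u u = u m *m act m.+1 P f m *m (u m)^t*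
    + hform f m (fun a => u a - u m *m P a) (fun a => u a - u m *m P a).
Proof.
move=> hf [mP oP]; pose w a := u a - u m *m P a.
have wm i : i = m -> w i = 0 by move=> ->; rewrite /w mP.1 mulmx1 subrr.
pose xP a := u m *m P a.
have eu : u = (fun a => xP a + w a) by apply/funext => a; rewrite /w addrC subrK.
have hx v : hform f m.+1 xP v = u m *m act m.+1 P f m *m (v m)^t*.
  rewrite hform_act big_ord_recr /= big1 ?add0r // => b _.
  by rewrite oP // mulmx0 mul0mx.
have -> : hform f m.+1 u u = hform f m.+1 xP xP + hform f m.+1 xP w
    + (hform f m.+1 w xP + hform f m.+1 w w).
  by rewrite {1 2}eu hformDl !hformDr.
rewrite !hx wm // ctr0 mulmx0 addr0.
rewrite -(hform_adj m.+1 xP w hf) hx wm // ctr0 mulmx0 ctr0 add0r.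
by rewrite /xP mP.1 mulmx1 hform_rec.
Qed.

Lemma pd_hankelS f m : herm_seq f ->
  pdmx (hankel f m.+1) <-> pdmx (hankel f m) /\ pdmx (schur f m).
Proof.
move=> hf; split=> [pH|[pH pS]].
  have pHm : pdmx (hankel f m).
    apply/pd_hankelP => // u [a am ua].
    pose v b := if (b < m)%N then u b else 0.
    have vm i : i = m -> v i = 0 by move=> ->; rewrite /v ltnn.
    have -> : hform f m u u = hform f m.+1 v v.
      rewrite hform_rec //; apply: eq_bigr => i _; apply: eq_bigr => j _.
      by rewrite /v !ltn_ord.
    by move/(pd_hankelP _ hf): pH; apply; exists a; [exact: leqW|rewrite /v am].
  split=> //; have [P oP] := monic_orthogonal_exists (pd_unit pHm).
  split=> [|x x0].
    rewrite /schur ctrB hf !ctrM ctr_inv hankel_herm // trmxCK.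
    by rewrite !mulmxA.
  rewrite (schur_monic hf (pd_unit pHm) oP).
  (* The polynomial $xP$ tests the Schur complement: after completing the square, its form is that
     of the complement at $x$. *)
  have /pd_hankelP-/(_ hf (fun a => x *m P a)) := pH.
  have h : exists2 a, (a < m.+1)%N & x *m P a != 0.
    by exists m => //; rewrite oP.1.1 mulmx1.
  move=> /(_ h); rewrite (hform_complete_square _ hf oP) oP.1.1 mulmx1.
  rewrite [hform _ _ _ _]big1 ?addr0 // => a _.
  by rewrite big1 // => b _; rewrite subrr !mul0mx.
have [P oP] := monic_orthogonal_exists (pd_unit pH).
apply/pd_hankelP => // u [a am ua].
rewrite (hform_complete_square _ hf oP) -(schur_monic hf (pd_unit pH) oP) mxE.
have [um|um] := eqVneq (u m) 0.
  rewrite um !mul0mx mxE add0r; move/(pd_hankelP _ hf): pH; apply.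
  exists a; last by rewrite mul0mx subr0.
  by move: am; rewrite ltnS leq_eqVlt => /orP[/eqP ea|//]; rewrite ea um eqxx in ua.
rewrite ltr_pwDl ?pS.2 // -hform_hankel.
by have /pd_psd/psdP[_] := pH; apply.
Qed.

Lemma pd_hankel0 f : herm_seq f -> pdmx (hankel f 0).
Proof. by move=> hf; apply/pd_hankelP => // u [a]. Qed.

Lemma pd_hankel_schur f m : herm_seq f ->
  pdmx (hankel f m) <-> forall i, (i < m)%N -> pdmx (schur f i).
Proof.
move=> hf; elim: m => [|m IH]; first by split=> // _; exact: pd_hankel0.
rewrite pd_hankelS // IH; split=> [[h hm] i|h].
  by rewrite ltnS leq_eqVlt => /orP[/eqP->//|/h].
by split=> [i im|]; apply: h; rewrite ?(ltnW im) // ltnW.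
Qed.

End HankelSchur.

(** * The gaps as Schur complements, and the recurrence between consecutive gaps *)

Section CanonicalGaps.
Variables (C : numClosedFieldType) (p : nat).
Implicit Types (f g s : nat -> 'M[C]_p) (m n j : nat).

(** The four Hankel families belong to the weights $1$, $x$, $1-x$ and $x(1-x)$: [lower_seq] takes
    $1$ for even and $x$ for odd index, [upper_seq] takes $x(1-x)$ and $1-x$ respectively. *)
Definition lower_seq s j a := if odd j then s a.+1 else s a.
Definition upper_seq s j a := if odd j then s a - s a.+1 else s a.+1 - s a.+2.

(* S_j - S_j^-, S_j^+ - S_j and S_j^+ - S_j^- *)
Definition lower_gap s j := schur (lower_seq s j) j./2.
Definition upper_gap s j := schur (upper_seq s j) j.-1./2.
Definition gap s j := lower_gap s j + upper_gap s j.

(** For Hermitian sequences this turns out to describe the interior of the moment space. *)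
Definition good s n := forall j, (0 < j <= n)%N ->
  pdmx (lower_gap s j) /\ pdmx (upper_gap s j).

Lemma half_odd m : (m.*2.+1)./2 = m. Proof. lia. Qed.
Lemma half_even m : (m.*2.+2)./2 = m.+1. Proof. lia. Qed.
Lemma half_dbl m : (m.*2)./2 = m. Proof. lia. Qed.

Lemma pos_parity j : (0 < j)%N -> (exists m, j = m.*2.+1) \/ (exists m, j = m.*2.+2).
Proof.
move=> j0; case: (boolP (odd j)) => oj; [left|right].
  by exists j./2; lia.
by exists j.-1./2; lia.
Qed.

Lemma lower_gap_odd s m : lower_gap s m.*2.+1 = schur (fun a => s a.+1) m.
Proof. by rewrite /lower_gap half_odd; congr schur; apply/funext => a; rewrite /lower_seq /= odd_double. Qed.

Lemma lower_gap_even s m : lower_gap s m.*2.+2 = schur s m.+1.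
Proof. by rewrite /lower_gap half_even; congr schur; apply/funext => a; rewrite /lower_seq /= odd_double. Qed.

Lemma upper_gap_odd s m : upper_gap s m.*2.+1 = schur (fun a => s a - s a.+1) m.
Proof. by rewrite /upper_gap half_dbl; congr schur; apply/funext => a; rewrite /upper_seq /= odd_double. Qed.

Lemma upper_gap_even s m : upper_gap s m.*2.+2 = schur (fun a => s a.+1 - s a.+2) m.
Proof. by rewrite /upper_gap half_odd; congr schur; apply/funext => a; rewrite /upper_seq /= odd_double. Qed.

Lemma schur0 f : schur f 0 = f 0%N.
Proof.
rewrite /schur (_ : _ *m _ = 0) ?subr0 //; apply/matrixP => i j; rewrite !mxE big1 //.
by move=> k _; exfalso; move: k; rewrite big_ord0 => -[].
Qed.

Lemma herm_seqS s : herm_seq s -> herm_seq (fun a => s a.+1).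
Proof. by move=> h a; apply: h. Qed.

Lemma herm_seqB f g : herm_seq f -> herm_seq g -> herm_seq (fun a => f a - g a).
Proof. by move=> hf hg a; rewrite ctrB hf hg. Qed.

Lemma good_le s n n' : (n <= n')%N -> good s n' -> good s n.
Proof. by move=> h H j /andP[j0 jn]; apply: H; rewrite j0 (leq_trans jn). Qed.

(** The gaps are the successive Schur complements of the four Hankel families, each index
    contributing one lower and one upper complement. *)
Lemma good_hankels s n : s 0%N = 1%:M -> herm_seq s -> good s n <->
  [/\ forall m, (m.*2 <= n)%N -> pdmx (hankel s m.+1),
      forall m, (m.*2.+1 <= n)%N -> pdmx (hankel (fun a => s a.+1) m.+1),
      forall m, (m.*2.+1 <= n)%N -> pdmx (hankel (fun a => s a - s a.+1) m.+1)
    & forall m, (m.*2.+2 <= n)%N -> pdmx (hankel (fun a => s a.+1 - s a.+2) m.+1)].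
Proof.
move=> s0 hs; have hs1 := herm_seqS hs.
have hg0 := herm_seqB hs hs1; have hg1 := herm_seqS hg0.
split=> [G|[h1 h2 h3 h4] j /andP[j0 jn]].
  split=> m mn; apply/pd_hankel_schur => // i im.
  (* The weight $1$ has one Schur complement that is not a gap, namely the first, $S_0=I_p$. *)
  - case: i im => [|i] im; first by rewrite schur0 s0; apply: pd1.
    by rewrite -lower_gap_even; have [|//] := G i.*2.+2; lia.
  - by rewrite -lower_gap_odd; have [|//] := G i.*2.+1; lia.
  - by rewrite -upper_gap_odd; have [|//] := G i.*2.+1; lia.
  - by rewrite -upper_gap_even; have [|//] := G i.*2.+2; lia.
case: (pos_parity j0) => -[m jm]; move: jn; rewrite jm => jn.
  rewrite lower_gap_odd upper_gap_odd; split.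
    by have /pd_hankel_schur-/(_ hs1 m) := h2 m jn; apply.
  by have /pd_hankel_schur-/(_ hg0 m) := h3 m jn; apply.
rewrite lower_gap_even upper_gap_even; split.
  have /h1 : (m.+1.*2 <= n)%N by lia.
  by move=> /pd_hankel_schur-/(_ hs m.+1); apply.
by have /pd_hankel_schur-/(_ hg1 m) := h4 m jn; apply.
Qed.

Lemma schur_orthogonal f m : herm_seq f -> pdmx (hankel f m) ->
  exists2 P, monic_orthogonal f m P & schur f m = act m.+1 P f m.
Proof.
move=> hf pH; have [P oP] := monic_orthogonal_exists (pd_unit pH).
by exists P => //; apply: schur_monic (pd_unit pH) oP.
Qed.

Lemma subr_telescope (V : zmodType) (a b c e : V) :
  a + (b - c) + (e + c - (a + b)) = e.
Proof.
have -> : e + c - (a + b) = e - (a + (b - c)) by rewrite addrA opprB addrA.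
by rewrite addrC subrK.
Qed.

(* With P and Q the monic orthogonal polynomials of the two gaps of index j,
   suitable combinations of P, xP, Q and xQ with the weights D Y^-1 and D Z^-1
   are the monic orthogonal polynomials of the gaps of index j + 1. *)
Lemma gap_recurrence s j : s 0%N = 1%:M -> herm_seq s -> (0 < j)%N -> good s j ->
  gap s j.+1 = invmx (invmx (lower_gap s j) + invmx (upper_gap s j)).
Proof.
move=> s0 hs j0 G; have [pY pZ] : pdmx (lower_gap s j) /\ pdmx (upper_gap s j).
  by apply: G; rewrite j0 leqnn.
have hs1 := herm_seqS hs.
have hg0 := herm_seqB hs hs1; have hg1 := herm_seqS hg0.
set Y := lower_gap s j in pY *; set Z := upper_gap s j in pZ *.
set D := invmx _.
have uY := pd_unit pY; have uZ := pd_unit pZ.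
have uS := pd_unit (pdD (pd_inv pY) (pd_inv pZ)).
(* $A+B=I_p$ keeps the combinations monic, and $AY=BZ=D$ makes the boundary terms cancel. *)
set A := D *m invmx Y; set B := D *m invmx Z.
have AB : A + B = 1%:M by rewrite -mulmxDr mulVmx.
have AY : A *m Y = D by rewrite mulmxKV.
have BZ : B *m Z = D by rewrite mulmxKV.
have [H1 H2 H3 H4] := (good_hankels _ s0 hs).1 G.
have hpd0 f : herm_seq f -> pdmx (hankel f 0) by apply: pd_hankel0.
case: (pos_parity j0) => -[m jm].
  have pHs : pdmx (hankel s m.+1) by apply: H1; lia.
  have pH1 : pdmx (hankel (fun a => s a.+1) m).
    by have [] // := (pd_hankelS m hs1).1 (H2 m _); lia.
  have pH0 : pdmx (hankel (fun a => s a - s a.+1) m).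
    by have [] // := (pd_hankelS m hg0).1 (H3 m _); lia.
  have pHg1 : pdmx (hankel (fun a => s a.+1 - s a.+2) m).
    by case: (m) jm => [|m'] jm; [exact: hpd0|apply: H4; lia].
  have [P [mP oP] eY] := schur_orthogonal hs1 pH1.
  have [Q [mQ oQ] eZ] := schur_orthogonal hg0 pH0.
  pose q b := act m.+1 P s b; pose r b := act m.+1 Q s b.
  have EY : Y = q m.+1 by rewrite /Y jm lower_gap_odd eY act_shift.
  have EZ : Z = r m - r m.+1 by rewrite /Z jm upper_gap_odd eZ act_seqB act_shift.
  have q0 b : (b < m)%N -> q b.+1 = 0 by move=> bm; rewrite -(oP b bm) act_shift.
  have r0 b : (b < m)%N -> r b = r b.+1.
    by move=> bm; apply/eqP; rewrite -subr_eq0 -(oQ b bm) act_seqB act_shift.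
  (* For odd index [P] and [Q] belong to the weights $x$ and $1-x$; then $AP+BQ$ is orthogonal for
     $x(1-x)$ and $AxP+B(x-1)Q$ for $1$. *)
  pose U a := A *m P a + B *m Q a.
  pose T a := A *m mulX P a + B *m (mulX Q a - Q a).
  have aU b : act m.+1 U s b = A *m q b + B *m r b by rewrite act_comb.
  have aT b : act m.+2 T s b = A *m q b.+1 + B *m (r b.+1 - r b).
    rewrite act_comb actB !act_mulX; congr (_ + _ *m (_ - _)).
    by apply: act_widen => // a ma; apply: mQ.2.
  have oU : monic_orthogonal (fun a => s a.+1 - s a.+2) m U.
    split; first split.
    - by rewrite /U mP.1 mQ.1 !mulmx1.
    - by move=> a ma; rewrite /U mP.2 ?mQ.2 // !mulmx0 addr0.
    move=> b bm; rewrite (act_seqB _ _ (fun a => s a.+1) (fun a => s a.+2)).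
    rewrite (act_shift _ _ (fun a => s a.+1)) !act_shift !aU q0 // mulmx0 add0r.
    have [bm1|mb] := ltnP b.+1 m; first by rewrite q0 // mulmx0 add0r (r0 _ bm1) subrr.
    have -> : b.+1 = m by lia.
    rewrite -EY opprD addrCA -mulmxBr -EZ AY BZ addNr //.
  have oT : monic_orthogonal s m.+1 T.
    split; first split.
    - by rewrite /T /= mP.1 mQ.1 mQ.2 // subr0 !mulmx1.
    - move=> [//|a] ma; rewrite /T /= mP.2 // !mQ.2 ?(ltnW ma) //.
      by rewrite subr0 !mulmx0 addr0.
    move=> b; rewrite ltnS leq_eqVlt aT => /orP[/eqP->|bm].
      by rewrite -EY -opprB -EZ mulmxN AY BZ subrr.
    by rewrite q0 ?leqW // (r0 b bm) subrr !mulmx0 addr0.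
  rewrite /gap jm lower_gap_even upper_gap_even.
  rewrite (schur_monic hs (pd_unit pHs) oT) (schur_monic hg1 (pd_unit pHg1) oU).
  rewrite (act_seqB _ _ (fun a => s a.+1) (fun a => s a.+2)).
  rewrite (act_shift _ _ (fun a => s a.+1)) !act_shift !aU aT mulmxBr.
  (* The two new squared norms telescope to $AY=D$. *)
  by rewrite subr_telescope -EY AY.
have pHs : pdmx (hankel s m.+1) by apply: H1; lia.
have pH1 : pdmx (hankel (fun a => s a.+1) m.+1) by apply: H2; lia.
have pH0 : pdmx (hankel (fun a => s a - s a.+1) m.+1) by apply: H3; lia.
have pHg1 : pdmx (hankel (fun a => s a.+1 - s a.+2) m).
  by case: (m) jm => [|m'] jm; [exact: hpd0|apply: H4; lia].
have [P [mP oP] eY] := schur_orthogonal hs pHs.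
have [Q [mQ oQ] eZ] := schur_orthogonal hg1 pHg1.
pose q b := act m.+2 P s b; pose r b := act m.+1 Q s b.
have aQ b : act m.+1 Q (fun a => s a.+1 - s a.+2) b = r b.+1 - r b.+2.
  rewrite (act_seqB _ _ (fun a => s a.+1) (fun a => s a.+2)).
  by rewrite (act_shift _ _ (fun a => s a.+1)) !act_shift.
have EY : Y = q m.+1 by rewrite /Y jm lower_gap_even eY.
have EZ : Z = r m.+1 - r m.+2 by rewrite /Z jm upper_gap_even eZ aQ.
have q0 b : (b < m.+1)%N -> q b = 0 by move=> bm; rewrite -(oP b bm).
have r0 b : (b < m)%N -> r b.+1 = r b.+2.
  by move=> bm; apply/eqP; rewrite -subr_eq0 -aQ oQ.
(* For even index the weights are $1$ and $x(1-x)$; then $AP+BxQ$ is orthogonal for $1-x$ and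
   $AP+B(x-1)Q$ for $x$. *)
pose U a := A *m P a + B *m mulX Q a.
pose T a := A *m P a + B *m (mulX Q a - Q a).
have aU b : act m.+2 U s b = A *m q b + B *m r b.+1.
  by rewrite act_comb act_mulX.
have aT b : act m.+2 T s b = A *m q b + B *m (r b.+1 - r b).
  rewrite act_comb actB !act_mulX; congr (_ + _ *m (_ - _)).
  by apply: act_widen => // a ma; apply: mQ.2.
have oU : monic_orthogonal (fun a => s a - s a.+1) m.+1 U.
  split; first split.
  - by rewrite /U /= mP.1 mQ.1 !mulmx1.
  - by move=> [//|a] ma; rewrite /U /= mP.2 // mQ.2 // !mulmx0 addr0.
  move=> b; rewrite ltnS leq_eqVlt act_seqB act_shift !aU => /orP[/eqP->|bm].
    rewrite -EY q0 // mulmx0 add0r opprD addrCA -mulmxBr -EZ AY BZ addNr //.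
  by rewrite (q0 b) ?leqW // (q0 b.+1) // (r0 b bm) !mulmx0 subrr.
have oT : monic_orthogonal (fun a => s a.+1) m.+1 T.
  split; first split.
  - by rewrite /T /= mP.1 mQ.1 mQ.2 // subr0 !mulmx1.
  - move=> [//|a] ma; rewrite /T /= mP.2 // !mQ.2 ?(ltnW ma) //.
    by rewrite subr0 !mulmx0 addr0.
  move=> b; rewrite ltnS leq_eqVlt act_shift aT => /orP[/eqP->|bm].
    by rewrite -EY -opprB -EZ mulmxN AY BZ subrr.
  by rewrite (q0 b.+1 bm) -(r0 b bm) subrr !mulmx0 addr0.
rewrite /gap jm -doubleS lower_gap_odd upper_gap_odd.
rewrite (schur_monic hs1 (pd_unit pH1) oT) (schur_monic hg0 (pd_unit pH0) oU).
by rewrite act_seqB !act_shift !aU aT mulmxBr subr_telescope -EY AY.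
Qed.

End CanonicalGaps.

(** * Determinant bounds for the gaps and extension by midpoints *)

Section GapBounds.
Variables (C : numClosedFieldType) (p : nat).
Implicit Types (f g s t : nat -> 'M[C]_p) (m n j : nat).

Definition hankel_corr f m : 'M[C]_p :=
  hankel_row f m *m invmx (hankel f m) *m (hankel_row f m)^t*.

(* S_j^- and S_j^+ *)
Definition lower_bound s j := hankel_corr (lower_seq s j) j./2.
Definition upper_bound s j := s j.-1 - hankel_corr (upper_seq s j) j.-1./2.

Lemma lower_gapE s j : lower_gap s j = s j - lower_bound s j.
Proof.
rewrite /lower_gap /schur -/(hankel_corr _ _) -/(lower_bound _ _).
congr (_ - _); rewrite /lower_seq.
by case: (boolP (odd j)) => oj; congr (s _); lia.
Qed.

Lemma upper_gapE s j : (0 < j)%N -> upper_gap s j = upper_bound s j - s j.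
Proof.
move=> j0; rewrite /upper_gap /schur -/(hankel_corr _ _) /upper_bound.
rewrite addrAC; congr (_ - _).
case: (pos_parity j0) => -[m ->]; rewrite /upper_seq /= odd_double /= ?half_dbl ?uphalf_double.
  by rewrite addnn.
by rewrite addnn.
Qed.

Lemma gapE s j : (0 < j)%N -> gap s j = upper_bound s j - lower_bound s j.
Proof. by move=> j0; rewrite /gap lower_gapE upper_gapE // addrC addrA subrK. Qed.

Lemma hankel_corr_ext f g m :
  (forall a, (a < m + m)%N -> f a = g a) -> hankel_corr f m = hankel_corr g m.
Proof.
move=> e; rewrite /hankel_corr; have -> : hankel_row f m = hankel_row g m.
  by apply: eq_mxrow => b; apply: e; rewrite ltn_add2l.
suff -> : hankel f m = hankel g m by [].
by apply: eq_mxblock => a b; apply: e; have := ltn_ord a; have := ltn_ord b; lia.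
Qed.

(** $S_j^-$ involves only the moments before $S_j$. With its companion for $S_j^+$, this says that
    $S_j$ moves between fixed end points when the earlier moments are fixed, which allows it to be
    integrated out. *)
Lemma lower_bound_ext s t j :
  (forall a, (a < j)%N -> s a = t a) -> lower_bound s j = lower_bound t j.
Proof.
move=> e; apply: hankel_corr_ext => a aj; rewrite /lower_seq.
by case: (boolP (odd j)) => oj; apply: e; lia.
Qed.

Lemma upper_bound_ext s t j : (0 < j)%N ->
  (forall a, (a < j)%N -> s a = t a) -> upper_bound s j = upper_bound t j.
Proof.
move=> j0 e; rewrite /upper_bound e; last lia; congr (_ - _).
apply: hankel_corr_ext => a aj; rewrite /upper_seq.
by case: (boolP (odd j)) => oj; rewrite !e //; lia.
Qed.

Lemma gap_ext s t j : (0 < j)%N ->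
  (forall a, (a < j)%N -> s a = t a) -> gap s j = gap t j.
Proof.
by move=> j0 e; rewrite !gapE // (lower_bound_ext e) (upper_bound_ext j0 e).
Qed.

Lemma goodS s j : good s j.+1 <->
  good s j /\ pdmx (lower_gap s j.+1) /\ pdmx (upper_gap s j.+1).
Proof.
split=> [G|[G H] i /andP[i0]]; first by split; [exact: good_le G|exact: (G j.+1 (leqnn _))].
by rewrite leq_eqVlt => /orP[/eqP->//|ij]; apply: G; rewrite i0.
Qed.

Lemma good0 s : good s 0.
Proof. by move=> j; lia. Qed.

Lemma good_ext s t n : (forall a, (a <= n)%N -> s a = t a) -> good s n -> good t n.
Proof.
move=> e G j /andP[j0 jn].
have e' a : (a < j)%N -> s a = t a by move=> aj; apply: e; lia.
have := G j; rewrite j0 jn => /(_ isT).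
rewrite !lower_gapE !upper_gapE // (lower_bound_ext e') (upper_bound_ext j0 e').
by rewrite e.
Qed.

Lemma gap1 s : s 0%N = 1%:M -> gap s 1 = 1%:M.
Proof.
move=> s0; rewrite /gap (lower_gap_odd s 0) (upper_gap_odd s 0) !schur0 s0.
by rewrite addrC subrK.
Qed.

Section Good.
Variables (s : nat -> 'M[C]_p) (s0 : s 0%N = 1%:M) (hs : herm_seq s).

Lemma pd_gap j : good s j -> pdmx (gap s j.+1).
Proof.
case: j => [|j] G; first by rewrite gap1 //; apply: pd1.
rewrite gap_recurrence //; have [pY pZ] := G j.+1 (leqnn _).
by apply/pd_inv/pdD; apply: pd_inv.
Qed.

Lemma det_gapS j : (0 < j)%N -> good s j ->
  \det (gap s j.+1) = \det (lower_gap s j) * \det (upper_gap s j) / \det (gap s j).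
Proof.
move=> j0 G; rewrite gap_recurrence //; apply: pd_parallel;
by have [] := G j; rewrite ?j0 ?leqnn.
Qed.

Lemma det_lower_gap_le j : (0 < j)%N -> good s j ->
  \det (lower_gap s j) <= \det (gap s j) /\ \det (upper_gap s j) <= \det (gap s j).
Proof.
move=> j0 G; have [pY pZ] : pdmx (lower_gap s j) /\ pdmx (upper_gap s j).
  by apply: G; rewrite j0 leqnn.
by split; [exact: pd_det_le|rewrite /gap addrC; exact: pd_det_le].
Qed.

(** $\det D_{j+1}=\det Y\det Z/\det D_j$, and neither $\det Y$ nor $\det Z$ exceeds $\det D_j$. *)
Lemma det_gap_le_gaps j : (0 < j)%N -> good s j ->
  \det (gap s j.+1) <= \det (lower_gap s j) /\
  \det (gap s j.+1) <= \det (upper_gap s j).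
Proof.
move=> j0 G; have [pY pZ] : pdmx (lower_gap s j) /\ pdmx (upper_gap s j).
  by apply: G; rewrite j0 leqnn.
have [leY leZ] := det_lower_gap_le j0 G.
have Y0 := pd_det pY; have Z0 := pd_det pZ; have D0 := pd_det (pdD pY pZ).
rewrite det_gapS // !ler_pdivrMr // ler_pM2l // mulrC ler_pM2l //.
Qed.

Lemma det_gap_decr j : good s j -> (0 < j)%N -> \det (gap s j.+1) <= \det (gap s j).
Proof.
move=> G j0; have [h _] := det_gap_le_gaps j0 G.
by have [h' _] := det_lower_gap_le j0 G; apply: le_trans h h'.
Qed.

Lemma det_gap_anti i j : good s j -> (i <= j)%N ->
  \det (gap s j.+1) <= \det (gap s i.+1).
Proof.
elim: j => [|j IH] G; first by rewrite leqn0 => /eqP->.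
rewrite leq_eqVlt => /orP[/eqP->//|ij].
apply: le_trans (IH _ ij); last exact: good_le G.
exact: det_gap_decr.
Qed.

Lemma det_gap_le j : good s j -> \det (gap s j.+1) <= ((4 ^+ p)^-1) ^+ j.
Proof.
elim: j => [|j IH] G; first by rewrite gap1 // det1 expr0.
have pD : pdmx (gap s j.+1) by apply: pd_gap; exact: good_le G.
have [pY pZ] := G j.+1 (leqnn _).
have d0 := pd_det pD.
rewrite det_gapS // exprS; apply: le_trans (ler_wpM2l _ (IH (good_le _ G))) => //.
rewrite ler_pdivrMr // -mulrA -expr2 ler_pdivlMl ?exprn_gt0 //.
exact: pd_det_parallel_le.
Qed.

(** These are the matrices inverted in $S_{j+1}^\pm$; their positivity makes the gaps of index $j+1$
    continuous at a good sequence. *)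
Lemma pd_hankels_next j : good s j ->
  pdmx (hankel (lower_seq s j.+1) j.+1./2) /\ pdmx (hankel (upper_seq s j.+1) j./2).
Proof.
move=> G; have [H1 H2 H3 H4] := (good_hankels _ s0 hs).1 G.
have hs1 := herm_seqS hs; have hg0 := herm_seqB hs hs1; have hg1 := herm_seqS hg0.
have [[m jm]|[m jm]] := pos_parity (ltn0Sn j).
  have -> : lower_seq s j.+1 = fun a => s a.+1.
    by apply/funext => a; rewrite /lower_seq jm /= odd_double.
  have -> : upper_seq s j.+1 = fun a => s a - s a.+1.
    by apply/funext => a; rewrite /upper_seq jm /= odd_double.
  have [-> ->] : j.+1./2 = m /\ j./2 = m by lia.
  case: m jm => [|m] jm; first by split; apply: pd_hankel0.
  by split; [apply: H2|apply: H3]; lia.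
have -> : lower_seq s j.+1 = s.
  by apply/funext => a; rewrite /lower_seq jm /= odd_double.
have -> : upper_seq s j.+1 = fun a => s a.+1 - s a.+2.
  by apply/funext => a; rewrite /upper_seq jm /= odd_double.
have [-> ->] : j.+1./2 = m.+1 /\ j./2 = m by lia.
split; first by apply: H1; lia.
case: m jm => [|m] jm; first exact: pd_hankel0.
by apply: H4; lia.
Qed.

Lemma hankel_corr_psd f m : pdmx (hankel f m) -> psdmx (hankel_corr f m).
Proof. by move=> /pd_inv/pd_psd; apply: psd_congr. Qed.

Lemma hankel_corr_adj f m : herm_seq f -> (hankel_corr f m)^t* = hankel_corr f m.
Proof. by move=> hf; rewrite !ctrM ctr_inv hankel_herm // trmxCK mulmxA. Qed.

Lemma lower_seq_herm j : herm_seq (lower_seq s j).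
Proof. by rewrite /lower_seq => a; case: ifP. Qed.

Lemma upper_seq_herm j : herm_seq (upper_seq s j).
Proof. by rewrite /upper_seq => a; case: ifP => _; rewrite ctrB !hs. Qed.

Lemma lower_bound_herm j : (lower_bound s j)^t* = lower_bound s j.
Proof. exact/hankel_corr_adj/lower_seq_herm. Qed.

Lemma upper_bound_herm j : (upper_bound s j)^t* = upper_bound s j.
Proof. by rewrite /upper_bound ctrB hs hankel_corr_adj //; apply: upper_seq_herm. Qed.

(** Each matrix is a positive definite gap plus a nonnegative definite correction $hH^{-1}h^*$. Good
    moments thus decrease from $I_p$ while staying positive, which bounds their entries. *)
Lemma good_pd j : good s j.+1 -> pdmx (s j.+1) /\ pdmx (s j - s j.+1).
Proof.
move=> /goodS[/pd_hankels_next[/hankel_corr_psd h1 /hankel_corr_psd h2] [pY pZ]].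
split.
  by have -> : s j.+1 = lower_gap s j.+1 + lower_bound s j.+1;
    [rewrite lower_gapE subrK|apply: pd_add_psd].
have -> : s j - s j.+1 = upper_gap s j.+1 + hankel_corr (upper_seq s j.+1) j./2.
  by rewrite upper_gapE // /upper_bound /= addrAC subrK.
exact: pd_add_psd.
Qed.

Lemma good_pd_le1 j : good s j.+1 -> pdmx (1%:M - s j.+1).
Proof.
elim: j => [|j IH] G; have [_ h] := good_pd G; first by rewrite -s0.
rewrite -(subrK (s j.+1) 1%:M) -addrA; apply: pdD h.
by apply: IH; exact: good_le G.
Qed.

End Good.

(** With $A=LL^*$ the rows of $L$ have norm at most $1$, and the inequality $2|xy|\le|x|^2+|y|^2$
    bounds their products. *)
Lemma pd_entry_le1 n (A : 'M[C]_n) (i j : 'I_n) :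
  pdmx A -> pdmx (1%:M - A) -> `|A i j| <= 1.
Proof.
move=> pA pB; have [L [_ _ eA]] := cholesky pA.
have diag k : \sum_c `|L k c| ^+ 2 <= 1.
  have -> : \sum_c `|L k c| ^+ 2 = A k k.
    by rewrite eA mxE; apply: eq_bigr => c _; rewrite !mxE normCK.
  have d0 : delta_mx 0 k != 0 :> 'rV[C]_n.
    by apply/eqP => /rowP/(_ k); rewrite !mxE !eqxx => /eqP; rewrite oner_eq0.
  have := pB.2 _ d0; rewrite -rowE mxE (bigD1 k) //= big1 ?addr0.
    by rewrite !mxE !eqxx conjC1 mulr1 subr_gt0 => /ltW.
  by move=> c ck; rewrite !mxE (negbTE ck) andbF conjC0 mulr0.
rewrite eA mxE (le_trans (ler_norm_sum _ _ _)) //.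
rewrite -(ler_pM2r (_ : 0 < 2)) // mul1r mulr_suml.
apply: (@le_trans _ _ (\sum_c (`|L i c| ^+ 2 + `|L j c| ^+ 2))).
  apply: ler_sum => c _; rewrite normrM !mxE norm_conjC -subr_ge0.
  rewrite (_ : _ - _ = (`|L i c| - `|L j c|) ^+ 2); last by ring.
  by apply: real_exprn_even_ge0 => //; rewrite rpredB // normr_real.
by rewrite big_split /= lerD.
Qed.

Definition extend_mid s n (a : nat) : 'M[C]_p :=
  if a == n.+1 then 2^-1 *: (lower_bound s n.+1 + upper_bound s n.+1) else s a.

Lemma extend_mid_eq s n a : (a <= n)%N -> extend_mid s n a = s a.
Proof. by move=> an; rewrite /extend_mid ltn_eqF. Qed.

(** At the midpoint both gaps are half of the total gap, which attains the factor $4^{-p}$. It also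
    shows that every good sequence can be prolonged. *)
Lemma extend_mid_good s n : s 0%N = 1%:M -> herm_seq s -> good s n ->
  [/\ herm_seq (extend_mid s n), good (extend_mid s n) n.+1
    & \det (gap (extend_mid s n) n.+2) = (4 ^+ p)^-1 * \det (gap s n.+1)].
Proof.
move=> s0 hs G; set t := extend_mid s n.
have e a : (a < n.+1)%N -> t a = s a by move=> an; rewrite /t extend_mid_eq.
have r2 : (2^-1 : C)^* = 2^-1 by apply: conj_Creal; rewrite ger0_real ?invr_ge0.
have ht : herm_seq t.
  move=> a; rewrite /t /extend_mid; case: eqP => _; last exact: hs.
  by rewrite ctrZ ctrD lower_bound_herm // upper_bound_herm // r2.
have half : 2^-1 + 2^-1 = 1 :> C by field.
have dbl (a : 'M[C]_p) : 2^-1 *: a + 2^-1 *: a = a.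
  by rewrite -scalerDl half scale1r.
have mid1 (a b : 'M[C]_p) : 2^-1 *: (a + b) - a = 2^-1 *: (b - a).
  by rewrite -[X in _ - X]dbl scalerDr scalerBr opprD addrACA subrr add0r.
have mid2 (a b : 'M[C]_p) : b - 2^-1 *: (a + b) = 2^-1 *: (b - a).
  rewrite -[X in X - _]dbl scalerDr scalerBr opprD [- _ + - _]addrC.
  by rewrite addrACA subrr add0r.
have eY : lower_gap t n.+1 = 2^-1 *: gap s n.+1.
  by rewrite lower_gapE (lower_bound_ext e) /t /extend_mid eqxx gapE //.
have eZ : upper_gap t n.+1 = 2^-1 *: gap s n.+1.
  by rewrite upper_gapE // (upper_bound_ext _ e) // /t /extend_mid eqxx gapE //.
have t0 : t 0%N = 1%:M by rewrite e.
have pD := pd_gap s0 hs G.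
have Gt : good t n.+1.
  apply/goodS; split; first by apply: good_ext G => a an; rewrite e.
  by rewrite eY eZ; split; apply: pdZ => //; rewrite invr_gt0.
split=> //; rewrite det_gapS // eY eZ !detZ (gap_ext _ e) //.
have d0 := pd_det pD.
have -> : (4 : C) ^+ p = 2 ^+ p * 2 ^+ p by rewrite -exprMn -natrM.
rewrite exprVn; have /gt_eqF/negbT n0 : 0 < (2 : C) ^+ p by rewrite exprn_gt0.
by field; rewrite n0 gt_eqF.
Qed.

(** Midpoints are chosen at every step. The resulting sequence maximises the determinant and is also
    the point towards which moment sequences are contracted. *)
Lemma center_exists n : exists s, [/\ s 0%N = 1%:M, herm_seq s, good s n
  & \det (gap s n.+1) = ((4 ^+ p)^-1) ^+ n].
Proof.
elim: n => [|n [s [s0 hs G d]]].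
  exists (fun a : nat => if a == 0%N then 1%:M else 0); split=> //.
  - by move=> [|a] /=; rewrite ?ctr1 ?ctr0.
  - exact: good0.
  by rewrite gap1 // det1 expr0.
have [ht Gt dt] := extend_mid_good s0 hs G.
by exists (extend_mid s n); split=> //; rewrite ?extend_mid_eq // dt d exprS.
Qed.

End GapBounds.

Section MomentBounds.
Variables (R : realType) (p : nat).
Implicit Types (s : nat -> 'M[R[i]]_p).

(** The equality of the block numbers is a hypothesis, so that substituting it takes the place of a
    cast. *)
Lemma mxblock_corr_eq (m n : nat) (f g : nat -> nat -> 'M[R[i]]_p)
    (u v : nat -> 'M[R[i]]_p) : m = n ->
  (forall a b, (a < n)%N -> (b < n)%N -> f a b = g a b) ->
  (forall b, (b < n)%N -> u b = v b) ->
  \mxrow_(b < m) u b *m invmx (\mxblock_(a < m, b < m) f a b) *m (\mxrow_(b < m) u b)^t*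
  = \mxrow_(b < n) v b *m invmx (\mxblock_(a < n, b < n) g a b) *m (\mxrow_(b < n) v b)^t*.
Proof.
move=> -> h1 h2.
have -> : \mxrow_(b < n) u b = \mxrow_(b < n) v b by apply: eq_mxrow => b; apply: h2.
by have -> : \mxblock_(a < n, b < n) f a b = \mxblock_(a < n, b < n) g a b
  by apply: eq_mxblock => a b; apply: h1.
Qed.

Lemma S_minusE s j : S_minus s j.+2 = lower_bound s j.+2.
Proof.
apply: (@mxblock_corr_eq (uphalf j.+1) j.+2./2
  (fun a b => if odd j then s (a + b).+1 else s (a + b)%N)
  (fun a b => lower_seq s j.+2 (a + b)) (fun b => s (j.+1./2.+1 + b)%N)
  (fun b => lower_seq s j.+2 (j.+2./2 + b))) => [|a b _ _|b _]; first by [].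
  by rewrite /lower_seq /= negbK.
rewrite /lower_seq /= negbK -[j]odd_double_half; case: (odd j) => /=.
  by rewrite add0n odd_double /= uphalf_double half_dbl.
by rewrite add0n odd_double /= uphalf_double half_dbl.
Qed.

Lemma S_plusE s j : S_plus s j.+2 = upper_bound s j.+2.
Proof.
case: j => [|j].
  rewrite /upper_bound /hankel_corr /S_plus.
  have -> : hankel_row (upper_seq s 2) 2.-1./2 = 0.
    by apply/matrixP => a [b hb]; exfalso; move: hb; rewrite big_ord0.
  by rewrite !mul0mx subr0.
congr (s j.+2 - _); apply: (@mxblock_corr_eq j.+2./2 j.+2./2
  (fun a b => if odd j.+1 then s (a + b)%N - s (a + b).+1 else s (a + b).+1 - s (a + b).+2)
  (fun a b => upper_seq s j.+3 (a + b))
  (fun b => s (uphalf j.+2 + b)%N - s (uphalf j.+2 + b).+1)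
  (fun b => upper_seq s j.+3 (j.+2./2 + b))) => [|a b _ _|b _]; first by [].
  by rewrite /upper_seq /= negbK.
rewrite /upper_seq /= negbK -[j]odd_double_half; case: (odd j) => /=.
  by rewrite add0n odd_double /= uphalf_double half_dbl.
by rewrite add0n odd_double /= uphalf_double half_dbl.
Qed.

End MomentBounds.

(** * Convergence along filters; openness and limits of good sequences *)

Section MatrixConvergence.
Variables (C : numClosedFieldType) (T : Type).
Implicit Types (F : set_system T).

Definition ccvg F (f : T -> C) (a : C) :=
  forall e, 0 < e -> \forall x \near F, `|f x - a| < e.

(** The filter is arbitrary, so that the same lemmas serve neighbourhoods of coordinates and of
    tuples, sequences of Riemann sums, and ultrafilters. *)
Definition mcvg F m n (f : T -> 'M[C]_(m, n)) (A : 'M[C]_(m, n)) :=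
  forall i j, ccvg F (fun x => f x i j) (A i j).

Definition scvg F p (s : T -> nat -> 'M[C]_p) (s0 : nat -> 'M[C]_p) :=
  forall a, mcvg F (fun x => s x a) (s0 a).

Section Filtered.
Variables (F : set_system T) (FF : Filter F).

Lemma ccvgP (f : T -> C) a : ccvg F f a <-> f @ F --> a.
Proof.
split=> [h|h e e0].
  by apply/cvgrPdist_lt => e e0; have := h e e0; apply: filterS => x; rewrite distrC.
by move/cvgrPdist_lt: h => /(_ e e0); apply: filterS => x; rewrite distrC.
Qed.

Lemma ccvg_cst (a : C) : ccvg F (fun=> a) a.
Proof. by apply/ccvgP; apply: cvg_cst. Qed.

Lemma ccvgD f g (a b : C) : ccvg F f a -> ccvg F g b -> ccvg F (fun x => f x + g x) (a + b).
Proof. by move=> /ccvgP hf /ccvgP hg; apply/ccvgP; apply: cvgD. Qed.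

Lemma ccvgN f (a : C) : ccvg F f a -> ccvg F (fun x => - f x) (- a).
Proof. by move=> /ccvgP hf; apply/ccvgP; apply: cvgN. Qed.

Lemma ccvgM f g (a b : C) : ccvg F f a -> ccvg F g b -> ccvg F (fun x => f x * g x) (a * b).
Proof. by move=> /ccvgP hf /ccvgP hg; apply/ccvgP; apply: cvgM. Qed.

Lemma ccvgV f (a : C) : a != 0 -> ccvg F f a -> ccvg F (fun x => (f x)^-1) a^-1.
Proof. by move=> a0 /ccvgP hf; apply/ccvgP; apply: cvgV. Qed.

Lemma ccvg_conj f (a : C) : ccvg F f a -> ccvg F (fun x => (f x)^*) a^*.
Proof.
by move=> h e e0; apply: filterS (h e e0) => x; rewrite -rmorphB norm_conjC.
Qed.

Lemma ccvg_sum I (r : seq I) (P : pred I) (f : I -> T -> C) (a : I -> C) :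
  (forall i, P i -> ccvg F (f i) (a i)) ->
  ccvg F (fun x => \sum_(i <- r | P i) f i x) (\sum_(i <- r | P i) a i).
Proof.
move=> h; elim: r => [|i r IH].
  rewrite big_nil (_ : (fun _ => _) = fun=> 0); first exact: ccvg_cst.
  by apply/funext => x; rewrite big_nil.
rewrite big_cons (_ : (fun _ => _) = fun x => if P i then f i x + \sum_(i <- r | P i) f i x
   else \sum_(i <- r | P i) f i x); last by apply/funext => x; rewrite big_cons.
by case: ifP => // /h hi; apply: ccvgD.
Qed.

Lemma ccvg_prod I (r : seq I) (P : pred I) (f : I -> T -> C) (a : I -> C) :
  (forall i, P i -> ccvg F (f i) (a i)) ->
  ccvg F (fun x => \prod_(i <- r | P i) f i x) (\prod_(i <- r | P i) a i).
Proof.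
move=> h; elim: r => [|i r IH].
  rewrite big_nil (_ : (fun _ => _) = fun=> 1); first exact: ccvg_cst.
  by apply/funext => x; rewrite big_nil.
rewrite big_cons (_ : (fun _ => _) = fun x => if P i then f i x * \prod_(i <- r | P i) f i x
   else \prod_(i <- r | P i) f i x); last by apply/funext => x; rewrite big_cons.
by case: ifP => // /h hi; apply: ccvgM.
Qed.

Lemma ccvg_ext (f g : T -> C) a : f =1 g -> ccvg F f a -> ccvg F g a.
Proof. by move=> /funext ->. Qed.

Lemma mcvg_ext m n (f g : T -> 'M[C]_(m, n)) A : f =1 g -> mcvg F f A -> mcvg F g A.
Proof. by move=> /funext ->. Qed.

Lemma mcvg_near m n (f g : T -> 'M[C]_(m, n)) A :
  (\forall x \near F, f x = g x) -> mcvg F f A -> mcvg F g A.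
Proof.
move=> h hf i j e e0; apply: filterS2 h (hf i j e e0) => x ->; exact.
Qed.

Lemma mcvg_cst m n (A : 'M[C]_(m, n)) : mcvg F (fun=> A) A.
Proof. by move=> i j; apply: ccvg_cst. Qed.

Lemma mcvgD m n f g (A B : 'M[C]_(m, n)) :
  mcvg F f A -> mcvg F g B -> mcvg F (fun x => f x + g x) (A + B).
Proof.
move=> hf hg i j; rewrite mxE; apply: ccvg_ext (ccvgD (hf i j) (hg i j)) => x.
by rewrite mxE.
Qed.

Lemma mcvgN m n f (A : 'M[C]_(m, n)) : mcvg F f A -> mcvg F (fun x => - f x) (- A).
Proof.
by move=> hf i j; rewrite mxE; apply: ccvg_ext (ccvgN (hf i j)) => x; rewrite mxE.
Qed.

Lemma mcvgB m n f g (A B : 'M[C]_(m, n)) :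
  mcvg F f A -> mcvg F g B -> mcvg F (fun x => f x - g x) (A - B).
Proof. by move=> hf hg; apply: mcvgD (mcvgN hg). Qed.

Lemma mcvgZ m n f a (g : T -> 'M[C]_(m, n)) A :
  ccvg F f a -> mcvg F g A -> mcvg F (fun x => f x *: g x) (a *: A).
Proof.
by move=> hf hg i j; rewrite mxE; apply: ccvg_ext (ccvgM hf (hg i j)) => x; rewrite mxE.
Qed.

Lemma mcvgM m n q f g (A : 'M[C]_(m, n)) (B : 'M[C]_(n, q)) :
  mcvg F f A -> mcvg F g B -> mcvg F (fun x => f x *m g x) (A *m B).
Proof.
move=> hf hg i j; rewrite mxE.
apply: (ccvg_ext (f := fun x => \sum_k f x i k * g x k j)).
  by move=> x; rewrite mxE.
by apply: ccvg_sum => k _; apply: ccvgM.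
Qed.

Lemma mcvg_adj m n f (A : 'M[C]_(m, n)) : mcvg F f A -> mcvg F (fun x => (f x)^t*) (A^t*).
Proof.
move=> hf i j; rewrite !mxE; apply: ccvg_ext (ccvg_conj (hf j i)) => x.
by rewrite !mxE.
Qed.

Lemma ccvg_det n f (A : 'M[C]_n) : mcvg F f A -> ccvg F (fun x => \det (f x)) (\det A).
Proof.
move=> hf; apply: ccvg_sum => s _; apply: ccvgM; first exact: ccvg_cst.
by apply: ccvg_prod => i _; apply: hf.
Qed.

Lemma near_unit n f (A : 'M[C]_n) : mcvg F f A -> A \in unitmx ->
  \forall x \near F, f x \in unitmx.
Proof.
move=> hf; rewrite unitmxE unitfE => uA.
have := ccvg_det hf; move/(_ `|\det A|); rewrite normr_gt0 => /(_ uA).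
apply: filterS => x h; rewrite unitmxE unitfE; apply: contraTneq h => ->.
by rewrite sub0r normrN ltxx.
Qed.

Lemma mcvg_inv n f (A : 'M[C]_n) : mcvg F f A -> A \in unitmx ->
  mcvg F (fun x => invmx (f x)) (invmx A).
Proof.
move=> hf uA; rewrite {2}/invmx uA.
apply: (mcvg_near (f := fun x => (\det (f x))^-1 *: \adj (f x))).
  by apply: filterS (near_unit hf uA) => x ux; rewrite /invmx ux.
apply: mcvgZ.
  by apply: ccvgV (ccvg_det hf); move: uA; rewrite unitmxE unitfE.
move=> i j; rewrite mxE; apply: (ccvg_ext (f := fun x => cofactor (f x) j i)).
  by move=> x; rewrite mxE.
apply: ccvgM; first exact: ccvg_cst.
apply: ccvg_det => k l; rewrite !mxE.
by apply: ccvg_ext (hf _ _) => x; rewrite !mxE.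
Qed.

(** The order of the complex field includes reality, so the limit is first shown to be real: its
    imaginary part is at most its distance to any nonnegative value of [f]. *)
Lemma ccvg_ge0 (f : T -> C) (a : C) : ProperFilter F -> (\forall x \near F, 0 <= f x) ->
  ccvg F f a -> 0 <= a.
Proof.
move=> PF f0 fa.
have near_lt (e : C) : 0 < e -> exists2 y : C, 0 <= y & `|y - a| < e.
  by move=> e0; have [x [h1 h2]] := filter_ex (filterI f0 (fa e e0)); exists (f x).
have Im0 : 'Im a = 0.
  apply/eqP; rewrite -normr_eq0; apply/negPn/negP => n0.
  have /near_lt[y y0] : 0 < `|'Im a| by rewrite lt0r n0 normr_ge0.
  apply/negP; rewrite -real_leNgt ?normr_real //.
  have -> : 'Im a = - 'Im (y - a).
    by rewrite raddfB /= (Creal_ImP _ (ger0_real y0)) sub0r opprK.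
  rewrite normrN -(ler_pXn2r (_ : (0 < 2)%N)) ?nnegrE // [X in _ <= X]normC2_Re_Im.
  by rewrite real_normK ?Creal_Im // lerDr real_exprn_even_ge0 ?Creal_Re.
have aR : a \is Num.real by apply/Creal_ImP.
rewrite real_leNgt //; apply/negP => a0.
have /near_lt[y y0] : 0 < - a by rewrite oppr_gt0.
apply/negP; rewrite -real_leNgt ?rpredN // ?normr_real //.
by rewrite ger0_norm ?lerDr // subr_ge0 (le_trans (ltW a0)).
Qed.

Lemma mcvg_psd n f (A : 'M[C]_n) : ProperFilter F -> (\forall x \near F, psdmx (f x)) ->
  mcvg F f A -> psdmx A.
Proof.
move=> PF fp fA; apply/psdP; split=> [|v].
  apply/matrixP => i j; apply/eqP; rewrite -subr_eq0 -normr_eq0.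
  have h := mcvgB (mcvg_adj fA) fA.
  have {}h : mcvg F (fun=> 0) (A^t* - A).
    by apply: mcvg_near h; apply: filterS fp => x /psd_herm ->; rewrite subrr.
  rewrite -[X in _ == X]/0 -[_ - _]/((A^t* i j) + - A i j).
  have -> : A^t* i j + - A i j = (A^t* - A) i j by rewrite !mxE.
  apply/negPn/negP => n0.
  have /(h i j) : 0 < `|(A^t* - A) i j| by rewrite lt0r n0 normr_ge0.
  by move=> /filter_ex[_]; rewrite !mxE sub0r normrN ltxx.
have hv : mcvg F (fun x => v *m f x *m v^t*) (v *m A *m v^t*).
  by apply: mcvgM (mcvg_cst _); apply: mcvgM fA; apply: mcvg_cst.
apply: (ccvg_ge0 PF _ (hv 0 0)).
by apply: filterS fp => x /psdP[_]; apply.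
Qed.

Lemma mcvg_small n f (A : 'M[C]_n) e : 0 < e -> mcvg F f A ->
  \forall x \near F, forall i j, `|(f x - A) i j| <= e.
Proof.
move=> e0 fA.
have : \forall x \near F, [forall ij : 'I_n * 'I_n, `|(f x - A) ij.1 ij.2| <= e].
  have : \forall x \near F, forall ij, ij \in enum {: 'I_n * 'I_n} ->
      `|(f x - A) ij.1 ij.2| <= e.
    elim: (enum _) => [|ij r IH]; first by near=> x.
    apply: filterS2 IH (fA ij.1 ij.2 e e0) => x h1 h2 kl.
    rewrite inE => /orP[/eqP->|]; last exact: h1.
    by rewrite !mxE ltW.
  by apply: filterS => x h; apply/forallP => ij; apply: h; rewrite mem_enum.
by apply: filterS => x /forallP h i j; exact: (h (i, j)).
Unshelve. all: by end_near. Qed.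

(** A Cholesky factor of the limit carries it to the identity, near which [pd_near1] applies. *)
Lemma near_pd n f (A : 'M[C]_n) : (forall x, (f x)^t* = f x) -> mcvg F f A ->
  pdmx A -> \forall x \near F, pdmx (f x).
Proof.
move=> hf fA pA; have [L [tL L0 eA]] := cholesky pA.
have uL := pd_cholesky_unit tL L0.
pose g x := invmx L *m f x *m (invmx L)^t*.
have hg : mcvg F g 1%:M.
  have -> : 1%:M = invmx L *m A *m (invmx L)^t*.
    by rewrite eA mulmxA mulVmx // mul1mx ctr_inv mulmxV ?unitmx_adj.
  by apply: mcvgM (mcvg_cst _); apply: mcvgM fA; apply: mcvg_cst.
have e0 : 0 < (n.+1%:R *+ 2 : C)^-1 by rewrite invr_gt0 pmulrn_lgt0.
apply: filterS (mcvg_small e0 hg) => x h.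
have -> : f x = L *m (1%:M + (g x - 1%:M)) *m L^t*.
  rewrite [_ + (_ - _)]addrC subrK /g !mulmxA mulmxV // mul1mx ctr_inv mulmxKV //.
  by rewrite unitmx_adj.
apply: pd_congr_unit => //; apply: pd_near1 => // .
by rewrite ctrB ctr1 /g !ctrM trmxCK hf mulmxA.
Qed.

Section Gaps.
Variables (p : nat) (s : T -> nat -> 'M[C]_p) (s0 : nat -> 'M[C]_p).
Hypothesis (ss0 : scvg F s s0).

Lemma mcvg_schur m (f : T -> nat -> 'M[C]_p) f0 : scvg F f f0 ->
  hankel f0 m \in unitmx -> mcvg F (fun x => schur (f x) m) (schur f0 m).
Proof.
move=> ff uH.
have hr : mcvg F (fun x => hankel_row (f x) m) (hankel_row f0 m).
  by move=> i j; rewrite mxE; apply: ccvg_ext (ff _ _ _) => x; rewrite mxE.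
have hH : mcvg F (fun x => hankel (f x) m) (hankel f0 m).
  by move=> i j; rewrite mxE; apply: ccvg_ext (ff _ _ _) => x; rewrite mxE.
apply: mcvgB (ff _) _; apply: mcvgM (mcvg_adj hr).
exact: mcvgM hr (mcvg_inv hH uH).
Qed.

Lemma mcvg_gaps j : s0 0%N = 1%:M -> herm_seq s0 -> good s0 j ->
  mcvg F (fun x => lower_gap (s x) j.+1) (lower_gap s0 j.+1) /\
  mcvg F (fun x => upper_gap (s x) j.+1) (upper_gap s0 j.+1).
Proof.
move=> s00 hs0 G; have [/pd_unit u1 /pd_unit u2] := pd_hankels_next s00 hs0 G.
split; apply: mcvg_schur => // a; rewrite /lower_seq /upper_seq; case: odd => //.
- exact: mcvgB (ss0 _) (ss0 _).
- exact: mcvgB (ss0 _) (ss0 _).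
Qed.

Lemma mcvg_gap j : s0 0%N = 1%:M -> herm_seq s0 -> good s0 j ->
  mcvg F (fun x => gap (s x) j.+1) (gap s0 j.+1).
Proof. by move=> a b G; have [h1 h2] := mcvg_gaps a b G; apply: mcvgD. Qed.

Lemma near_good n : s0 0%N = 1%:M -> (forall x, herm_seq (s x)) -> herm_seq s0 ->
  good s0 n -> \forall x \near F, good (s x) n.
Proof.
move=> s00 hs hs0; elim: n => [|n IH] G.
  by apply: filterE => x; apply: good0.
have Gn : good s0 n by exact: good_le G.
have [h1 h2] := mcvg_gaps s00 hs0 Gn.
have [p1 p2] := G n.+1 (leqnn _).
have n1 : \forall x \near F, pdmx (lower_gap (s x) n.+1).
  apply: near_pd h1 p1 => x; rewrite lower_gapE ctrB hs lower_bound_herm //.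
have n2 : \forall x \near F, pdmx (upper_gap (s x) n.+1).
  apply: near_pd h2 p2 => x; rewrite upper_gapE // ctrB hs upper_bound_herm //.
apply: filterS3 (IH Gn) n1 n2 => x g1 g2 g3.
exact/goodS.
Qed.

(** A limit of gaps is nonnegative definite, and the uniform lower bound on determinants excludes
    degeneration. The proof proceeds by index because convergence of the next gaps uses that the
    limit is good so far. *)
Lemma cvg_good n c : ProperFilter F -> s0 0%N = 1%:M -> herm_seq s0 ->
  0 < c -> (\forall x \near F, good (s x) n /\
    forall j, (0 < j <= n)%N -> c <= \det (lower_gap (s x) j) /\ c <= \det (upper_gap (s x) j)) ->
  good s0 n.
Proof.
move=> PF s00 hs0 c0; elim: n => [|n IH] h; first exact: good0.
have Gn : good s0 n.
  apply: IH; apply: filterS h => x [g hc]; split; first exact: good_le g.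
  by move=> j /andP[j0 jn]; apply: hc; rewrite j0 (leq_trans jn).
have [h1 h2] := mcvg_gaps s00 hs0 Gn.
have lim (f : T -> 'M[C]_p) A : mcvg F f A ->
    (\forall x \near F, pdmx (f x) /\ c <= \det (f x)) -> pdmx A.
  move=> fA fx; apply: psd_det_pd.
    by apply: mcvg_psd fA => //; apply: filterS fx => x [/pd_psd].
  rewrite gt_eqF // (lt_le_trans c0) // -subr_ge0.
  apply: (ccvg_ge0 PF (f := fun x => \det (f x) - c)).
    by apply: filterS fx => x [_]; rewrite subr_ge0.
  by apply: ccvgD (ccvg_det fA) _; apply: ccvg_cst.
apply/goodS; split=> //; split; [apply: lim h1 _|apply: lim h2 _];
  apply: filterS h => x [g hc];
  by have [] := g n.+1 (leqnn _); have [] := hc n.+1 (leqnn _).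
Qed.

End Gaps.
End Filtered.
End MatrixConvergence.

(** * Iterated integrals in the coordinates of Hermitian matrices *)

Section RealLineIntegrals.
Variable R : realType.
Local Notation mu := (@lebesgue_measure R).
Local Open Scope ereal_scope.

(** The integral of a nonnegative function is a supremum over the simple functions below it, so
    monotonicity holds for arbitrary functions; this is what makes volumes of arbitrary sets
    comparable. *)
Lemma ge0_le_integralT (f g : R -> \bar R) : (forall t, 0 <= f t) ->
  (forall t, f t <= g t) -> \int[mu]_t f t <= \int[mu]_t g t.
Proof.
move=> f0 fg; rewrite !ge0_integralTE //; last by move=> t; exact: le_trans (fg t).
by apply: le_ereal_sup => _ /= [h hf <-]; exists h => // t; exact: le_trans (fg t).
Qed.

Lemma lebesgue_affine (a b : R) (A : set (measurableTypeR R)) : (0 < a)%R ->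
  measurable A ->
  mu A = a%:E * mu ((fun t : R => a * t + b)%R @^-1` A).
Proof.
move=> a0 mA; pose phi (t : measurableTypeR R) : measurableTypeR R := (a * t + b)%R.
have mphi : measurable_fun setT phi.
  by apply: measurable_funD => //; apply: measurable_funM.
pose nu := mscale (NngNum (ltW a0)) (pushforward mu phi).
suff : mu A = nu mphi A by [].
apply: lebesgue_measure_unique => // _ [[c d] _ <-] /=.
rewrite /nu /mscale /= (_ : pushforward mu phi _ = mu (phi @^-1` `]c, d])) //.
have -> : phi @^-1` `]c, d] = `]((c - b) / a)%R, ((d - b) / a)%R]%classic.
  apply/seteqP; split=> t /=; rewrite /phi !in_itv /= => /andP[h1 h2].
    by rewrite ltr_pdivrMr // ler_pdivlMr // ltrBlDr lerBrDr mulrC h1.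
  move: h1 h2; rewrite ltr_pdivrMr // ler_pdivlMr // ltrBlDr lerBrDr mulrC => -> ->.
  by [].
rewrite !lebesgue_measure_itv /= !lte_fin ltr_pM2r ?invr_gt0 // ltrD2r.
case: ifP => _; last by rewrite mule0.
rewrite -!EFinD -EFinM; congr (_%:E); field; exact: lt0r_neq0.
Qed.

Lemma integral_affine (f : measurableTypeR R -> \bar R) (a b : R) : (0 < a)%R ->
  measurable_fun setT f -> (forall t, 0 <= f t) ->
  \int[mu]_t f (a * t + b)%R = (a^-1)%:E * \int[mu]_t f t.
Proof.
move=> a0 mf f0; pose phi (t : measurableTypeR R) : measurableTypeR R := (a * t + b)%R.
have mphi : measurable_fun setT phi.
  by apply: measurable_funD => //; apply: measurable_funM.
pose nu := mscale (NngNum (ltW a0)) (pushforward mu phi).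
have -> : \int[mu]_t f t = \int[nu mphi]_t f t.
  by apply: eq_measure_integral => A mA _; exact: lebesgue_affine.
rewrite /nu ge0_integral_mscale // muleA -EFinM mulVf ?gt_eqF // mul1e.
by rewrite ge0_integral_pushforward // preimage_setT.
Qed.

End RealLineIntegrals.

Section IteratedIntegrals.
Variables (R : realType) (I : choiceType).
Local Notation mu := (@lebesgue_measure R).
Local Open Scope ereal_scope.

Definition coord_cylinders : set (set (I -> R)) :=
  [set A | exists i (B : set (measurableTypeR R)),
     measurable B /\ A = (fun x => x i) @^-1` B].

(** One space for all dimensions: an integral runs over a finite list of coordinates and the
    remaining ones act as parameters. *)
Definition coords := g_sigma_algebraType coord_cylinders.

Lemma measurable_eval i : measurable_fun setT (fun x : coords => x i : measurableTypeR R).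
Proof. by move=> _ B mB; rewrite setTI; apply: sub_sigma_algebra; exists i, B. Qed.

Lemma measurable_coordsP d (T : measurableType d) (f : T -> coords) :
  (forall i, measurable_fun setT (fun t => f t i : measurableTypeR R)) ->
  measurable_fun setT f.
Proof.
move=> h; apply: (@measurability _ _ T coords setT f coord_cylinders) => [//|_ [_ [i [B [mB ->]]] <-]].
have -> : [set: T] `&` f @^-1` ((fun x => x i) @^-1` B) =
  [set: T] `&` (fun t => f t i) @^-1` B by [].
exact: h.
Qed.

Definition upd (x : coords) (i : I) (t : R) : coords := fun j => if j == i then t else x j.

Lemma upd_same x i t : upd x i t i = t. Proof. by rewrite /upd eqxx. Qed.

Lemma upd_neq x i j t : j != i -> upd x i t j = x j.
Proof. by rewrite /upd => /negbTE->. Qed.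

Lemma upd_upd x i t u : upd (upd x i t) i u = upd x i u.
Proof. by apply/funext => j; rewrite /upd; case: eqP. Qed.

Lemma updC x i j t u : i != j -> upd (upd x i t) j u = upd (upd x j u) i t.
Proof.
by move=> ij; apply/funext => k; rewrite /upd; case: eqP => // ->; rewrite eq_sym (negbTE ij).
Qed.

Lemma measurable_upd2 i :
  measurable_fun setT (fun z : coords * measurableTypeR R => upd z.1 i z.2).
Proof.
apply: measurable_coordsP => j; rewrite /upd; case: eqP => _.
  exact: measurable_snd.
exact: measurableT_comp (measurable_eval j) measurable_fst.
Qed.

Lemma measurable_upd x i : measurable_fun setT (fun t : measurableTypeR R => upd x i t).
Proof. by apply: measurable_coordsP => j; rewrite /upd; case: eqP. Qed.

Definition iint (s : seq I) (f : coords -> \bar R) : coords -> \bar R :=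
  foldr (fun i g x => \int[mu]_t g (upd x i t)) f s.

Lemma iint_cons i s f x : iint (i :: s) f x = \int[mu]_t iint s f (upd x i t).
Proof. by []. Qed.

Lemma iint_cat s1 s2 f : iint (s1 ++ s2) f = iint s1 (iint s2 f).
Proof. by rewrite /iint foldr_cat. Qed.

Lemma iint_ge0 s f : (forall x, 0 <= f x) -> forall x, 0 <= iint s f x.
Proof. by move=> f0; elim: s => [//|i s IH] x; apply: integral_ge0 => t _; apply: IH. Qed.

Lemma iint_measurable s f : (forall x, 0 <= f x) -> measurable_fun setT f ->
  measurable_fun setT (iint s f).
Proof.
move=> f0 mf; elim: s => [//|i s IH].
have := @measurable_fun_fubini_tonelli_F _ _ coords (measurableTypeR R) R
  mu (fun z => iint s f (upd z.1 i z.2)).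
apply; last by move=> z; apply: iint_ge0.
exact: measurableT_comp IH (measurable_upd2 i).
Qed.

Lemma iint_le s f g : (forall x, 0 <= f x) -> (forall x, f x <= g x) ->
  forall x, iint s f x <= iint s g x.
Proof.
move=> f0 fg; elim: s => [//|i s IH] x.
by apply: ge0_le_integralT => t; [apply: iint_ge0|apply: IH].
Qed.

Lemma iint_swap i j s f : i != j -> (forall x, 0 <= f x) -> measurable_fun setT f ->
  iint [:: i, j & s] f = iint [:: j, i & s] f.
Proof.
move=> ij f0 mf; apply/funext => x; rewrite /=.
have := @fubini_tonelli _ _ (measurableTypeR R) (measurableTypeR R) R mu mu
  (fun z => iint s f (upd (upd x i z.1) j z.2)).
move=> ->.
- by apply: eq_integral => u _; apply: eq_integral => t _; rewrite /= updC.
- apply: measurableT_comp (iint_measurable _ f0 mf) _.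
  apply: measurable_coordsP => k; rewrite /upd; case: eqP => _; first exact: measurable_snd.
  by case: eqP => _; [exact: measurable_fst|exact: measurable_cst].
- by move=> z; apply: iint_ge0.
Qed.

Lemma iint_move i s1 s2 f : i \notin s1 -> (forall x, 0 <= f x) ->
  measurable_fun setT f -> iint (s1 ++ i :: s2) f = iint (i :: s1 ++ s2) f.
Proof.
move=> + f0 mf; elim: s1 => [//|j s1 IH]; rewrite inE negb_or => /andP[ij is1].
rewrite [RHS](iint_swap _ ij) //.
by apply/funext => x; rewrite /= -/(iint _ _) IH.
Qed.

Lemma iint_perm s1 s2 f : uniq s1 -> perm_eq s1 s2 -> (forall x, 0 <= f x) ->
  measurable_fun setT f -> iint s1 f = iint s2 f.
Proof.
move=> + + f0 mf; elim: s1 s2 => [|i s1 IH] s2 /=.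
  by move=> _; rewrite perm_sym => /perm_nilP ->.
move=> /andP[is1 us1] p12.
have /path.splitPr h : i \in s2 by rewrite -(perm_mem p12) mem_head.
case: h p12 => a b p12.
have uab : uniq (a ++ i :: b) by rewrite -(perm_uniq p12) /= is1.
have ia : i \notin a.
  by move: uab; rewrite cat_uniq => /and3P[_ /hasPn/(_ i)]; rewrite mem_head => /(_ isT).
rewrite iint_move //; apply/funext => x; rewrite /= -/(iint _ _).
congr integral; apply/funext => t; rewrite (IH (a ++ b)) //.
rewrite -(perm_cons i) (perm_trans p12) // -[i :: b]cat1s -[i :: (_ ++ _)]cat1s.
by rewrite perm_catCA perm_refl.
Qed.

Lemma eq_iint_off s f g x :
  (forall y, (forall j, j \notin s -> y j = x j) -> f y = g y) ->
  iint s f x = iint s g x.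
Proof.
elim: s x => [|i s IH] x h; first by apply: h.
apply: eq_integral => t _; apply: IH => y hy; apply: h => j.
by rewrite inE negb_or => /andP[ji js]; rewrite hy // upd_neq.
Qed.

Lemma eq_iint s f g x : f =1 g -> iint s f x = iint s g x.
Proof. by move=> h; apply: eq_iint_off. Qed.

Lemma iint_indep s f x y : (forall j, j \notin s -> x j = y j) ->
  iint s f x = iint s f y.
Proof.
elim: s x y => [|i s IH] x y h; first by congr f; apply/funext => j; apply: h.
apply: eq_integral => t _; apply: IH => j js.
by rewrite /upd; case: eqP => // /eqP ji; apply: h; rewrite inE negb_or ji.
Qed.

Lemma iint_comm s f (r : coords -> coords) x :
  (forall y j t, j \in s -> r (upd y j t) = upd (r y) j t) ->
  iint s (f \o r) x = iint s f (r x).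
Proof.
elim: s x => [//|i s IH] x h; rewrite !iint_cons; apply: eq_integral => t _.
rewrite IH ?h ?mem_head // => y j u js; apply: h.
by rewrite inE js orbT.
Qed.

Lemma iint_factor s c f x : (forall x, 0 <= f x) -> measurable_fun setT f ->
  (0 <= c x)%R ->
  (forall y, (forall j, j \notin s -> y j = x j) -> c y = c x) ->
  iint s (fun y => (c y)%:E * f y) x = (c x)%:E * iint s f x.
Proof.
move=> f0 mf; elim: s x => [//|i s IH] x c0 hc.
rewrite !iint_cons -ge0_integralZl //.
- apply: eq_integral => t _.
  have e : c (upd x i t) = c x.
    by apply: hc => j; rewrite inE negb_or => /andP[ji _]; rewrite upd_neq.
  rewrite IH ?e // => y hy; rewrite hc ?hc // => j.
  by rewrite inE negb_or => /andP[ji js]; rewrite hy // upd_neq.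
- exact: measurableT_comp (iint_measurable _ f0 mf) (measurable_upd x i).
- by move=> t _; apply: iint_ge0.
Qed.

Lemma iintZ s (c : R) f x : (forall x, 0 <= f x) -> measurable_fun setT f ->
  (0 <= c)%R -> iint s (fun y => c%:E * f y) x = c%:E * iint s f x.
Proof. by move=> f0 mf c0; apply: (@iint_factor s (fun=> c)). Qed.

(** [g i] may depend only on coordinates outside [s] or before [i] in [s], the latter being the
    variables of the outer integrals. *)
Fixpoint triangular (g : I -> coords -> R) (s : seq I) : Prop :=
  if s is i :: s' then
    (forall j x t, j \in s -> g i (upd x j t) = g i x) /\ triangular g s'
  else True.

Definition shear (a : I -> R) (g : I -> coords -> R) (s : seq I) (x : coords) : coords :=
  fun j => if j \in s then (a j * x j + g j x)%R else x j.

Lemma measurable_shear a g s : (forall i, measurable_fun setT (g i : coords -> measurableTypeR R)) ->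
  measurable_fun setT (shear a g s).
Proof.
move=> mg; apply: measurable_coordsP => j; rewrite /shear; case: (j \in s).
  apply: measurable_funD (mg j); apply: measurable_funM => //; exact: measurable_eval.
exact: measurable_eval.
Qed.

(** When the variable of index [i] is integrated, [g i] is constant, so each step is a
    one-dimensional affine substitution. *)
Lemma iint_shear a g s f x : uniq s -> (forall i, 0 < a i)%R ->
  (forall i, measurable_fun setT (g i : coords -> measurableTypeR R)) ->
  triangular g s -> (forall x, 0 <= f x) -> measurable_fun setT f ->
  iint s (f \o shear a g s) x = (\prod_(i <- s) (a i)^-1)%R%:E * iint s f x.
Proof.
move=> + a0 mg; elim: s f x => [|i s IH] f x /=.
  by rewrite big_nil mul1e => _ _ _ _; congr f.
move=> /andP[iS us] [gi ts] f0 mf.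
(* [r] moves the coordinate [i] only. The full shear is [r] after the shear of the tail, because
   [g i] does not see the coordinates of the tail. *)
pose r (y : coords) : coords := upd y i (a i * y i + g i y)%R.
have mr : measurable_fun setT r.
  apply: measurable_coordsP => j; rewrite /r /upd; case: eqP => _.
    apply: measurable_funD (mg i); apply: measurable_funM => //; exact: measurable_eval.
  exact: measurable_eval.
have giE y z : (forall j, j \notin i :: s -> y j = z j) -> g i y = g i z.
  have gen : forall l : seq I, {subset l <= i :: s} -> forall y z,
      (forall j, j \notin l -> y j = z j) -> g i y = g i z.
    elim=> [|j l IHl] sl u v huv; first by congr (g i); apply/funext => j; apply: huv.
    rewrite -(gi j v (u j)) ?sl ?mem_head //; apply: IHl => [k kl|k kl].
      by apply: sl; rewrite inE kl orbT.
    by rewrite /upd; case: eqP => [->//|/eqP kj]; apply: huv; rewrite inE negb_or kj.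
  exact: gen.
have fr0 y : 0 <= (f \o r) y by apply: f0.
have mfr : measurable_fun setT (f \o r) by apply: measurableT_comp mr.
rewrite -/(iint _ _) (_ : (fun t => _) = (fun t => (\prod_(i <- s) (a i)^-1)%R%:E *
    iint s f (upd x i (a i * t + g i x)))); last first.
  apply/funext => t.
  have -> : iint s (f \o shear a g (i :: s)) (upd x i t) =
            iint s ((f \o r) \o shear a g s) (upd x i t).
    apply: eq_iint => y /=; congr f; apply/funext => j; rewrite /shear /r /upd.
    rewrite inE; case: eqP => [->|_] //=.
    rewrite (negbTE iS) /=; congr (_ + _)%R; apply: giE => k.
    by rewrite inE negb_or => /andP[_ /negbTE ->].
  rewrite IH //; congr (_ * _).
  rewrite iint_comm; last first.
    move=> y j u js; rewrite /r gi ?inE ?js ?orbT //.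
    have ji : j != i by apply: contraNneq iS => <-.
    by rewrite (@upd_neq y j i) 1?eq_sym // updC.
  by rewrite /r upd_same upd_upd gi ?mem_head.
rewrite ge0_integralZl //.
- rewrite (@integral_affine _ (fun t => iint s f (upd x i t))) //.
  + by rewrite muleA -EFinM big_cons mulrC.
  + exact: measurableT_comp (iint_measurable _ f0 mf) (measurable_upd x i).
  + by move=> t; apply: iint_ge0.
- apply: measurableT_comp (iint_measurable _ f0 mf) _.
  apply: measurable_coordsP => j; rewrite /upd; case: eqP => _ //.
  by apply: measurable_funD => //; apply: measurable_funM.
- by move=> t _; apply: iint_ge0.
- by rewrite lee_fin prodr_ge0 // => j _; rewrite invr_ge0 ltW.
Qed.

Lemma iint_box s (lo hi : I -> R) x : uniq s -> (forall i, lo i <= hi i)%R ->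
  iint s (fun y => (\1_[set y : coords | forall i, i \in s -> (lo i <= y i <= hi i)%R] y)%:E) x
  = (\prod_(i <- s) (hi i - lo i))%R%:E.
Proof.
move=> + lh; elim: s x => [|i s IH] x /=.
  by move=> _; rewrite big_nil /= indicE mem_set.
move=> /andP[iS us]; rewrite -/(iint _ _) big_cons.
rewrite (_ : (fun t => _) = fun t => (\prod_(i <- s) (hi i - lo i))%R%:E *
    (\1_(`[lo i, hi i]%classic) t)%:E); last first.
  apply/funext => t; rewrite -(IH (upd x i t) us).
  have [ti|ti] := boolP (t \in `[lo i, hi i]%classic).
    rewrite [\1_(`[_, _]%classic) t]indicE ti mule1; apply: eq_iint_off => y hy.
    congr (_%:E); rewrite !indicE; congr (_%:R); congr nat_of_bool; apply/idP/idP.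
      by move=> /set_mem h; apply/mem_set => j js; apply: h; rewrite inE js orbT.
    move=> /set_mem h; apply/mem_set => j; rewrite inE => /orP[/eqP->|/h//].
    by rewrite hy // upd_same; move: ti => /set_mem /=; rewrite in_itv.
  rewrite [\1_(`[_, _]%classic) t]indicE (negbTE ti) mule0.
  rewrite (@eq_iint_off s _ (fun=> 0)).
    by elim: (s) (upd x i t) => [//|j l IHl] y; apply: integral0_eq => u _; apply: IHl.
  move=> y hy; rewrite indicE memNset //= => /(_ i (mem_head _ _)) h.
  by move/negP: ti; apply; apply/mem_set; rewrite /= in_itv /= -(upd_same x i t) -hy.
rewrite ge0_integralZl //.
- rewrite integral_indic // setIT /= lebesgue_measure_itv /= lte_fin.
  rewrite mulrC EFinM; congr (_ * _).
  by have [|] := ltP (lo i) (hi i); [rewrite EFinB|move=> h; rewrite (le_anti (introT andP (conj h (lh i)))) subrr].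
- by apply/measurable_EFinP; apply: measurable_indic.
- by rewrite lee_fin prodr_ge0 // => j _; rewrite subr_ge0.
Qed.

(** Both sides iterate the same one-dimensional integrals in the same order, so the identity holds
    for arbitrary [A]. *)
Lemma iint_lebesgue_tuple m (e : m.-tuple I) (A : set (m.-tuple R)) (x : coords) :
  uniq e ->
  lebesgue_tuple A = iint e (fun y => (\1_A (map_tuple y e))%:E) x.
Proof.
elim: m e A x => [|m IH] e A x ue.
  by rewrite (tuple0 e) /= diracE indicE (tuple0 (map_tuple x _)).
case/tupleP: e ue => i e /= /andP[ie ue].
rewrite -/(iint _ _); apply: eq_integral => t _.
rewrite (IH e _ (upd x i t) ue); apply: eq_iint_off => y hy.
congr (_%:E); rewrite !indicE; congr (_%:R); congr nat_of_bool.
rewrite (_ : map_tuple y [tuple of i :: e] = [tuple of t :: map_tuple y e]).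
  by apply/idP/idP => /set_mem h; apply/mem_set.
by apply: val_inj; rewrite /= hy // upd_same.
Qed.

End IteratedIntegrals.

Lemma measurable_ereal_gtP d (T : measurableType d) (R : realType) (f : T -> \bar R) :
  (forall c : R, measurable [set x | (c%:E < f x)%E]) -> measurable_fun setT f.
Proof.
move=> h; have H := @measurability _ _ T _ setT f _ (ErealGenOInfty.measurableE R).
apply: H => _ [_ [c ->] <-].
rewrite setTI (_ : _ @^-1` _ = [set x | (c%:E < f x)%E]); first exact: h.
by apply/seteqP; split=> x /=; rewrite in_itv /= andbT.
Qed.

(** * Measurability of functions of the coordinates from their semicontinuity *)

Section CoordinateTopology.
Variables (R : realType) (I : countType).
Implicit Types (x y : coords R I).

Definition cnear x : set_system (coords R I) :=
  [set A | exists (F : seq I) (e : R), 0 < e /\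
     forall y, (forall i, i \in F -> `|y i - x i| < e) -> A y].

Lemma cnear_filter x : ProperFilter (cnear x).
Proof.
apply: Build_ProperFilter_ex.
  by move=> A [F [e [e0 h]]]; exists x; apply: h => i _; rewrite subrr normr0.
split.
- by exists [::], 1.
- move=> A B [F [e [e0 h]]] [F' [e' [e'0 h']]].
  exists (F ++ F'), (Num.min e e'); split; first by rewrite lt_min e0.
  move=> y hy; split; [apply: h => i iF|apply: h' => i iF];
    have := hy i; rewrite mem_cat iF ?orbT lt_min => /(_ isT)/andP[] //.
- move=> A B AB [F [e [e0 h]]]; exists F, e; split=> // y hy; exact/AB/h.
Qed.

Lemma cnear_eval x i : ((fun y => y i) @ cnear x --> x i)%classic.
Proof.
have := cnear_filter x => PF.
apply/cvgrPdist_lt => e e0; exists [:: i], e; split=> // y h.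
by rewrite distrC; apply: h; rewrite mem_head.
Qed.

Let rational_box (l : seq (I * (rat * rat))) : set (coords R I) :=
  [set y | forall c, c \in l -> `|y c.1 - ratr c.2.1| < ratr c.2.2].

Let measurable_rational_box l : measurable (rational_box l).
Proof.
elim: l => [|c l IH].
  by rewrite (_ : rational_box _ = setT) //; apply/seteqP; split.
rewrite (_ : rational_box _ = (fun y : coords R I => y c.1) @^-1`
   `](ratr c.2.1 - ratr c.2.2), (ratr c.2.1 + ratr c.2.2)[%classic `&` rational_box l).
  apply: measurableI IH; rewrite -[X in measurable X]setTI.
  exact: measurable_eval.
apply/seteqP; split=> y /=.
  move=> h; split; last by move=> d dl; apply: h; rewrite inE dl orbT.
  by have := h c (mem_head _ _); rewrite ltr_distl in_itv.
rewrite in_itv /= -ltr_distl => -[h1 h2] d; rewrite inE => /orP[/eqP->//|]; exact: h2.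
Qed.

(** The index set is countable, so the boxes given by finitely many rational constraints form a
    countable base, enumerated here through [unpickle]. *)
Lemma measurable_open_coords (A : set (coords R I)) :
  (forall x, A x -> cnear x A) -> measurable A.
Proof.
move=> oA; pose B n : set (coords R I) :=
  if unpickle n is Some l then
    (if `[< rational_box l `<=` A >] then rational_box l else set0) else set0.
have -> : A = \bigcup_n B n.
  apply/seteqP; split=> [x Ax|x [n _]]; last first.
    by rewrite /B; case: unpickle => // l; case: asboolP => // h /h.
  have [F [e [e0 h]]] := oA x Ax.
  have e2 : 0 < e / 2 by rewrite divr_gt0.
  have [r] := rat_in_itvoo e2; rewrite in_itv /= => /andP[r0 re].
  have q i : {q : rat | `|x i - ratr q| < ratr r}.
    apply/cid; have lt : x i - ratr r < x i + ratr r.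
      by rewrite ltrD2l gt0_cp.
    have [q] := rat_in_itvoo lt; rewrite in_itv /= -ltr_distl distrC => hq.
    by exists q.
  pose l := [seq (i, (sval (q i), r)) | i <- F].
  exists (pickle l) => //; rewrite /B pickleK asboolT.
    by move=> c /mapP[i iF ->] /=; case: (q i).
  move=> y hy; apply: h => i iF.
  have := hy (i, (sval (q i), r)); rewrite map_f // => /(_ isT) /=.
  case: (q i) => /= q' hq' hy'.
  rewrite -(subrK (ratr q') (y i)) -addrA (le_lt_trans (ler_normD _ _)) //.
  rewrite [`|ratr q' - _|]distrC (splitr e); apply: ltrD.
    exact: lt_trans hy' re.
  exact: lt_trans hq' re.
apply: bigcupT_measurable => n; rewrite /B; case: unpickle => [l|] //.
by case: ifP.
Qed.

(** Semicontinuity is the right notion here: the densities are continuous on an open set and zero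
    outside it. *)
Lemma measurable_lsc_coords (f : coords R I -> \bar R) :
  (forall x (c : R), (c%:E < f x)%E -> cnear x [set y | (c%:E < f y)%E]) ->
  measurable_fun setT f.
Proof.
by move=> h; apply: measurable_ereal_gtP => c; apply: measurable_open_coords => x; apply: h.
Qed.

Lemma measurable_cont_coords (f : coords R I -> R) :
  (forall x, (f @ cnear x --> f x)%classic) ->
  measurable_fun setT (f : coords R I -> measurableTypeR R).
Proof.
move=> cf; apply/measurable_EFinP; apply: measurable_lsc_coords => x c /=.
have := cnear_filter x => PF; rewrite lte_fin => cx.
apply: (@filterS _ (cnear x) PF _ _ _ (cvgr_gt _ (cf x) c cx)) => y /=.
by rewrite lte_fin.
Qed.

End CoordinateTopology.

Section ComplexFacts.
Variable R : realType.
Local Open Scope complex_scope.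
Local Notation Re := complex.Re.
Local Notation Im := complex.Im.
Implicit Types (z w : R[i]).

Lemma conjCE z : (z^*)%R = Complex (Re z) (- Im z).
Proof. by case: z. Qed.

Lemma cReD z w : Re (z + w) = Re z + Re w. Proof. by case: z w => [a b] [c d]. Qed.
Lemma cImD z w : Im (z + w) = Im z + Im w. Proof. by case: z w => [a b] [c d]. Qed.
Lemma cReN z : Re (- z) = - Re z. Proof. by case: z. Qed.
Lemma cImN z : Im (- z) = - Im z. Proof. by case: z. Qed.
Lemma cReB z w : Re (z - w) = Re z - Re w. Proof. by rewrite cReD cReN. Qed.
Lemma cImB z w : Im (z - w) = Im z - Im w. Proof. by rewrite cImD cImN. Qed.
Lemma cReM z w : Re (z * w) = Re z * Re w - Im z * Im w.
Proof. by case: z w => [a b] [c d]. Qed.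
Lemma cImM z w : Im (z * w) = Re z * Im w + Im z * Re w.
Proof. by case: z w => [a b] [c d]. Qed.

Lemma gt0_complex z : 0 < z -> Im z = 0 /\ 0 < Re z.
Proof. by rewrite ltcE => /andP[/eqP -> ]. Qed.

Lemma norm_complexE z : `|z| = (Num.sqrt (Re z ^+ 2 + Im z ^+ 2))%:C.
Proof. exact: normc_def. Qed.

Lemma norm_complex_lt z (e : R) :
  `|z| < e%:C -> `|Re z| < e /\ `|Im z| < e.
Proof.
rewrite norm_complexE ltcR => h.
have le (a b : R) : `|a| <= Num.sqrt (a ^+ 2 + b ^+ 2).
  by rewrite -sqrtr_sqr ler_wsqrtr // lerDl sqr_ge0.
split; first exact: le_lt_trans (le _ _) h.
by apply: le_lt_trans (le _ (Re z)) _; rewrite addrC.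
Qed.

Lemma norm_complex_gt z (e : R) :
  `|Re z| < e / 2 -> `|Im z| < e / 2 -> `|z| < e%:C.
Proof.
move=> h1 h2; rewrite norm_complexE ltcR.
have e0 : 0 < e / 2 by apply: le_lt_trans h1.
have e1 : 0 < e by move: e0; rewrite pmulr_lgt0 // invr_gt0.
rewrite -[e]gtr0_norm // -sqrtr_sqr ltr_sqrt ?exprn_gt0 //.
apply: (@lt_trans _ _ ((e / 2) ^+ 2 + (e / 2) ^+ 2)).
  by apply: ltrD; rewrite -real_normK ?num_real // ltrXn2r.
have : 0 < e ^+ 2 by rewrite exprn_gt0.
by rewrite exprMn; lra.
Qed.

Section Filtered.
Variables (T : Type) (F : set_system T) (FF : Filter F).

Lemma ccvg_complex (f : T -> R[i]) (a : R[i]) :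
  ((fun x => Re (f x)) @ F --> Re a)%classic ->
  ((fun x => Im (f x)) @ F --> Im a)%classic -> ccvg F f a.
Proof.
move=> /cvgrPdist_lt hr /cvgrPdist_lt hi e /gt0_complex[e1 e2].
have h : 0 < Re e / 2 by rewrite divr_gt0.
apply: filterS2 (hr _ h) (hi _ h) => x h1 h2.
have -> : e = (Re e)%:C by case: (e) e1 => a' b /= ->.
by apply: norm_complex_gt; rewrite ?cReB ?cImB distrC.
Qed.

Lemma ccvg_Re (f : T -> R[i]) (a : R[i]) : ccvg F f a ->
  ((fun x => Re (f x)) @ F --> Re a)%classic.
Proof.
move=> h; apply/cvgrPdist_lt => e e0.
have e0' : 0 < e%:C by rewrite ltcR.
apply: filterS (h _ e0') => x /norm_complex_lt[].
by rewrite cReB distrC.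
Qed.

Lemma ccvg_Im (f : T -> R[i]) (a : R[i]) : ccvg F f a ->
  ((fun x => Im (f x)) @ F --> Im a)%classic.
Proof.
move=> h; apply/cvgrPdist_lt => e e0.
have e0' : 0 < e%:C by rewrite ltcR.
apply: filterS (h _ e0') => x /norm_complex_lt[_].
by rewrite cImB distrC.
Qed.

End Filtered.
End ComplexFacts.

(** * Real coordinates of Hermitian matrices; volume as an iterated integral *)

Section HermitianCoordinates.
Variables (R : realType) (p : nat).
Local Open Scope complex_scope.
Local Notation Re := complex.Re.
Local Notation Im := complex.Im.
Local Notation idx := (nat * ('I_p * 'I_p))%type.
Implicit Types (x y : coords R idx) (A : 'M[R[i]]_p).

Definition herm_at x (l : nat) : 'M[R[i]]_p :=
  \matrix_(a < p, b < p)
    (if (a < b)%N then x (l, (a, b)) +i* x (l, (b, a))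
     else if (b < a)%N then x (l, (b, a)) -i* x (l, (a, b))
     else (x (l, (a, a)))%:C).

Definition coord_of A (ab : 'I_p * 'I_p) : R :=
  if (ab.1 <= ab.2)%N then Re (A ab.1 ab.2) else Im (A ab.2 ab.1).

Lemma herm_at_adj x l : (herm_at x l)^t* = herm_at x l.
Proof.
apply/matrixP => a b; rewrite !mxE conjCE.
by case: ltngtP => [ab|ab|/val_inj ->] /=; rewrite ?opprK ?oppr0.
Qed.

Lemma coord_of_herm_at x l ab : coord_of (herm_at x l) ab = x (l, ab).
Proof.
case: ab => a b; rewrite /coord_of /= !mxE.
by case: ltngtP => [//|//|/val_inj ->].
Qed.

Lemma herm_at_coord_of (A : nat -> 'M[R[i]]_p) l : (A l)^t* = A l ->
  herm_at (fun c => coord_of (A c.1) c.2) l = A l.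
Proof.
move=> hA; apply/matrixP => a b; rewrite !mxE /coord_of /=.
have e : A l b a = Complex (Re (A l a b)) (- Im (A l a b)).
  by rewrite -{1}hA !mxE conjCE.
case: ltngtP => [ab|ab|/val_inj ab] /=.
- by case: (A l a b).
- by rewrite e opprK; case: (A l a b).
move: e; rewrite ab; case: (A l b b) => u v /= [] e.
have -> : v = 0 by lra.
by rewrite leqnn.
Qed.

Lemma herm_at_ext x y l l' : (forall ab, x (l, ab) = y (l', ab)) ->
  herm_at x l = herm_at y l'.
Proof. by move=> h; apply/matrixP => a b; rewrite !mxE !h. Qed.

Lemma mcvg_herm_at x l : mcvg (cnear x) (fun y => herm_at y l) (herm_at x l).
Proof.
have := cnear_filter x => PF i j; apply: ccvg_complex; rewrite !mxE.
- rewrite (_ : (fun y => _) = (fun y => if (i < j)%N then y (l, (i, j)) else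
     if (j < i)%N then y (l, (j, i)) else y (l, (i, i)))).
    by case: ltngtP => /= _; apply: cnear_eval.
  by apply/funext => y; rewrite !mxE; case: ltngtP.
rewrite (_ : (fun y => _) = (fun y => if (i < j)%N then y (l, (j, i)) else
     if (j < i)%N then - y (l, (i, j)) else 0)).
  case: ltngtP => /= _; [exact: cnear_eval| |exact: cvg_cst].
  by apply: cvgN; apply: cnear_eval.
by apply/funext => y; rewrite !mxE; case: ltngtP.
Qed.

Lemma cvg_coord_of T (F : set_system T) (f : T -> 'M[R[i]]_p) A ab : Filter F ->
  mcvg F f A -> ((fun t => coord_of (f t) ab) @ F --> coord_of A ab)%classic.
Proof.
move=> FF h; rewrite /coord_of; case: ifP => _.
  exact: ccvg_Re (h _ _).
exact: ccvg_Im (h _ _).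
Qed.

Definition rank_le (u v : 'I_p * 'I_p) := (u.1 + u.2 <= v.1 + v.2)%N.
Definition block (l : nat) : seq idx :=
  [seq (l, ab) | ab <- sort rank_le (enum {: 'I_p * 'I_p})].

Lemma mem_block l c : (c \in block l) = (c.1 == l).
Proof.
apply/mapP/eqP => [[ab _ ->]//|<-]; exists c.2; last by case: c.
by rewrite mem_sort mem_enum.
Qed.

Lemma block_uniq l : uniq (block l).
Proof. by rewrite map_inj_uniq ?sort_uniq ?enum_uniq // => a b []. Qed.

Definition blocks (j m : nat) : seq idx := flatten [seq block l | l <- iota j m].

Lemma mem_blocks j m c : (c \in blocks j m) = (j <= c.1 < j + m)%N.
Proof.
rewrite -mem_iota; apply/flattenP/idP => [[_ /mapP[l li ->]]|h].
  by rewrite mem_block => /eqP->.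
by exists (block c.1); rewrite ?mem_block // map_f.
Qed.

Lemma blocks_uniq j m : uniq (blocks j m).
Proof.
elim: m j => [//|m IH] j; rewrite /blocks /= cat_uniq block_uniq IH andbT /=.
apply/hasPn => c; rewrite mem_blocks mem_block => /andP[jc _].
by rewrite gtn_eqF.
Qed.

Lemma blocks_cat j m n : blocks j (m + n) = blocks j m ++ blocks (j + m) n.
Proof. by rewrite /blocks iotaD map_cat flatten_cat. Qed.

Lemma blocks1 j : blocks j 1 = block j.
Proof. by rewrite /blocks /= cats0. Qed.

Definition row_of n x : 'rV['M[R[i]]_p]_n := \row_(l < n) herm_at x l.

(** [lebesgue_tuple] follows the enumeration of the finite index type, which is some permutation [e]
    of the order by blocks; bringing it into that order is a Tonelli argument and takes
    measurability. *)
Lemma herm_volume_iint n (A : set 'rV['M[R[i]]_p]_n) x :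
  exists2 e : seq idx, perm_eq e (blocks 0 n) &
  herm_volume A = iint e (fun y => (\1_A (row_of n y) : R)%:E) x.
Proof.
pose f (k : {: 'I_n * ('I_p * 'I_p)}) : idx := (k.1 : nat, k.2).
have fI : injective f by move=> [a b] [c d] [/val_inj -> ->].
pose e := [tuple f (enum_val k) | k < #|{: 'I_n * ('I_p * 'I_p)}|].
have ue : uniq e.
  rewrite /= map_inj_uniq ?enum_uniq // => a b /fI; exact: enum_val_inj.
exists e.
  apply: uniq_perm => //; first exact: blocks_uniq.
  move=> c; rewrite mem_blocks /= add0n; apply/mapP/idP => [[k _ ->]|h].
    by rewrite /f /= ltn_ord.
  exists (enum_rank (Ordinal h, c.2)); first by rewrite mem_enum.
  by rewrite enum_rankK /f /=; case: c h.
rewrite /herm_volume (iint_lebesgue_tuple _ x ue); apply: eq_iint => y.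
congr (_%:E); rewrite !indicE; congr (_%:R); congr nat_of_bool.
have -> : row_of n y = herm_coords (map_tuple y e).
  apply/rowP => l; rewrite !mxE; apply/matrixP => a b; rewrite !mxE.
  by rewrite !tnth_map !tnth_ord_tuple !enum_rankK.
by apply/idP/idP => /set_mem h; apply/mem_set.
Qed.

Lemma herm_volumeE n (A : set 'rV['M[R[i]]_p]_n) x :
  measurable_fun setT (fun y : coords R idx => (\1_A (row_of n y) : R)%:E) ->
  herm_volume A = iint (blocks 0 n) (fun y => (\1_A (row_of n y) : R)%:E) x.
Proof.
move=> mA; have [e pe ->] := herm_volume_iint A x.
rewrite (@iint_perm _ _ e (blocks 0 n)) //.
by rewrite (perm_uniq pe) blocks_uniq.
Qed.

Lemma herm_volume_le n (A B : set 'rV['M[R[i]]_p]_n) :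
  A `<=` B -> (herm_volume A <= herm_volume B)%E.
Proof.
move=> AB; pose x : coords R idx := fun=> 0.
pose f (k : {: 'I_n * ('I_p * 'I_p)}) : idx := (k.1 : nat, k.2).
have fI : injective f by move=> [a b] [c d] [/val_inj -> ->].
pose e := [tuple f (enum_val k) | k < #|{: 'I_n * ('I_p * 'I_p)}|].
have ue : uniq e.
  rewrite /= map_inj_uniq ?enum_uniq // => a b /fI; exact: enum_val_inj.
rewrite /herm_volume !(iint_lebesgue_tuple _ x ue); apply: iint_le => [y|y].
  by rewrite lee_fin.
rewrite lee_fin !indicE ler_nat.
have [/set_mem h|//] := boolP (map_tuple y e \in @herm_coords R p n @^-1` A).
by rewrite mem_set //=; apply: AB.
Qed.

End HermitianCoordinates.

Section IteratedIntegralBounds.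
Variables (R : realType) (I : countType).
Local Notation mu := (@lebesgue_measure R).
Implicit Types (x y : coords R I) (s : seq I) (f g : coords R I -> \bar R).
Local Open Scope ereal_scope.

Lemma iint_le_off s f g x : (forall y, 0 <= f y) ->
  (forall y, (forall j, j \notin s -> y j = x j) -> f y <= g y) ->
  iint s f x <= iint s g x.
Proof.
move=> f0; elim: s x => [|i s IH] x h; first by apply: h.
rewrite !iint_cons; apply: ge0_le_integralT => t; first exact: iint_ge0.
apply: IH => y hy; apply: h => j.
by rewrite inE negb_or => /andP[ji js]; rewrite hy // upd_neq.
Qed.

Lemma iint_only s f x y : (forall u v, (forall j, j \in s -> u j = v j) -> f u = f v) ->
  iint s f x = iint s f y.
Proof.
move=> hf; pose r (z : coords R I) : coords R I := fun j => if j \in s then z j else y j.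
have fr : f =1 f \o r by move=> z; apply: hf => j js; rewrite /r js.
rewrite (eq_iint _ _ fr) iint_comm.
  by apply: iint_indep => j /negbTE js; rewrite /r js.
move=> z j t js; apply/funext => k; rewrite /r /upd.
by case: eqP => [->|_]; rewrite ?js.
Qed.

(** [v] is the volume of a box inside the neighbourhood. It depends neither on [c] nor on [f], so
    that one box serves all powers $K^m$ later on. *)
Lemma iint_ge_near s x (A : set (coords R I)) : uniq s -> cnear x A ->
  exists2 v : R, (0 < v)%R & forall (c : R) f, (0 <= c)%R -> (forall y, 0 <= f y) ->
    (forall y, A y -> (forall j, j \notin s -> y j = x j) -> c%:E <= f y) ->
    (c * v)%:E <= iint s f x.
Proof.
move=> us [F [e [e0 h]]]; pose lo i := (x i - e / 2)%R; pose hi i := (x i + e / 2)%R.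
have lh i : (lo i <= hi i)%R by rewrite /lo /hi; lra.
exists (\prod_(i <- s) (hi i - lo i))%R.
  by apply: prodr_gt0 => i _; rewrite /lo /hi; lra.
move=> c f c0 f0 hf; rewrite EFinM -(iint_box x us lh).
set B := [set y | _]; have mB : measurable B.
  have -> : B = \bigcap_(i in [set` s]) ((fun y : coords R I => y i) @^-1` `[lo i, hi i]%classic).
    apply/seteqP; split=> y h' i.
      by move=> /= /h'; rewrite in_itv.
    by move=> is'; have /= := h' i is'; rewrite in_itv.
  apply: fin_bigcap_measurable; first exact: finite_seq.
  move=> i _; rewrite -[X in measurable X]setTI; exact: measurable_eval.
rewrite -iintZ //; last by apply/measurable_EFinP; apply: measurable_indic.
apply: iint_le_off => y; first by rewrite -EFinM lee_fin mulr_ge0.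
move=> hy; rewrite -EFinM indicE.
have [/set_mem yB|_] := boolP (y \in B); last by rewrite mulr0.
rewrite mulr1; apply: hf => //; apply: h => i iF.
have [is'|is'] := boolP (i \in s); last by rewrite hy // subrr normr0.
have := yB i is'; rewrite /lo /hi -ler_distl => h'.
by apply: le_lt_trans h' _; lra.
Qed.

Lemma iint_le_box s x (c : R) f : uniq s -> (0 <= c)%R -> (forall y, 0 <= f y) ->
  (forall y, f y <= c%:E) ->
  (forall y, 0 < f y -> forall i, i \in s -> (`|y i| <= 1)%R) ->
  iint s f x <= (c * 2 ^+ size s)%:E.
Proof.
move=> us c0 f0 fc h.
have lh (i : I) : (-1 <= (1 : R))%R by lra.
have e2 : (\prod_(i <- s) (1 - -1) = 2 ^+ size s :> R)%R.
  by rewrite big_const_seq count_predT iter_mulr_1 opprK.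
rewrite -e2 EFinM -(iint_box x us lh).
set B := [set y | _]; have mB : measurable B.
  have -> : B = \bigcap_(i in [set` s]) ((fun y : coords R I => y i) @^-1` `[(-1)%R, 1%R]%classic).
    apply/seteqP; split=> y h' i.
      by move=> /= /h'; rewrite in_itv.
    by move=> is'; have /= := h' i is'; rewrite in_itv.
  apply: fin_bigcap_measurable; first exact: finite_seq.
  move=> i _; rewrite -[X in measurable X]setTI; exact: measurable_eval.
rewrite -iintZ //; last by apply/measurable_EFinP; apply: measurable_indic.
apply: iint_le => // y; rewrite -EFinM indicE.
have [yB|yB] := boolP (y \in B); first by rewrite mulr1.
rewrite mulr0 leNgt; apply/negP => /h hy; move/negP: yB; apply; apply/mem_set => i is'.
by rewrite -ler_norml; apply: hy.
Qed.

End IteratedIntegralBounds.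

(** * Change of variables under a triangular congruence *)

Section Congruence.
Variables (R : realType) (p : nat).
Local Notation Re := complex.Re.
Local Notation Im := complex.Im.
Local Notation idx := (nat * ('I_p * 'I_p))%type.
Implicit Types (x y : coords R idx) (L B D : 'M[R[i]]_p) (l : nat).

Definition congr_at l L B x : coords R idx :=
  fun c => if c.1 == l then coord_of (L *m herm_at x l *m L^t* + B) c.2 else x c.

Lemma herm_congr_at l L B x : B^t* = B ->
  herm_at (congr_at l L B x) l = L *m herm_at x l *m L^t* + B.
Proof.
move=> hB; set A := _ + B.
have hA : A^t* = A by rewrite ctrD !ctrM trmxCK herm_at_adj hB !mulmxA.
rewrite -(@herm_at_coord_of R p (fun=> A) l hA).
by apply: herm_at_ext => ab; rewrite /congr_at /= eqxx.
Qed.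

(** Since $L$ is triangular, the entry $(a,b)$ of $LWL^*$ sees only the entries of $W$ above and to
    the left; the hypothesis removes all of them but one. *)
Lemma trig_congr_entry (C : numClosedFieldType) n (L W : 'M[C]_n) (a b : 'I_n) :
  is_trig_mx L ->
  (forall c d : 'I_n, (c <= a)%N -> (d <= b)%N -> (c, d) != (a, b) -> W c d = 0) ->
  (L *m W *m L^t*) a b = L a a * W a b * (L b b)^*.
Proof.
move=> /is_trig_mxP tL hW; rewrite !mxE (bigD1 b) //= [X in _ + X]big1 ?addr0.
  rewrite !mxE (bigD1 a) //= [X in _ + X]big1 ?addr0 // => c ca.
  have [ac|ca'] := ltnP a c; first by rewrite tL // mul0r.
  by rewrite hW ?mulr0 // xpair_eqE negb_and ca.
move=> d db; rewrite !mxE.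
have [bd|db'] := ltnP b d; first by rewrite (tL b d bd) conjC0 mulr0.
rewrite big1 ?mul0r // => c _.
have [ac|ca'] := ltnP a c; first by rewrite tL // mul0r.
by rewrite hW ?mulr0 // xpair_eqE negb_and db orbT.
Qed.

Lemma coord_ofB (A B : 'M[R[i]]_p) ab : coord_of (A - B) ab = coord_of A ab - coord_of B ab.
Proof. by rewrite /coord_of; case: ifP => _; rewrite !mxE ?cReB ?cImB. Qed.

Lemma coord_ofD (A B : 'M[R[i]]_p) ab : coord_of (A + B) ab = coord_of A ab + coord_of B ab.
Proof. by rewrite /coord_of; case: ifP => _; rewrite !mxE ?cReD ?cImD. Qed.

Lemma triangular_sub (J : choiceType) (g : J -> coords R J -> R) (r : J -> J -> bool) s :
  sorted r s -> transitive r -> reflexive r ->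
  (forall i j (x : coords R J) t, i \in s -> j \in s -> r i j -> g i (upd x j t) = g i x) ->
  triangular g s.
Proof.
move=> + tr rr; elim: s => [//|i s IH] /= pis h; split.
  move=> j x t js; apply: h => //; first exact: mem_head.
  move: js; rewrite inE => /orP[/eqP->//|js].
  by have /allP := order_path_min tr pis; apply.
apply: IH; first exact: path_sorted pis.
by move=> k j x t ks js; apply: h; rewrite inE ?ks ?js orbT.
Qed.

(* Entry (a, b) of L U L^* is |L_aa L_bb| U_ab plus a combination of entries of
   U of smaller rank, where the rank of (a, b) is a + b: in the coordinates
   sorted by rank the congruence by L is triangular. *)
Lemma iint_congr_at l L B f x : is_trig_mx L -> (forall i, 0 < L i i) -> B^t* = B ->
  (forall y, 0 <= f y)%E -> measurable_fun setT f ->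
  iint (block p l) f x =
  ((Re (\det (L *m L^t*)) ^+ p)%:E * iint (block p l) (f \o congr_at l L B) x)%E.
Proof.
move=> tL L0 hB f0 mf.
pose r i := Re (L i i).
have r0 i : 0 < r i by have [] := gt0_complex (L0 i).
have Lr i : L i i = (r i)%:C%C.
  by have [] := gt0_complex (L0 i); rewrite /r; case: (L i i) => u v /= ->.
pose a (c : idx) := r c.2.1 * r c.2.2.
have a0 c : 0 < a c by rewrite mulr_gt0.
pose g (c : idx) y := coord_of (L *m herm_at y l *m L^t* + B) c.2 - a c * y (l, c.2).
have eg : congr_at l L B = shear a g (block p l).
  apply/funext => y; apply/funext => -[l' ab]; rewrite /congr_at /shear mem_block /=.
  by case: eqP => [->|//]; rewrite /g /a /= addrCA subrr addr0.
have mg c : measurable_fun setT (g c : coords R idx -> measurableTypeR R).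
  apply: measurable_cont_coords => y; have := cnear_filter y => PF.
  apply: cvgB; last by apply: cvgM; [exact: cvg_cst|exact: cnear_eval].
  apply: cvg_coord_of; apply: mcvgD; last exact: mcvg_cst.
  apply: mcvgM; last exact: mcvg_cst.
  by apply: mcvgM; [exact: mcvg_cst|exact: mcvg_herm_at].
have tg : triangular g (block p l).
  apply: (@triangular_sub _ g (fun c c' => rank_le c.2 c'.2)).
  - rewrite /block (sorted_map) //=.
    by apply: sort_sorted => u v; rewrite /rank_le leq_total.
  - by move=> u v w; apply: leq_trans.
  - by move=> u; rewrite /rank_le leqnn.
  move=> [l1 [c d]] [l2 [c' d']] y t; rewrite !mem_block /= => /eqP -> /eqP ->.
  rewrite /rank_le /= => cd; rewrite /g /= /a /=.
  (* Changing one coordinate alters the matrix by [W], supported on $(c',d')$ and $(d',c')$, whose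
     rank is at least $c+d$. Hence [W] affects the coordinate $(c,d)$ of the congruence only through
     its own entry there, and that diagonal contribution is subtracted in [g]. *)
  set y' := upd _ _ _; pose W := herm_at y' l - herm_at y l.
  suff E : coord_of (L *m W *m L^t*) (c, d) = r c * r d * coord_of W (c, d).
    have e1 : coord_of (L *m herm_at y' l *m L^t* + B) (c, d) =
        coord_of (L *m herm_at y l *m L^t* + B) (c, d) + coord_of (L *m W *m L^t*) (c, d).
      have -> : herm_at y' l = herm_at y l + W by rewrite /W addrC subrK.
      by rewrite mulmxDr mulmxDl addrAC coord_ofD.
    have e2 : coord_of W (c, d) = y' (l, (c, d)) - y (l, (c, d)).
      by rewrite coord_ofB !coord_of_herm_at.
    by rewrite e1 E e2; ring.
  have WE (u v : 'I_p) : (forall ab : 'I_p * 'I_p, ab = (u, v) \/ ab = (v, u) -> ab <> (c', d')) ->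
      W u v = 0.
    move=> h; rewrite /W !mxE /y' /upd !xpair_eqE !eqxx /=.
    have h1 := h _ (or_introl erefl); have h2 := h _ (or_intror erefl).
    have e1 : ((u == c') && (v == d')) = false.
      by apply/negP => /andP[/eqP e /eqP e']; apply: h1; rewrite e e'.
    have e2 : ((v == c') && (u == d')) = false.
      by apply/negP => /andP[/eqP e /eqP e']; apply: h2; rewrite e e'.
    rewrite e1 e2; case: ltngtP => [_|_|/val_inj uv]; rewrite ?subrr //.
    by move: e1; rewrite -uv => ->; rewrite subrr.
  have small (u v : 'I_p) (a' b' : 'I_p) : (a' + b' = c + d)%N ->
      (u <= a')%N -> (v <= b')%N -> (u, v) != (a', b') -> W u v = 0.
    move=> ab ua vb uv; apply: WE => -[u' v'] [] [-> ->] [e1 e2].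
    - move/negP: uv; apply; rewrite xpair_eqE -!val_eqE /=.
      move: cd; rewrite -e1 -e2 -ab => cd; apply/andP; split; apply/eqP; lia.
    - move/negP: uv; apply; rewrite xpair_eqE -!val_eqE /=.
      move: cd; rewrite -e1 -e2 -ab => cd; apply/andP; split; apply/eqP; lia.
  rewrite /coord_of /=; case: ifP => _.
    rewrite trig_congr_entry //; last by move=> u v; apply: small.
    rewrite !Lr conjCE !cReM !cImM /= ; ring.
  rewrite trig_congr_entry //; last by move=> u v; apply: small; rewrite addnC.
  rewrite !Lr conjCE !cImM !cReM /=; ring.
rewrite eg iint_shear ?block_uniq // muleA -EFinM.
(* Over all $p^2$ real coordinates, $\prod_{i,j}r_ir_j=(\prod_ir_i)^{2p}=\det(LL^{*})^p$. *)
have -> : \prod_(i <- block p l) (a i)^-1 = (Re (\det (L *m L^t*)) ^+ p)^-1.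
  have eL : \det L = (\prod_i r i)%:C%C.
    by rewrite det_trig // rmorph_prod; apply: eq_bigr => i _; rewrite Lr.
  have -> : Re (\det (L *m L^t*)) = (\prod_i r i) ^+ 2.
    by rewrite det_mulmx det_adj eL conjCE cReM /= oppr0 mulr0 subr0 expr2.
  rewrite /block big_map (perm_big (enum {: 'I_p * 'I_p})) ?perm_sort //=.
  rewrite prodfV big_enum /= -(pair_bigA _ (fun i j => r i * r j)) /=; congr (_^-1).
  under eq_bigr do rewrite big_split /= prodr_const card_ord.
  rewrite big_split /= prodr_const card_ord prodrXl -exprD addnn -mul2n exprM.
  by [].
rewrite mulfV ?mul1e //.
have uL := pd_cholesky_unit tL L0.
by rewrite expf_neq0 // gt_eqF //; have [] := gt0_complex (pd_det (pd_gram uL)).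
Qed.

End Congruence.

(** * Volumes of the fibers of the moment space *)

Lemma pd_herm (C : numClosedFieldType) n (A : 'M[C]_n) : pdmx A -> A^t* = A.
Proof. by case. Qed.

Lemma good_at (C : numClosedFieldType) p (s : nat -> 'M[C]_p) n j :
  good s n -> (0 < j <= n)%N -> pdmx (lower_gap s j) /\ pdmx (upper_gap s j).
Proof. exact. Qed.

Lemma pd_det_le1 (C : numClosedFieldType) n (A : 'M[C]_n) :
  pdmx A -> pdmx (1%:M - A) -> \det A <= 1 /\ \det (1%:M - A) <= 1.
Proof.
move=> p1 p2; have := pd_det_le p1 p2; have := pd_det_le p2 p1.
by rewrite subrK [A + _]addrC subrK det1.
Qed.

(* Unification must not unfold these over R[i]: it would not terminate in
   reasonable time. *)
Opaque pdmx good lower_gap upper_gap gap lower_bound upper_bound.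

Section RealDeterminants.
Variables (R : realType) (p : nat).
Local Notation Re := complex.Re.
Local Notation Im := complex.Im.
Implicit Types (A D L U : 'M[R[i]]_p).

Definition rdet A : R := Re (\det A).

Lemma pd_rdet A : pdmx A -> \det A = (rdet A)%:C%C /\ 0 < rdet A.
Proof.
move=> /pd_det/gt0_complex[h1 h2]; split=> //.
by move: h1; rewrite /rdet; case: (\det A) => a b /= ->.
Qed.

Lemma rdet_congr L U : rdet (L *m U *m L^t*) = rdet (L *m L^t*) * rdet U.
Proof.
rewrite /rdet !det_mulmx det_adj conjCE !cReM !cImM /=; ring.
Qed.

Lemma pd_congr_iff L U : L \in unitmx -> pdmx (L *m U *m L^t*) <-> pdmx U.
Proof.
move=> uL; split; last exact: pd_congr_unit.
have uL' : invmx L \in unitmx by rewrite unitmx_inv.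
move=> /(pd_congr_unit uL'); rewrite !mulmxA mulVmx // mul1mx ctr_inv.
by rewrite mulmxK ?unitmx_adj.
Qed.

Lemma rdet_gapS (s : nat -> 'M[R[i]]_p) j : s 0%N = 1%:M -> herm_seq s -> (0 < j)%N ->
  good s j -> rdet (gap s j.+1) = rdet (lower_gap s j) * rdet (upper_gap s j) / rdet (gap s j).
Proof.
move=> s0 hs j0 G; have [pY pZ] : pdmx (lower_gap s j) /\ pdmx (upper_gap s j).
  by apply: (good_at G); rewrite j0 leqnn.
apply: complexI; rewrite fmorph_div rmorphM /=.
have [<- _] := pd_rdet (pd_gap s0 hs G).
have [<- _] := pd_rdet pY; have [<- _] := pd_rdet pZ.
have [<- _] := pd_rdet (pdD pY pZ).
exact: det_gapS.
Qed.

Lemma rdet_le1 A : pdmx A -> pdmx (1%:M - A) -> rdet A <= 1 /\ rdet (1%:M - A) <= 1.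
Proof.
move=> p1 p2; have [] := pd_det_le1 p1 p2.
have [-> _] := pd_rdet p1; have [-> _] := pd_rdet p2.
by rewrite -[X in _ <= X -> _ <= X -> _]/(1%:C)%C !lecR.
Qed.

Lemma norm_complex_le (z : R[i]) (e : R) : `|z| <= e%:C%C -> `|Re z| <= e /\ `|Im z| <= e.
Proof.
rewrite norm_complexE lecR => h.
have le (a b : R) : `|a| <= Num.sqrt (a ^+ 2 + b ^+ 2).
  by rewrite -sqrtr_sqr ler_wsqrtr // lerDl sqr_ge0.
split; first exact: le_trans (le _ _) h.
by apply: le_trans (le _ (Re z)) _; rewrite addrC.
Qed.

Lemma pd_coord_le1 A ab : pdmx A -> pdmx (1%:M - A) -> `|coord_of A ab| <= 1.
Proof.
move=> pA pB; have h i j := norm_complex_le (pd_entry_le1 i j pA pB : _ <= 1%:C%C).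
by rewrite /coord_of; case: ifP => _; [have [] := h ab.1 ab.2|have [] := h ab.2 ab.1].
Qed.

Lemma cvg_exprn T (F : set_system T) (f : T -> R) (a : R) n : Filter F ->
  (f @ F --> a)%classic -> ((fun x => f x ^+ n) @ F --> a ^+ n)%classic.
Proof.
move=> FF fa; elim: n => [|n IH].
  by rewrite (_ : (fun _ => _) = fun=> 1); [exact: cvg_cst|apply/funext].
rewrite exprS (_ : (fun _ => _) = fun x => f x * f x ^+ n); first exact: cvgM.
by apply/funext => x; rewrite exprS.
Qed.

Lemma cvg_rdet T (F : set_system T) (f : T -> 'M[R[i]]_p) A : Filter F -> mcvg F f A ->
  ((fun x => rdet (f x)) @ F --> rdet A)%classic.
Proof. by move=> FF fA; apply: ccvg_Re; apply: ccvg_det. Qed.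

End RealDeterminants.

Section Fibers.
Variables (R : realType) (p : nat).
Local Notation Re := complex.Re.
Local Notation idx := (nat * ('I_p * 'I_p))%type.
Implicit Types (x y : coords R idx) (A D L U Y Z : 'M[R[i]]_p) (l j m q : nat).

Definition open_weight (G : coords R idx -> Prop) (h : coords R idx -> R) x : R :=
  if `[< G x >] then h x else 0.

Lemma cnear_Filter (x : coords R idx) : Filter (cnear x).
Proof. have PF := cnear_filter x; typeclasses eauto. Qed.

Lemma open_weightT (G : coords R idx -> Prop) (h : coords R idx -> R) x :
  G x -> open_weight G h x = h x.
Proof. by move=> Gx; rewrite /open_weight asboolT. Qed.

Lemma open_weightF (G : coords R idx -> Prop) (h : coords R idx -> R) x :
  ~ G x -> open_weight G h x = 0.
Proof. by move=> Gx; rewrite /open_weight asboolF. Qed.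

Lemma open_weight_near (G : coords R idx -> Prop) (h : coords R idx -> R) x (c : R) :
  (forall y, 0 <= h y) ->
  (G x -> cnear x G) -> (G x -> h @ cnear x --> h x)%classic ->
  c < open_weight G h x -> cnear x [set y | c < open_weight G h y].
Proof.
move=> h0 oG ch; have := cnear_filter x => PF; rewrite {1}/open_weight.
case: asboolP => [Gx cx|_ c0].
  apply: (@filterS2 _ _ PF _ _ _ _ (oG Gx) (cvgr_gt _ (ch Gx) c cx)) => y Gy /=.
  by rewrite /open_weight asboolT.
apply: filterE => y /=; apply: lt_le_trans c0 _.
by rewrite /open_weight; case: ifP.
Qed.

Lemma measurable_open_weight (G : coords R idx -> Prop) (h : coords R idx -> R) :
  (forall y, 0 <= h y) ->
  (forall x, G x -> cnear x G) -> (forall x, G x -> h @ cnear x --> h x)%classic ->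
  measurable_fun setT (fun x => (open_weight G h x)%:E).
Proof.
move=> h0 oG ch; apply: measurable_lsc_coords => x c; rewrite lte_fin => cx.
have := cnear_filter x => PF.
apply: (@filterS _ (cnear x) PF _ _ _ (open_weight_near h0 (oG x) (ch x) cx)) => y /=.
by rewrite lte_fin.
Qed.

Lemma open_weight_ge0 (G : coords R idx -> Prop) (h : coords R idx -> R) x : (forall y, 0 <= h y) -> 0 <= open_weight G h x.
Proof. by rewrite /open_weight => h0; case: ifP. Qed.

Lemma iint0 (I : choiceType) (s : seq I) (x : coords R I) : iint s (fun=> 0%E) x = 0%E.
Proof. by elim: s x => [//|i s IH] x; rewrite iint_cons; apply: integral0_eq. Qed.

(** The absolute value makes the power nonnegative everywhere, as [open_weight] is to be lower
    semicontinuous; on positive definite pairs it changes nothing. *)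
Definition barrier q (F : coords R idx -> 'M[R[i]]_p * 'M[R[i]]_p) : coords R idx -> R :=
  open_weight (fun y => pdmx (F y).1 /\ pdmx (F y).2)
    (fun y => `|rdet (F y).1 * rdet (F y).2| ^+ q).

Lemma barrierE q F y : pdmx (F y).1 -> pdmx (F y).2 ->
  barrier q F y = (rdet (F y).1 * rdet (F y).2) ^+ q.
Proof.
move=> p1 p2; have [_ r1] := pd_rdet p1; have [_ r2] := pd_rdet p2.
rewrite /barrier open_weightT; first by rewrite gtr0_norm ?mulr_gt0.
split; [exact: p1|exact: p2].
Qed.

Definition pd_weight q Y Z : R :=
  if `[< pdmx Y /\ pdmx Z >] then `|rdet Y * rdet Z| ^+ q else 0.

Lemma barrier_weight q F y : barrier q F y = pd_weight q (F y).1 (F y).2.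
Proof. reflexivity. Qed.

Lemma pd_weight_congr q L U V : L \in unitmx ->
  pd_weight q (L *m U *m L^t*) (L *m V *m L^t*) = rdet (L *m L^t*) ^+ (q * 2) * pd_weight q U V.
Proof.
move=> uL; have [_ r0] := pd_rdet (pd_gram uL).
have gen (a b c : R) : 0 < a -> `|a * b * (a * c)| ^+ q = a ^+ (q * 2) * `|b * c| ^+ q.
  move=> a0; rewrite mulrACA normrM exprMn; congr (_ * _).
  by rewrite -expr2 gtr0_norm ?exprn_gt0 // -exprM mulnC.
have [[a b]|h] := pselect (pdmx U /\ pdmx V).
  rewrite /pd_weight asboolT; last by split; [exact/(pd_congr_iff _ uL)|exact/(pd_congr_iff _ uL)].
  rewrite asboolT; last by split; [exact: a|exact: b].
  rewrite (rdet_congr L U) (rdet_congr L V); exact: gen.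
rewrite /pd_weight asboolF; last first.
  by move=> [/(pd_congr_iff _ uL) a /(pd_congr_iff _ uL) b]; apply: h; split; [exact: a|exact: b].
by rewrite asboolF ?mulr0 //; exact: h.
Qed.

Lemma barrier_ge0 q F y : 0 <= barrier q F y.
Proof. by apply: open_weight_ge0 => z; rewrite exprn_ge0. Qed.

Definition mx_continuous (f : coords R idx -> 'M[R[i]]_p) :=
  forall x, mcvg (cnear x) f (f x).

Section BarrierContinuity.
Variables (q : nat) (f g : coords R idx -> 'M[R[i]]_p).
Hypotheses (hf : forall y, (f y)^t* = f y) (hg : forall y, (g y)^t* = g y).
Hypotheses (cf : mx_continuous f) (cg : mx_continuous g).

Lemma barrier_nearG x : pdmx (f x) /\ pdmx (g x) ->
  cnear x (fun y => pdmx (f y) /\ pdmx (g y)).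
Proof.
move=> [p1 p2]; have := cnear_filter x => PF.
have n1 := near_pd (cnear_Filter x) hf (cf x) p1; have n2 := near_pd (cnear_Filter x) hg (cg x) p2.
exact: (@filterS2 _ _ PF _ _ _ _ n1 n2).
Qed.

Lemma barrier_cvg x :
  ((fun y => `|rdet (f y) * rdet (g y)| ^+ q) @ cnear x --> `|rdet (f x) * rdet (g x)| ^+ q)%classic.
Proof.
have := cnear_filter x => PF; apply: cvg_exprn; apply: cvg_norm.
by apply: cvgM; apply: cvg_rdet.
Qed.

Lemma barrier_near x c : c < barrier q (fun y => (f y, g y)) x ->
  cnear x [set y | c < barrier q (fun y => (f y, g y)) y].
Proof.
apply: open_weight_near => [y|h|h]; first by rewrite exprn_ge0.
  exact: barrier_nearG.
exact: barrier_cvg.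
Qed.

Lemma measurable_barrier :
  measurable_fun setT (fun y => (barrier q (fun y => (f y, g y)) y)%:E).
Proof.
apply: measurable_open_weight => [y|x h|x h]; first by rewrite exprn_ge0.
  exact: barrier_nearG.
exact: barrier_cvg.
Qed.

End BarrierContinuity.

Lemma herm_at_continuous l : mx_continuous (fun y => herm_at y l).
Proof. by move=> x; apply: mcvg_herm_at. Qed.

Lemma mx_continuous_cst A : mx_continuous (fun=> A).
Proof. by move=> x; have := cnear_filter x => PF; apply: mcvg_cst. Qed.

Lemma mx_continuousB f g : mx_continuous f -> mx_continuous g ->
  mx_continuous (fun y => f y - g y).
Proof. by move=> cf cg x; have := cnear_filter x => PF; apply: mcvgB. Qed.

Definition unit_barrier q l := barrier q (fun y => (herm_at y l, 1%:M - herm_at y l)).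

(** The matrix beta integral of $\det(U)^q\det(I_p-U)^q$ over $0<U<I_p$, in the coordinates of the
    block [l]. *)
Definition beta q l : \bar R := iint (block p l) (fun y => (unit_barrier q l y)%:E) (fun=> 0).

Lemma unit_barrier_sub_herm l y : (1%:M - herm_at y l)^t* = 1%:M - herm_at y l.
Proof. by rewrite ctrB ctr1 herm_at_adj. Qed.

Lemma unit_barrier_cont l : mx_continuous (fun y => 1%:M - herm_at y l).
Proof. exact: mx_continuousB (mx_continuous_cst _) (herm_at_continuous _). Qed.

Lemma beta_only q l x : iint (block p l) (fun y => (unit_barrier q l y)%:E) x = beta q l.
Proof.
apply: iint_only => u v h; rewrite /unit_barrier /barrier /open_weight /=.
have -> : herm_at u l = herm_at v l; last by [].
by apply: herm_at_ext => ab; apply: h; rewrite mem_block.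
Qed.

(** From above, the integrand is at most $1$ and lives in the box $|y_i|\le1$; from below, it is
    bounded away from $0$ near $U=I_p/2$. *)
Lemma beta_bounds q l : exists2 b : R, 0 < b & beta q l = b%:E.
Proof.
have ub : (beta q l <= (1 * 2 ^+ size (block p l))%:E)%E.
  apply: iint_le_box => [| |y|y|y]; rewrite ?block_uniq ?lee_fin ?barrier_ge0 //.
    rewrite /unit_barrier /barrier /open_weight; case: asboolP => //= -[p1 p2].
    have [_ r1] := pd_rdet p1; have [_ r2] := pd_rdet p2.
    rewrite gtr0_norm ?mulr_gt0 //; apply: exprn_ile1; first by rewrite mulr_ge0 ?ltW.
    have [l1 l2] := rdet_le1 p1 p2; exact: mulr_ile1 (ltW r1) (ltW r2) l1 l2.
  rewrite lte_fin /unit_barrier /barrier /open_weight; case: asboolP; rewrite ?ltxx //=.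
  move=> [p1 p2] _ [l' ab]; rewrite mem_block /= => /eqP ->.
  by rewrite -coord_of_herm_at; apply: pd_coord_le1.
pose x0 : coords R idx := fun c => coord_of (2^-1%:M : 'M[R[i]]_p) c.2.
have h2 : (2^-1 : R[i])^* = 2^-1 by apply: conj_Creal; rewrite ger0_real ?invr_ge0.
have hx0 : herm_at x0 l = 2^-1%:M.
  apply: (@herm_at_coord_of R p (fun=> 2^-1%:M)).
  by rewrite tr_scalar_mx map_scalar_mx /= h2.
have ph : pdmx (2^-1%:M : 'M[R[i]]_p).
  by rewrite -scalemx1; apply: pdZ (pd1 _ _); rewrite invr_gt0.
have eh : 1%:M - 2^-1%:M = 2^-1%:M :> 'M[R[i]]_p.
  by rewrite -raddfB /=; congr (_%:M); field.
pose c := unit_barrier q l x0.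
have c0 : 0 < c.
  have [_ r] := pd_rdet ph.
  rewrite /c /unit_barrier barrierE /= ?hx0 ?eh //.
  by rewrite exprn_gt0 // mulr_gt0.
have nb : cnear x0 [set y | c / 2 < unit_barrier q l y].
  apply: barrier_near => [y|y| | |]; rewrite ?herm_at_adj ?unit_barrier_sub_herm //.
  - exact: herm_at_continuous.
  - exact: unit_barrier_cont.
  - by rewrite -/(unit_barrier _ _ _) -/c; lra.
have [v v0 hv] := iint_ge_near (block_uniq p l) nb.
have lb : ((c / 2 * v)%:E <= beta q l)%E.
  rewrite -(beta_only q l x0); apply: hv => [|y|y /= hy _].
  - by rewrite divr_ge0 // ltW.
  - by rewrite lee_fin barrier_ge0.
  - by rewrite lee_fin ltW.
have cv : 0 < c / 2 * v by rewrite mulr_gt0 // divr_gt0.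
case: (beta q l) ub lb => [b| |] //; rewrite !lee_fin => _ lb.
by exists b => //; apply: lt_le_trans lb.
Qed.

(** The substitution $S=LUL^*+S^-$ with $LL^*=S^+-S^-$ contributes the Jacobian $\det(LL^{*})^p$,
    and each of the two determinants of the barrier is multiplied by $\det(LL^{*})$. *)
Lemma iint_barrier q l lo up x : lo^t* = lo -> pdmx (up - lo) ->
  (iint (block p l) (fun y => (barrier q (fun y => (herm_at y l - lo, up - herm_at y l)) y)%:E) x
  = (rdet (up - lo) ^+ (p + q * 2))%:E * beta q l)%E.
Proof.
move=> hlo pD; have [L [tL L0 eL]] := cholesky pD.
have uL := pd_cholesky_unit tL L0.
have hup : up^t* = up by rewrite -(subrK lo up) ctrD (pd_herm pD) hlo.
have cb1 : mx_continuous (fun y => herm_at y l - lo).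
  exact: mx_continuousB (herm_at_continuous _) (mx_continuous_cst _).
have cb2 : mx_continuous (fun y => up - herm_at y l).
  exact: mx_continuousB (mx_continuous_cst _) (herm_at_continuous _).
rewrite (iint_congr_at _ _ tL L0 hlo); last 2 first.
- by move=> y; rewrite lee_fin barrier_ge0.
- apply: measurable_barrier => [y|y| |]; [| |exact: cb1|exact: cb2].
    by rewrite ctrB herm_at_adj hlo.
  by rewrite ctrB herm_at_adj hup.
rewrite -eL exprD EFinM -muleA; congr (_ * _)%E.
rewrite -(beta_only q l x) -iintZ; first last.
- by rewrite exprn_ge0 // ltW //; have [] := pd_rdet pD.
- apply: measurable_barrier => [y|y| |].
  + exact: herm_at_adj.
  + exact: unit_barrier_sub_herm.
  + exact: herm_at_continuous.
  exact: unit_barrier_cont.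
- by move=> y; rewrite lee_fin barrier_ge0.
apply: eq_iint => y /=; rewrite -EFinM; congr (_%:E).
rewrite /unit_barrier !barrier_weight /= (herm_congr_at _ _ _ hlo) addrK.
set U := herm_at y l.
have -> : up - (L *m U *m L^t* + lo) = L *m (1%:M - U) *m L^t*.
  by rewrite mulmxBr mulmx1 mulmxBl -eL opprD addrA addrAC.
by rewrite (pd_weight_congr _ _ _ uL) -eL.
Qed.

Definition seq_of x j : 'M[R[i]]_p := if j is l.+1 then herm_at x l else 1%:M.

Lemma seq_of_herm x : herm_seq (seq_of x).
Proof. by move=> [|j] /=; rewrite ?ctr1 ?herm_at_adj. Qed.

Lemma scvg_seq_of x : scvg (cnear x) seq_of (seq_of x).
Proof.
by have := cnear_filter x => PF; move=> [|a]; [exact: mcvg_cst|exact: mcvg_herm_at].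
Qed.

(* Up to a constant, the volume of the fiber of M_{j+m} over (S_1, ..., S_j). *)
Definition dens m j : coords R idx -> R :=
  open_weight (fun x => good (seq_of x) j)
    (fun x => `|rdet (gap (seq_of x) j.+1)| ^+ (p * m)).

Lemma dens_ge0 m j x : 0 <= dens m j x.
Proof. by apply: open_weight_ge0 => y; rewrite exprn_ge0. Qed.

Lemma near_good_seq_of j x : good (seq_of x) j -> cnear x (fun y => good (seq_of y) j).
Proof.
have := cnear_filter x => PF G; apply: (near_good (cnear_Filter x) (scvg_seq_of x)); [by []| | |exact: G].
- by move=> y; apply: seq_of_herm.
- exact: seq_of_herm.
Qed.

Lemma cvg_gap_seq_of j x : good (seq_of x) j ->
  ((fun y => rdet (gap (seq_of y) j.+1)) @ cnear x --> rdet (gap (seq_of x) j.+1))%classic.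
Proof.
have := cnear_filter x => PF G; apply: cvg_rdet.
by apply: (mcvg_gap (cnear_Filter x) (scvg_seq_of x)); [|exact: seq_of_herm|exact: G].
Qed.

Lemma measurable_dens m j : measurable_fun setT (fun x => (dens m j x)%:E).
Proof.
apply: measurable_open_weight => [y|x G|x G]; first by rewrite exprn_ge0.
  exact: near_good_seq_of.
by have := cnear_filter x => PF; apply: cvg_exprn; apply: cvg_norm; apply: cvg_gap_seq_of.
Qed.

Lemma dens_good m j x : good (seq_of x) j ->
  dens m j x = rdet (gap (seq_of x) j.+1) ^+ (p * m).
Proof.
move=> G; rewrite /dens /open_weight asboolT //.
have pD := pd_gap (erefl : seq_of x 0 = 1%:M) (seq_of_herm x) G.
by have [_ r0] := pd_rdet pD; rewrite gtr0_norm.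
Qed.

Lemma dens_bad m j x : ~ good (seq_of x) j -> dens m j x = 0.
Proof. by move=> G; rewrite /dens /open_weight asboolF. Qed.

Lemma dens0 j x : dens 0 j x = (\1_[set y | good (seq_of y) j] x : R).
Proof.
rewrite indicE; have [G|G] := pselect (good (seq_of x) j).
  by rewrite dens_good // muln0 expr0 mem_set.
by rewrite dens_bad // memNset.
Qed.

Lemma seq_of_off j x y : (forall c, c \notin block p j -> y c = x c) ->
  forall a, (a <= j)%N -> seq_of y a = seq_of x a.
Proof.
move=> h [//|a] aj; apply: herm_at_ext => ab; apply: h.
by rewrite mem_block /= ltn_eqF.
Qed.

(** The block [j] holds $S_{j+1}$, which runs between $S_{j+1}^-$ and $S_{j+1}^+$. The recurrence
    turns the density into a barrier divided by $\det(D_{j+1})^{pm}$, so the exponent becomes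
    $p+2pm-pm=p(m+1)$. *)
Lemma fiber m j x :
  (iint (block p j) (fun y => (dens m j.+1 y)%:E) x = beta (p * m) j * (dens m.+1 j x)%:E)%E.
Proof.
have [G|G] := pselect (good (seq_of x) j); last first.
  rewrite [dens m.+1 j x]dens_bad // mule0 -[RHS](iint0 (block p j) x).
  apply: eq_iint_off => y hy; rewrite dens_bad // => Gy; apply: G.
  by apply: (good_ext (seq_of_off hy)); apply: good_le Gy.
set s := seq_of x in G *.
have hs : herm_seq s by apply: seq_of_herm.
have s0 : s 0%N = 1%:M by [].
pose lo := lower_bound s j.+1; pose up := upper_bound s j.+1.
have eD : gap s j.+1 = up - lo by apply: gapE.
have pD : pdmx (up - lo) by rewrite -eD; apply: pd_gap.
have hlo : lo^t* = lo by apply: lower_bound_herm.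
have [dD r0] := pd_rdet pD.
have -> : iint (block p j) (fun y => (dens m j.+1 y)%:E) x =
  iint (block p j) (fun y => ((rdet (up - lo) ^+ (p * m))^-1)%:E *
    (barrier (p * m) (fun y => (herm_at y j - lo, up - herm_at y j)) y)%:E)%E x.
  apply: eq_iint_off => y hy; rewrite -EFinM; congr (_%:E).
  have e a : (a < j.+1)%N -> s a = seq_of y a by move=> aj; rewrite (seq_of_off hy).
  have eY : lower_gap (seq_of y) j.+1 = herm_at y j - lo.
    by rewrite lower_gapE -(lower_bound_ext e).
  have eZ : upper_gap (seq_of y) j.+1 = up - herm_at y j.
    by rewrite (upper_gapE _ (ltn0Sn j)) -(upper_bound_ext (ltn0Sn j) e).
  have Gy : good (seq_of y) j by apply: good_ext G => a aj; apply: e.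
  have [P|P] := pselect (pdmx (herm_at y j - lo) /\ pdmx (up - herm_at y j)).
    have Gy1 : good (seq_of y) j.+1 by apply/goodS; rewrite eY eZ; split; [exact: Gy|exact: P].
    rewrite (dens_good _ Gy1) (barrierE (F := fun y => (herm_at y j - lo, up - herm_at y j)) _ P.1 P.2).
    rewrite (rdet_gapS (erefl : seq_of y 0 = 1%:M) (seq_of_herm y) (ltn0Sn j) Gy1).
    by rewrite eY eZ -(gap_ext (ltn0Sn j) e) eD exprMn exprVn mulrC.
  rewrite dens_bad; last by move/goodS => [_]; rewrite eY eZ; exact: P.
  by rewrite /barrier open_weightF ?mulr0.
rewrite iintZ; last 3 first.
- by move=> y; rewrite lee_fin barrier_ge0.
- apply: measurable_barrier => [y|y| |].
  + by rewrite ctrB herm_at_adj hlo.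
  + by rewrite ctrB herm_at_adj upper_bound_herm.
  + exact: mx_continuousB (herm_at_continuous _) (mx_continuous_cst _).
  + exact: mx_continuousB (mx_continuous_cst _) (herm_at_continuous _).
- by rewrite invr_ge0 exprn_ge0 // ltW.
rewrite (iint_barrier _ _ _ hlo pD) (dens_good _ G) -/s eD muleA -EFinM muleC; congr (_ * (_)%:E)%E.
have -> : (p + p * m * 2 = p * m + p * m.+1)%N by rewrite mulnS; lia.
by rewrite exprD mulKf // expf_neq0 // gt_eqF.
Qed.

(** The last block is the innermost integral; each block yields a beta integral independent of the
    remaining coordinates, and these multiply to [c]. *)
Lemma fiber_marginal j m q : exists2 c : R, 0 < c & forall x,
  iint (blocks p j m) (fun y => (dens q (j + m) y)%:E) x = (c * dens (q + m) j x)%:E.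
Proof.
elim: m q => [|m IH] q.
  by exists 1 => // x; rewrite mul1r !addn0.
have [b b0 eb] := beta_bounds (p * q) (j + m).
have [c c0 hc] := IH q.+1.
exists (b * c); first exact: mulr_gt0.
move=> x; rewrite -addn1 blocks_cat blocks1 iint_cat addn1.
rewrite (_ : iint (block p (j + m)) _ = fun y => b%:E * (dens q.+1 (j + m) y)%:E)%E; last first.
  by apply/funext => y; rewrite addnS fiber eb.
rewrite iintZ ?(ltW b0) //.
- by rewrite hc -EFinM mulrA addSnnS.
- by move=> y; rewrite lee_fin dens_ge0.
- exact: measurable_dens.
Qed.

End Fibers.

(** * Moment sequences of matrix measures *)

Section RiemannSums.
Variable R : realType.
Implicit Types (i j N d : nat) (x y t : R).

Lemma exprn_diff_le j x y : 0 <= y -> y <= x -> x <= 1 ->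
  x ^+ j - y ^+ j <= j%:R * (x - y).
Proof.
move=> y0 yx x1; elim: j => [|j IH]; first by rewrite !expr0 subrr mul0r.
have xy : 0 <= x - y by rewrite subr_ge0.
have x0 : 0 <= x by apply: le_trans yx.
have yj1 : y ^+ j <= 1 by apply: exprn_ile1 => //; apply: le_trans yx x1.
have j0 : 0 <= j%:R * (x - y) by rewrite mulr_ge0.
rewrite !exprS -natr1 mulrDl mul1r.
have -> : x * x ^+ j - y * y ^+ j = x * (x ^+ j - y ^+ j) + y ^+ j * (x - y) by ring.
apply: lerD; last by rewrite ler_piMl.
by apply: le_trans (ler_wpM2l x0 IH) _; rewrite ler_piMl.
Qed.

(** For [i] up to $N+1$ these cells partition $[0,1]$, the last one being the single point $1$;
    hence the sums over [N.+2] indices. *)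
Definition cell N i : set (measurableTypeR R) :=
  [set t | 0 <= t <= 1 /\ i%:R <= t * N.+1%:R < i.+1%:R].

Definition node N i : R := i%:R / N.+1%:R.

Lemma node_ge0 N i : 0 <= node N i.
Proof. by rewrite divr_ge0. Qed.

Lemma node_le1 N (i : 'I_N.+2) : node N i <= 1.
Proof. by rewrite ler_pdivrMr // mul1r ler_nat -ltnS. Qed.

Lemma cellE N i : cell N i = `[0, 1]%classic `&`
  `[i%:R / N.+1%:R, i.+1%:R / N.+1%:R[%classic.
Proof.
by apply/seteqP; split=> t /=; rewrite !in_itv /= ler_pdivrMr // ltr_pdivlMr.
Qed.

Lemma measurable_cell N i : measurable (cell N i).
Proof. by rewrite cellE; apply: measurableI. Qed.

Lemma cell_ex N t : 0 <= t <= 1 -> {i : 'I_N.+2 | cell N i t}.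
Proof.
move=> t01; have /andP[t0 t1] := t01.
have tN : 0 <= t * N.+1%:R by rewrite mulr_ge0.
have /andP[h1 h2] := truncn_itv tN.
have h : (Num.truncn (t * N.+1%:R) < N.+2)%N.
  rewrite ltnS -(ler_nat R); apply: le_trans h1 _.
  by rewrite ler_piMl.
by exists (Ordinal h); split; rewrite //= h1.
Qed.

Lemma cell_uniq N i i' t : cell N i t -> cell N i' t -> i = i'.
Proof.
move=> [t01 /truncn_def <-] [_ /truncn_def <-] //.
Qed.

Lemma sum_cell N (g : nat -> R) (k : 'I_N.+2) t : cell N k t ->
  \sum_(i < N.+2) g i * \1_(cell N i) t = g k.
Proof.
move=> kt; rewrite (bigD1 k) //= indicE mem_set // mulr1 big1 ?addr0 // => i ik.
rewrite indicE memNset ?mulr0 // => it.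
by move/eqP: ik; apply; apply: val_inj; apply: cell_uniq it kt.
Qed.

Lemma node_gap N i t : t * N.+1%:R < i.+1%:R -> t - node N i <= N.+1%:R^-1.
Proof.
move=> h; rewrite lerBlDr; have -> : N.+1%:R^-1 + node N i = i.+1%:R / N.+1%:R.
  by rewrite /node -[i.+1%:R]natr1 mulrDl mul1r addrC.
by rewrite ler_pdivlMr // ltW.
Qed.

Definition riemann (nu : set (measurableTypeR R) -> \bar R) j N : R :=
  \sum_(i < N.+2) node N i ^+ j * fine (nu (cell N i)).

(** The node is the left end of its cell, so this is a lower sum, which $x^j$ exceeds pointwise by
    at most $j/(N+1)$. *)
Lemma riemann_measure (mu : {finite_measure set (measurableTypeR R) -> \bar R}) j N :
  riemann mu j N <= Rintegral mu `[0, 1] (fun x => x ^+ j) <=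
    riemann mu j N + j%:R / N.+1%:R * fine (mu `[0, 1]%classic).
Proof.
set D : set (measurableTypeR R) := `[0, 1]%classic.
have mD : measurable D by exact: measurable_itv.
have muf A : measurable A -> mu A \is a fin_num by apply: fin_num_measure.
have mpow : measurable_fun D (fun x : measurableTypeR R => (x ^+ j)%:E).
  by apply/measurable_EFinP; apply: measurable_funX.
pose h (x : measurableTypeR R) : \bar R :=
  (\sum_(i < N.+2) (node N i ^+ j * \1_(cell N i) x)%:E)%E.
have mh (i : 'I_N.+2) : measurable_fun D (fun x => (node N i ^+ j * \1_(cell N i) x)%:E).
  apply/measurable_EFinP; apply: measurable_funM => //.
  by apply: measurable_indic; apply: measurable_cell.
have h0 (i : 'I_N.+2) x : D x -> (0 <= (node N i ^+ j * \1_(cell N i) x)%:E)%E.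
  by rewrite lee_fin mulr_ge0 // exprn_ge0 // node_ge0.
have hE (x : measurableTypeR R) (k : 'I_N.+2) : cell N k x -> h x = (node N k ^+ j)%:E.
  by move=> kx; rewrite /h sumEFin (sum_cell (fun i => node N i ^+ j) kx).
have cellD (x : measurableTypeR R) : D x -> exists k : 'I_N.+2, cell N k x.
  rewrite /D /= in_itv /= => x01; have [k kx] := cell_ex N x01; by exists k.
have bnd (x : measurableTypeR R) (k : 'I_N.+2) : cell N k x -> 0 <= x <= 1 /\ node N k <= x /\ x - node N k <= N.+1%:R^-1.
  move=> [x01 /andP[h1 h2]]; split=> //; split; first by rewrite ler_pdivrMr.
  exact: node_gap.
have Ih : (\int[mu]_(x in D) h x = (riemann mu j N)%:E)%E.
  rewrite /h ge0_integral_sum // -sumEFin; apply: eq_bigr => i _.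
  under eq_integral do rewrite EFinM.
  rewrite ge0_integralZl //.
  - rewrite integral_indic //; last exact: measurable_cell.
    rewrite EFinM fineK ?muf //; last exact: measurable_cell.
    by congr (_ * mu _)%E; apply/setIidPl; rewrite cellE; apply: subIsetl.
  - by apply/measurable_EFinP; apply: measurable_indic; apply: measurable_cell.
  - by rewrite lee_fin exprn_ge0 // node_ge0.
have hge0 x : D x -> (0 <= h x)%E by move=> Dx; apply: sume_ge0 => i _; apply: h0.
have mhh : measurable_fun D h by apply: emeasurable_sum.
have pow0 (x : measurableTypeR R) : D x -> (0 <= (x ^+ j)%:E)%E.
  by rewrite /D /= in_itv /= lee_fin => /andP[x0 _]; rewrite exprn_ge0.
have le1 : ((riemann mu j N)%:E <= \int[mu]_(x in D) (x ^+ j)%:E)%E.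
  rewrite -Ih; apply: ge0_le_integral => // x Dx.
  have [k kx] := cellD x Dx; rewrite (hE x k kx) lee_fin.
  have [_ [nx _]] := bnd x k kx.
  by rewrite lerXn2r ?nnegrE ?node_ge0 // (le_trans (node_ge0 N k)).
have le2 : (\int[mu]_(x in D) (x ^+ j)%:E <=
    (riemann mu j N + j%:R / N.+1%:R * fine (mu D))%:E)%E.
  apply: (@le_trans _ _ (\int[mu]_(x in D) (h x + (j%:R / N.+1%:R)%:E))%E).
    apply: ge0_le_integral => //.
      by apply: emeasurable_funD.
    move=> x Dx; have [k kx] := cellD x Dx; rewrite (hE x k kx) -EFinD lee_fin.
    have [/andP[x0 x1] [nx nx']] := bnd x k kx.
    rewrite -lerBlDl; apply: le_trans (exprn_diff_le j (node_ge0 N k) nx x1) _.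
    by rewrite ler_wpM2l.
  rewrite ge0_integralD // Ih integral_cst // EFinD leeD2l //.
  have -> // : (j%:R / N.+1%:R * fine (mu D))%:E = ((j%:R / N.+1%:R)%:E * mu D)%E.
  by rewrite [LHS]EFinM (fineK (muf D mD)).
have fin : (\int[mu]_(x in D) (x ^+ j)%:E)%E \is a fin_num.
  by rewrite ge0_fin_numE ?(le_lt_trans le2) ?ltry // integral_ge0.
move: le1 le2; rewrite /Rintegral -(fineK fin) !lee_fin => -> ->.
by [].
Qed.

(** The Riemann sums use values of the charge itself, so the Hahn decomposition chosen in
    [charge_integral] drops out and integrals can be handled through values on cells. *)
Lemma riemann_charge (nu : {charge set (measurableTypeR R) -> \bar R}) j :
  exists2 c : R, 0 <= c & forall N,
    `|charge_integral nu `[0, 1]%classic (fun x => x ^+ j) - riemann nu j N| <= c / N.+1%:R.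
Proof.
rewrite /charge_integral; case: cid => P hP; case: cid => Q nuPN.
set D : set (measurableTypeR R) := `[0, 1]%classic.
exists (j%:R * (fine (jordan_pos nuPN D) + fine (jordan_neg nuPN D))).
  by rewrite mulr_ge0 // addr_ge0 // fine_ge0.
move=> N.
have -> : riemann nu j N = riemann (jordan_pos nuPN) j N - riemann (jordan_neg nuPN) j N.
  rewrite /riemann -sumrB; apply: eq_bigr => i _; rewrite -mulrBr; congr (_ * _).
  have mC := measurable_cell N i.
  have -> : nu (cell N i) =
      (jordan_pos nuPN (cell N i) + (-1)%:E * jordan_neg nuPN (cell N i))%E.
    by rewrite (jordan_decomp nuPN mC).
  by rewrite EFinN mulN1e fineB //; exact: fin_num_measure.
have /andP[a1 a2] := riemann_measure (jordan_pos nuPN) j N.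
have /andP[b1 b2] := riemann_measure (jordan_neg nuPN) j N.
have p0 : 0 <= j%:R / N.+1%:R * fine (jordan_pos nuPN D).
  by rewrite mulr_ge0 ?divr_ge0 // fine_ge0.
have n0 : 0 <= j%:R / N.+1%:R * fine (jordan_neg nuPN D).
  by rewrite mulr_ge0 ?divr_ge0 // fine_ge0.
rewrite mulrDr mulrDl [_ * fine _ / _]mulrAC [_ * fine (jordan_neg _ _) / _]mulrAC.
move: a1 a2 b1 b2 p0 n0.
rewrite -/D; move: (_ * fine (jordan_pos _ _)) (_ * fine (jordan_neg _ _)) => u v.
move: (Rintegral _ _ _) (Rintegral _ _ _) (riemann _ _ _) (riemann _ _ _).
move=> I1 I2 r1 r2 a1 a2 b1 b2 p0 n0; rewrite ler_norml; apply/andP; split; lra.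
Qed.

Lemma eq_of_norm_le (x y c : R) :
  (forall N : nat, `|x - y| <= c / N.+1%:R) -> x = y.
Proof.
move=> h; apply/eqP; rewrite -subr_eq0 -normr_eq0; apply/negPn/negP => n0.
have e0 : 0 < `|x - y| by rewrite lt0r n0 normr_ge0.
have := real_truncnS_gt (num_real (c / `|x - y|)); set N := Num.truncn _.
rewrite ltr_pdivrMr // => lt; have := h N.
by rewrite ler_pdivlMr // leNgt mulrC lt.
Qed.

Fixpoint atomic_charge (s : seq (R * R)) : {charge set (measurableTypeR R) -> \bar R} :=
  if s is wl :: s' then
    cadd (cscale wl.1 (charge_of_finite_measure (\d_(wl.2 : measurableTypeR R))))
      (atomic_charge s')
  else czero.

Lemma atomic_chargeE s A : measurable A ->
  atomic_charge s A = (\sum_(wl <- s) wl.1 * \1_A wl.2)%:E.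
Proof.
move=> mA; elim: s => [|wl s IH] /=; first by rewrite big_nil.
have -> : cadd (cscale wl.1 (charge_of_finite_measure \d_(wl.2 : measurableTypeR R))) (atomic_charge s) A =
  (wl.1%:E * \d_wl.2 A + atomic_charge s A)%E by [].
by rewrite IH diracE big_cons EFinD EFinM indicE.
Qed.

(** Both sides are compared with the same Riemann sums, which avoids computing a Jordan
    decomposition of the atomic charge. *)
Lemma atomic_charge_integral s j : (forall wl, wl \in s -> 0 <= wl.2 <= 1) ->
  charge_integral (atomic_charge s) `[0, 1]%classic (fun x => x ^+ j)
  = \sum_(wl <- s) wl.1 * wl.2 ^+ j.
Proof.
move=> s01; have [c c0 hc] := riemann_charge (atomic_charge s) j.
apply: (@eq_of_norm_le _ _ (c + j%:R * \sum_(wl <- s) `|wl.1|)) => N.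
rewrite mulrDl -(subrK (riemann (atomic_charge s) j N) (charge_integral _ _ _)).
rewrite -addrA (le_trans (ler_normD _ _)) // lerD //.
have -> : riemann (atomic_charge s) j N =
    \sum_(wl <- s) wl.1 * \sum_(i < N.+2) node N i ^+ j * \1_(cell N i) wl.2.
  rewrite /riemann.
  under eq_bigr => i _ do
    rewrite (atomic_chargeE s (measurable_cell N i)) /= mulr_sumr.
  rewrite exchange_big /=; apply: eq_bigr => wl _; rewrite mulr_sumr.
  by apply: eq_bigr => i _; rewrite mulrCA.
rewrite -sumrB (le_trans (ler_norm_sum _ _ _)) // mulrAC mulr_sumr.
rewrite big_seq [X in _ <= X]big_seq; apply: ler_sum => wl wls.
have [k kx] := cell_ex N (s01 _ wls).
rewrite (sum_cell (fun i => node N i ^+ j) kx) -mulrBr normrM mulrC ler_wpM2r //.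
have [/andP[x0 x1] /andP[h1 h2]] := kx.
have nx : node N k <= wl.2 by rewrite ler_pdivrMr.
rewrite distrC ger0_norm; last first.
  by rewrite subr_ge0 lerXn2r ?nnegrE ?node_ge0 // (le_trans (node_ge0 N k)).
apply: le_trans (exprn_diff_le j (node_ge0 N k) nx x1) _.
by rewrite ler_wpM2l // node_gap.
Qed.

End RiemannSums.

(** * Hankel forms of atomic sequences, mixtures and Gauss quadrature *)

Section AtomicHankelForms.
Variables (C : numClosedFieldType) (p : nat).
Implicit Types (f g s : nat -> 'M[C]_p) (u v : nat -> 'rV[C]_p) (m n j : nat).

Lemma hform_ext f g m u v : (forall a, (a <= m.-1.*2)%N -> f a = g a) ->
  hform f m u v = hform g m u v.
Proof.
move=> e; apply: eq_bigr => a _; apply: eq_bigr => b _; rewrite e //.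
by have := ltn_ord a; have := ltn_ord b; lia.
Qed.

Lemma hform_seqD f g m u v :
  hform (fun a => f a + g a) m u v = hform f m u v + hform g m u v.
Proof.
rewrite /hform -big_split; apply: eq_bigr => a _; rewrite -big_split.
by apply: eq_bigr => b _; rewrite mulmxDr mulmxDl.
Qed.

Lemma hform_seqZ (c : C) f m u v : hform (fun a => c *: f a) m u v = c *: hform f m u v.
Proof.
rewrite /hform scaler_sumr; apply: eq_bigr => a _; rewrite scaler_sumr.
by apply: eq_bigr => b _; rewrite -scalemxAr -scalemxAl.
Qed.

Lemma hform_seq_sum N (f : 'I_N -> nat -> 'M[C]_p) m u v :
  hform (fun a => \sum_i f i a) m u v = \sum_i hform (f i) m u v.
Proof.
rewrite /hform [RHS]exchange_big; apply: eq_bigr => a _; rewrite [RHS]exchange_big.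
by apply: eq_bigr => b _; rewrite mulmx_sumr mulmx_suml.
Qed.

(** $t^{a+b}$ factors, so the form evaluates the vector polynomial at the real point $t$. *)
Lemma hform_power (t : C) (A : 'M[C]_p) m u : t \is Num.real ->
  hform (fun a => t ^+ a *: A) m u u =
  (\sum_(a < m) t ^+ a *: u a) *m A *m (\sum_(a < m) t ^+ a *: u a)^t*.
Proof.
move=> tr; rewrite ctr_sum !mulmx_suml; apply: eq_bigr => a _.
rewrite mulmx_sumr; apply: eq_bigr => b _.
rewrite ctrZ (conj_Creal (rpredX b tr)) exprD.
by rewrite -!scalemxAl -!scalemxAr -scalemxAl scalerA.
Qed.

Lemma atomic_hform_ge0 N (c t : 'I_N -> C) (A : 'I_N -> 'M[C]_p) m u :
  (forall i, 0 <= c i) -> (forall i, t i \is Num.real) -> (forall i, psdmx (A i)) ->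
  0 <= hform (fun a => \sum_i (c i * t i ^+ a) *: A i) m u u 0 0.
Proof.
move=> c0 tr pA; rewrite hform_seq_sum summxE; apply: sumr_ge0 => i _.
rewrite (_ : hform _ _ _ _ = c i *: hform (fun a => t i ^+ a *: A i) m u u); last first.
  by rewrite -hform_seqZ; congr hform; apply/funext => a; rewrite scalerA.
rewrite mxE mulr_ge0 // hform_power //.
by have /psdP[_] := pA i; apply.
Qed.

(** The closed counterpart of the four positivity conditions in [good_hankels]; it holds for the
    moments of every matrix probability. *)
Definition psd_hankels s n :=
  [/\ forall m u, (m.*2 <= n)%N -> 0 <= hform s m.+1 u u 0 0,
      forall m u, (m.*2.+1 <= n)%N -> 0 <= hform (fun a => s a.+1) m.+1 u u 0 0,
      forall m u, (m.*2.+1 <= n)%N -> 0 <= hform (fun a => s a - s a.+1) m.+1 u u 0 0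
    & forall m u, (m.*2.+2 <= n)%N -> 0 <= hform (fun a => s a.+1 - s a.+2) m.+1 u u 0 0].

Lemma psd_hankels_ext s s' n : (forall a, (a <= n)%N -> s a = s' a) ->
  psd_hankels s n -> psd_hankels s' n.
Proof.
move=> e [h1 h2 h3 h4]; split=> m u mn.
- by rewrite -(@hform_ext s) ?h1 // => a am; apply: e; move: am mn => /=; lia.
- by rewrite -(@hform_ext (fun a => s a.+1)) ?h2 // => a am; apply: e; move: am mn => /=; lia.
- rewrite -(@hform_ext (fun a => s a - s a.+1)) ?h3 // => a am.
  by rewrite !e //; move: am mn => /=; lia.
- rewrite -(@hform_ext (fun a => s a.+1 - s a.+2)) ?h4 // => a am.
  by rewrite !e //; move: am mn => /=; lia.
Qed.

Definition mix (e : C) s s' a := e *: s a + (1 - e) *: s' a.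

Lemma mix_herm e s s' : 0 <= e -> herm_seq s -> herm_seq s' -> herm_seq (mix e s s').
Proof.
move=> e0 hs hs' a; rewrite ctrD !ctrZ hs hs' rmorphB /= conjC1.
by rewrite (conj_Creal (ger0_real e0)).
Qed.

(** The Hankel forms are linear in the sequence, and a positive multiple of a positive form plus a
    nonnegative form is positive. *)
Lemma mix_good e s s' n : s 0%N = 1%:M -> s' 0%N = 1%:M -> herm_seq s -> herm_seq s' ->
  0 < e -> e <= 1 -> good s n -> psd_hankels s' n -> good (mix e s s') n.
Proof.
move=> s0 s'0 hs hs' e0 e1 G [h1 h2 h3 h4].
have hm := mix_herm (ltW e0) hs hs'.
have m0 : mix e s s' 0%N = 1%:M by rewrite /mix s0 s'0 -scalerDl addrCA subrr addr0 scale1r.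
have [g1 g2 g3 g4] := (good_hankels _ s0 hs).1 G.
have key f f' m : herm_seq f -> herm_seq f' -> pdmx (hankel f m) ->
    (forall u, 0 <= hform f' m u u 0 0) -> pdmx (hankel (mix e f f') m).
  move=> hf hf' pf pf'; apply/pd_hankelP; first exact: mix_herm (ltW e0) hf hf'.
  move=> u hu; rewrite /mix hform_seqD !hform_seqZ mxE [X in _ + X]mxE.
  rewrite [X in X + _]mxE ltr_pwDl //.
    by rewrite mulr_gt0 //; move/(pd_hankelP _ hf): pf; apply.
  by rewrite mulr_ge0 ?subr_ge0.
have hs1 := herm_seqS hs; have hs'1 := herm_seqS hs'.
have hg0 := herm_seqB hs hs1; have hg'0 := herm_seqB hs' hs'1.
have hg1 := herm_seqS hg0; have hg'1 := herm_seqS hg'0.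
have mixB f1 f2 f1' f2' : (fun a => mix e f1 f1' a - mix e f2 f2' a) =
    mix e (fun a => f1 a - f2 a) (fun a => f1' a - f2' a).
  by apply/funext => a; rewrite /mix !scalerBr opprD addrACA.
apply/good_hankels => //; split=> m mn.
- by apply: key => //; [apply: g1|move=> u; apply: h1].
- by apply: (key (fun a => s a.+1) (fun a => s' a.+1)) => //; [apply: g2|move=> u; apply: h2].
- rewrite (mixB s (fun a => s a.+1) s' (fun a => s' a.+1)).
  by apply: key => //; [apply: g3|move=> u; apply: h3].
- rewrite (mixB (fun a => s a.+1) (fun a => s a.+2) (fun a => s' a.+1) (fun a => s' a.+2)).
  by apply: key => //; [apply: g4|move=> u; apply: h4].
Qed.

Lemma good_extend s n k : s 0%N = 1%:M -> herm_seq s -> good s n ->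
  exists s', [/\ forall a, (a <= n)%N -> s' a = s a, herm_seq s' & good s' (n + k)].
Proof.
move=> s0 hs G; elim: k => [|k [s' [e hs' G']]]; first by exists s; rewrite addn0.
have s'0 : s' 0%N = 1%:M by rewrite e.
have [ht Gt _] := extend_mid_good s'0 hs' G'.
exists (extend_mid s' (n + k)); split=> //; last by rewrite addnS.
by move=> a an; rewrite extend_mid_eq ?e // (leq_trans an) // leq_addr.
Qed.

Lemma submxblock_mul m (A B : 'M[C]_(\sum_(i < m) p)) (a b : 'I_m) :
  submxblock (A *m B) a b = submxcol A a *m submxrow B b :> 'M[C]_p.
Proof. by apply/matrixP => i j; rewrite !mxE; apply: eq_bigr => k _; rewrite !mxE. Qed.

(* With H = T T^* the block Hankel matrix of s and H' that of its shift, the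
   nodes are the eigenvalues of the Hermitian matrix T^-1 H' T^-*. *)
Lemma quadrature s m : s 0%N = 1%:M -> herm_seq s -> good s m.*2.+1 ->
  exists N (d : 'rV[C]_N) (F : 'I_N -> 'cV[C]_p),
    (forall i, 0 < d 0 i < 1) /\
    forall j, (j <= m.*2.+1)%N -> s j = \sum_i d 0 i ^+ j *: (F i *m (F i)^t*).
Proof.
move=> s0 hs G; have [g1 g2 g3 _] := (good_hankels _ s0 hs).1 G.
set H0 := hankel s m.+1; set H1 := hankel (fun a => s a.+1) m.+1.
have pH1 : pdmx H1 by apply: g2.
have pH01 : pdmx (H0 - H1).
  rewrite (_ : H0 - H1 = hankel (fun a => s a - s a.+1) m.+1); first exact: g3.
  by apply/matrixP => i j; rewrite !mxE.
(* Positivity of the Hankel matrices for the weights $x$ and $1-x$ puts the nodes into $(0,1)$. *)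
have [L [d [uL e1 _ e0 d01]]] := pd_simultaneous pH1 pH01.
rewrite addrC subrK in e0.
pose r (a : 'I_m.+1) : 'M[C]_(p, \sum_(i < m.+1) p) := submxcol L a.
pose D j := diag_mx (\row_i d 0 i ^+ j).
have DD i j : D i *m D j = D (i + j)%N.
  rewrite /D mulmx_diag; congr diag_mx; apply/rowP => k; rewrite !mxE.
  by rewrite exprD.
have rE (b : 'I_m.+1) : (r b)^t* = submxrow (L^t*) b by apply/matrixP => i j; rewrite !mxE.
have rr (a b : 'I_m.+1) : r a *m (r b)^t* = s (a + b)%N.
  by rewrite rE -submxblock_mul -e0 /H0 mxblockK.
have D1 : D 1%N = diag_mx d.
  by rewrite /D; congr diag_mx; apply/rowP => k; rewrite mxE.
have rDr (a b : 'I_m.+1) : r a *m D 1%N *m (r b)^t* = s (a + b).+1.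
  have -> : r a *m D 1%N = submxcol (L *m D 1%N) a.
    by apply/matrixP => i j; rewrite !mxE; apply: eq_bigr => k _; rewrite !mxE.
  by rewrite rE -submxblock_mul D1 -e1 /H1 mxblockK.
(* [D 1] acts on the block rows of [L] as multiplication by $x$: both sides have the same products
   with all adjoint block rows, and [L] is invertible. *)
have rS (a b : 'I_m.+1) : b = a.+1 :> nat -> r a *m D 1%N = r b.
  move=> ab; apply/eqP; rewrite -subr_eq0; apply/eqP.
  have uL' : L^t* \in unitmx by rewrite unitmx_adj.
  apply: (can_inj (mulmxK uL')); rewrite mul0mx; apply/mxrowP => c.
  rewrite -mul_submxrow -rE mulmxBl rDr rr ab addSn subrr.
  by apply/matrixP => i j; rewrite !mxE.
have r0D a (h : (a < m.+1)%N) : r (Ordinal h) = r ord0 *m D a.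
  elim: a h => [|a IH] h.
    rewrite (_ : D 0%N = 1%:M) ?mulmx1; first by congr r; apply: val_inj.
    rewrite /D -diag_const_mx; congr diag_mx; apply/rowP => k.
    by rewrite !mxE expr0.
  by rewrite -(rS (Ordinal (ltnW h))) // IH -mulmxA DD addn1.
have Dadj j : (D j)^t* = D j.
  rewrite /D tr_diag_mx map_diag_mx; congr diag_mx; apply/rowP => k; rewrite !mxE /=.
  by rewrite conj_Creal // rpredX // gtr0_real //; have /andP[] := d01 k.
have prod a b : r ord0 *m D a *m (r ord0 *m D b)^t* = r ord0 *m D (a + b)%N *m (r ord0)^t*.
  by rewrite ctrM Dadj mulmxA -(mulmxA (r ord0) (D a)) DD.
(* Up to $2m$ the index splits into two indices at most $m$; the top moment needs the shifted Hankel
   matrix. *)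
have key j : (j <= m.*2.+1)%N -> s j = r ord0 *m D j *m (r ord0)^t*.
  move=> jm; have [jm2|jm2] := leqP j m.*2.
    have h1 : (j - j./2 < m.+1)%N by lia.
    have h2 : (j./2 < m.+1)%N by lia.
    have -> : s j = s (Ordinal h1 + Ordinal h2)%N by congr s => /=; lia.
    rewrite -rr (r0D _ h1) (r0D _ h2) prod.
    by congr (_ *m D _ *m _); lia.
  have h1 : (m < m.+1)%N by [].
  have -> : s j = s (Ordinal h1 + Ordinal h1).+1 by congr s => /=; lia.
  rewrite -rDr (r0D _ h1) -(mulmxA (r ord0) (D m)) DD prod.
  by congr (_ *m D _ *m _); lia.
(* The masses are the rank-one matrices built from the columns of the first block row. *)
exists (\sum_(i < m.+1) p)%N, d, (fun i => col i (r ord0)); split=> // j jm.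
rewrite key //; apply/matrixP => a b; rewrite summxE mxE; apply: eq_bigr => k _.
rewrite mul_mx_diag !mxE big_ord1 !mxE mulrAC [RHS]mulrA.
by rewrite mulrC mulrA.
Qed.

End AtomicHankelForms.

Section Moments.
Variables (R : realType) (p : nat).
Local Notation Re := complex.Re.
Local Notation Im := complex.Im.
Implicit Types (mu : matrix_charge R p) (j n N m : nat).

Definition moment mu j : 'M[R[i]]_p := mc_integral mu `[0, 1] (fun x => x ^+ j).

Definition mc_riemann mu j N : 'M[R[i]]_p :=
  \sum_(i < N.+2) ((node R N i)%:C%C ^+ j) *: mc_val mu (cell N i).

Lemma Re_sum I (r : seq I) (P : pred I) (F : I -> R[i]) :
  Re (\sum_(i <- r | P i) F i) = \sum_(i <- r | P i) Re (F i).
Proof. by elim/big_rec2: _ => // i x y _ <-; rewrite cReD. Qed.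

Lemma Im_sum I (r : seq I) (P : pred I) (F : I -> R[i]) :
  Im (\sum_(i <- r | P i) F i) = \sum_(i <- r | P i) Im (F i).
Proof. by elim/big_rec2: _ => // i x y _ <-; rewrite cImD. Qed.

Lemma Re_real_scale (c : R) (z : R[i]) j :
  Re (c%:C%C ^+ j * z) = c ^+ j * Re z /\ Im (c%:C%C ^+ j * z) = c ^+ j * Im z.
Proof. by rewrite -rmorphXn /= cReM cImM /= !mul0r subr0 addr0. Qed.

Lemma mc_riemann_entry mu j N a b :
  Re (mc_riemann mu j N a b) = riemann (mc_re mu a b) j N /\
  Im (mc_riemann mu j N a b) = riemann (mc_im mu a b) j N.
Proof.
rewrite /mc_riemann summxE Re_sum Im_sum; split; apply: eq_bigr => i _; rewrite !mxE.
  by rewrite (Re_real_scale _ _ _).1.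
by rewrite (Re_real_scale _ _ _).2.
Qed.

Lemma cvg_riemann (nu : {charge set (measurableTypeR R) -> \bar R}) j :
  (riemann nu j N @[N --> \oo] --> charge_integral nu `[0%R, 1%R]%classic (fun x => x ^+ j))%classic.
Proof.
have [c c0 hc] := riemann_charge nu j; apply/cvgrPdist_lt => e e0.
exists (Num.truncn (c / e)) => // N /= hN; apply: le_lt_trans (hc N) _.
rewrite ltr_pdivrMr // mulrC -ltr_pdivrMr //.
apply: lt_le_trans (real_truncnS_gt (num_real _)) _.
by rewrite ler_nat ltnS.
Qed.

Lemma mcvg_mc_riemann mu j : mcvg \oo (mc_riemann mu j) (moment mu j).
Proof.
move=> a b; apply: ccvg_complex.
- rewrite (_ : (fun N => _) = riemann (mc_re mu a b) j).
    by rewrite mxE; apply: cvg_riemann.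
  by apply/funext => N; have [] := mc_riemann_entry mu j N a b.
- rewrite (_ : (fun N => _) = riemann (mc_im mu a b) j).
    by rewrite mxE; apply: cvg_riemann.
  by apply/funext => N; have [] := mc_riemann_entry mu j N a b.
Qed.

Lemma mcvg_hform (C : numClosedFieldType) T (F : set_system T) (FF : Filter F)
    (f : T -> nat -> 'M[C]_p) f0 m (u : nat -> 'rV[C]_p) :
  scvg F f f0 -> ccvg F (fun x => hform (f x) m u u 0 0) (hform f0 m u u 0 0).
Proof.
move=> ff; rewrite -hform_hankel.
have hH : mcvg F (fun x => hankel (f x) m) (hankel f0 m).
  by move=> i j; rewrite mxE; apply: ccvg_ext (ff _ _ _) => x; rewrite mxE.
have h : mcvg F (fun x => hform (f x) m u u)
    (\mxrow_(a < m) u a *m hankel f0 m *m (\mxrow_(a < m) u a)^t*).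
  apply: mcvg_ext (mcvgM FF (mcvgM FF (mcvg_cst FF _) hH) (mcvg_cst FF _)) => x.
  exact: hform_hankel.
exact: h.
Qed.

Let oo_proper : ProperFilter (\oo : set_system nat) := eventually_filter.
Let oo_filter : Filter (\oo : set_system nat).
Proof. have := oo_proper; typeclasses eauto. Qed.

Section Probability.
Variables (mu : matrix_charge R p) (pmu : matrix_probability01 mu).

Lemma psd_mc_cell N (i : nat) : psdmx (mc_val mu (cell N i)).
Proof. by case: pmu => h _ _; apply: h; apply: measurable_cell. Qed.

Lemma node_real N (i : nat) : (node R N i : R)%:C%C \is Num.real.
Proof. by apply/complex_realP; exists (node R N i : R). Qed.

Lemma moment_herm : herm_seq (moment mu).
Proof.
move=> j; apply: psd_herm; apply: (mcvg_psd oo_filter oo_proper _ (mcvg_mc_riemann mu j)).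
apply: filterE => N.
have h : 0 <= (0 : R[i]) by [].
elim/big_ind: (mc_riemann mu j N) => [|A B|i _]; first exact: psdmx0.
  exact: psdD.
apply: psdZ (psd_mc_cell _ _); apply: exprn_ge0.
by rewrite ler0c node_ge0.
Qed.

Lemma moment0 : moment mu 0 = 1%:M.
Proof. by case: pmu => _ _ <-; congr mc_integral; apply/funext => x; rewrite expr0. Qed.

(** The weights $1$, $t$, $1-t$ and $(1-t)t$ yield the four Hankel families. The Riemann sums are
    atomic forms with nonnegative definite masses, and the sign passes to the limit. *)
Lemma moment_hform (f : nat -> 'M[R[i]]_p) (c : R -> R) m u :
  (forall t, 0 <= t <= 1 -> 0 <= c t) ->
  scvg \oo (fun N a => \sum_(i < N.+2)
     ((c (node R N i))%:C%C * (node R N i)%:C%C ^+ a) *: mc_val mu (cell N i)) f ->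
  0 <= hform f m u u 0 0.
Proof.
move=> c0 hf; apply: (ccvg_ge0 oo_filter oo_proper _ (mcvg_hform oo_filter m u hf)).
apply: filterE => N; apply: atomic_hform_ge0 => i.
- by rewrite ler0c c0 // node_ge0 node_le1.
- exact: node_real.
- exact: psd_mc_cell.
Qed.

Lemma moment_psd_hankels n : psd_hankels (moment mu) n.
Proof.
have cv a := mcvg_mc_riemann mu a.
split=> m u _.
- apply: (@moment_hform (moment mu) (fun=> 1) m.+1 u) => [t _|a]; first exact: ler01.
  by apply: mcvg_ext (cv a) => N; apply: eq_bigr => i _; rewrite mul1r.
- apply: (@moment_hform (fun a => moment mu a.+1) id m.+1 u) => [t /andP[]//|a].
  by apply: mcvg_ext (cv a.+1) => N; apply: eq_bigr => i _; rewrite exprS.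
- apply: (@moment_hform (fun a => moment mu a - moment mu a.+1) (fun t => 1 - t) m.+1 u).
    by move=> t /andP[]; rewrite subr_ge0.
  move=> a; apply: mcvg_ext (mcvgB oo_filter (cv a) (cv a.+1)) => N.
  rewrite -sumrB; apply: eq_bigr => i _; rewrite -scalerBl; congr (_ *: _).
  by rewrite rmorphB rmorph1 mulrBl mul1r exprS.
- apply: (@moment_hform (fun a => moment mu a.+1 - moment mu a.+2)
    (fun t => (1 - t) * t) m.+1 u).
    by move=> t /andP[t0 t1]; rewrite mulr_ge0 // subr_ge0.
  move=> a; apply: mcvg_ext (mcvgB oo_filter (cv a.+1) (cv a.+2)) => N.
  rewrite -sumrB; apply: eq_bigr => i _; rewrite -scalerBl; congr (_ *: _).
  set t := node R N i; have -> : ((1 - t) * t)%:C%C = (1 - t%:C%C) * t%:C%C.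
    rewrite (rmorphM (real_complex R)) (rmorphB (real_complex R)).
    by rewrite (rmorph1 (real_complex R)).
  by rewrite !exprS; ring.
Qed.

End Probability.

Section Atomic.
Variables (q : nat) (lam : 'I_q -> R) (F : 'I_q -> 'cV[R[i]]_p).
Hypothesis lam01 : forall i, 0 <= lam i <= 1.
Hypothesis F1 : \sum_i F i *m (F i)^t* = 1%:M.

Let entry (i : 'I_q) (a b : 'I_p) := (F i *m (F i)^t*) a b.

Definition atomic_mc : matrix_charge R p := MatrixCharge
  (fun a b => atomic_charge [seq (Re (entry i a b), lam i) | i <- index_enum 'I_q])
  (fun a b => atomic_charge [seq (Im (entry i a b), lam i) | i <- index_enum 'I_q]).

Lemma atomic_mc_val A : measurable A ->
  mc_val atomic_mc A = \sum_i (\1_A (lam i))%:C%C *: (F i *m (F i)^t*).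
Proof.
move=> mA; apply/matrixP => a b; rewrite summxE mxE !atomic_chargeE //= !big_map /=.
have -> : \sum_i ((\1_A (lam i))%:C%C *: (F i *m (F i)^t*)) a b =
   \sum_i (\1_A (lam i))%:C%C ^+ 1 * entry i a b.
  by apply: eq_bigr => i _; rewrite mxE.
set z := \sum_i _ ^+ 1 * _.
rewrite (_ : z = (Re z +i* Im z)%C); last by case: z.
rewrite /z Re_sum Im_sum; congr Complex; apply: eq_bigr => i _.
  by rewrite (Re_real_scale _ _ _).1 expr1 mulrC.
by rewrite (Re_real_scale _ _ _).2 expr1 mulrC.
Qed.

Lemma atomic_moment j : moment atomic_mc j = \sum_i ((lam i)%:C%C ^+ j) *: (F i *m (F i)^t*).
Proof.
apply/matrixP => a b; rewrite summxE mxE !atomic_charge_integral; first last.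
- by move=> wl /mapP[i _ ->] /=; apply: lam01.
- by move=> wl /mapP[i _ ->] /=; apply: lam01.
rewrite !big_map /=.
have -> : \sum_i ((lam i)%:C%C ^+ j *: (F i *m (F i)^t*)) a b =
   \sum_i (lam i)%:C%C ^+ j * entry i a b.
  by apply: eq_bigr => i _; rewrite mxE.
set z := \sum_i _ ^+ j * _.
rewrite (_ : z = (Re z +i* Im z)%C); last by case: z.
rewrite /z Re_sum Im_sum; congr Complex; apply: eq_bigr => i _.
  by rewrite (Re_real_scale _ _ _).1 mulrC.
by rewrite (Re_real_scale _ _ _).2 mulrC.
Qed.

Lemma atomic_mc_probability : matrix_probability01 atomic_mc.
Proof.
split.
- move=> A mA; rewrite atomic_mc_val //.
  elim/big_ind: (\sum_i _) => [|B D|i _]; [exact: psdmx0|exact: psdD|].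
  by apply: psdZ; [rewrite ler0c|exact: psd_gram].
- rewrite atomic_mc_val; last by apply: measurableC; exact: measurable_itv.
  rewrite big1 // => i _; rewrite indicE memNset ?scale0r //=.
  by apply; rewrite in_itv /=; apply: lam01.
- rewrite -F1 -[RHS](_ : moment atomic_mc 0 = _); last first.
    by rewrite atomic_moment; apply: eq_bigr => i _; rewrite expr0 scale1r.
  by congr mc_integral; apply/funext => x; rewrite expr0.
Qed.

End Atomic.

Lemma good_moment_space n (s : nat -> 'M[R[i]]_p) : s 0%N = 1%:M -> herm_seq s ->
  good s n -> moment_space (\row_(l < n) s l.+1).
Proof.
(* [quadrature] treats sequences good up to an odd index; $n+1$ further midpoints give the index
   $2n+1$. *)
move=> s0 hs G; have [s' [e hs' G']] := good_extend n.+1 s0 hs G.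
have s'0 : s' 0%N = 1%:M by rewrite e.
rewrite (_ : n + n.+1 = n.*2.+1)%N in G'; last lia.
have [q [d [F [d01 hd]]]] := quadrature s'0 hs' G'.
pose lam i := Re (d 0 i).
have dE i : d 0 i = (lam i)%:C%C.
  have /andP[/gt0_complex[h _] _] := d01 i.
  by move: h; rewrite /lam; case: (d 0 i) => x y /= ->.
have lam01 i : 0 <= lam i <= 1.
  have /andP[a b] := d01 i; have [_ r1] := gt0_complex a.
  have b' : 0 < 1 - d 0 i by rewrite subr_gt0.
  have [_] := gt0_complex b'; rewrite cReB /= subr_gt0 => r2.
  by rewrite /lam (ltW r1) (ltW r2).
have F1 : \sum_i F i *m (F i)^t* = 1%:M.
  by rewrite -s'0 hd //; apply: eq_bigr => i _; rewrite expr0 scale1r.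
exists (atomic_mc lam F); first exact: atomic_mc_probability.
move=> j; rewrite mxE -[RHS]/(moment _ _) atomic_moment //.
rewrite -e // hd; last by have := ltn_ord j; lia.
by apply: eq_bigr => i _; rewrite dE.
Qed.

End Moments.

(** * The moment space as a subset of the Hermitian tuples *)

Section TupleTopology.
Variables (R : realType) (p : nat).
Implicit Types (n : nat).

Lemma cvg_rowP n T (F : set_system T) (f : T -> 'rV['M[R[i]]_p]_n) (A : 'rV['M[R[i]]_p]_n) :
  Filter F -> f @ F --> A <-> forall j, mcvg F (fun x => f x 0 j) (A 0 j).
Proof.
move=> FF; split=> [/cvg_ballP h j a b e e0|h].
  apply: filterS (h e e0) => x [_ /(_ 0 j) [_ /(_ a b)]].
  by rewrite /ball /= distrC.
apply/cvg_ballP => e e0.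
have : \forall x \near F, forall j : 'I_n, forall a b : 'I_p, `|f x 0 j a b - A 0 j a b| < e.
  apply: filter_forall => j; apply: filter_forall => a; apply: filter_forall => b.
  exact: h.
apply: filterS => x hx; split=> // i j; rewrite ord1; split=> // a b.
by have := hx j a b; rewrite /ball /= distrC.
Qed.

Lemma moment_seq_lt n (S : 'rV['M[R[i]]_p]_n) (l : 'I_n) : moment_seq S l.+1 = S 0 l.
Proof. by rewrite /moment_seq; case: insubP => [u _ /val_inj -> //|]; rewrite ltn_ord. Qed.

Lemma moment_seq_ge n (S : 'rV['M[R[i]]_p]_n) a : (n <= a)%N -> moment_seq S a.+1 = 0.
Proof. by move=> h; rewrite /moment_seq insubN // -leqNgt. Qed.

Lemma moment_seq_ext n (S : 'rV['M[R[i]]_p]_n) s : s 0%N = 1%:M ->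
  (forall l : 'I_n, S 0 l = s l.+1) -> forall a, (a <= n)%N -> moment_seq S a = s a.
Proof. by move=> s0 h [|a] // an; have := moment_seq_lt S (Ordinal an); rewrite h. Qed.

Lemma moment_seq_row n (S : 'rV['M[R[i]]_p]_n) : S = \row_(l < n) moment_seq S l.+1.
Proof. by apply/rowP => l; rewrite mxE moment_seq_lt. Qed.

Lemma moment_seq_herm n (S : 'rV['M[R[i]]_p]_n) : herm_tuples S -> herm_seq (moment_seq S).
Proof.
move=> h [|a] /=; first exact: ctr1.
case: insubP => [u _ _|_]; last exact: ctr0.
by apply/hermsymP; apply: h.
Qed.

Lemma scvg_moment_seq n T (F : set_system T) (FF : Filter F) (f : T -> 'rV['M[R[i]]_p]_n)
    (A : 'rV['M[R[i]]_p]_n) :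
  f @ F --> A -> scvg F (fun x => moment_seq (f x)) (moment_seq A).
Proof.
move/cvg_rowP => h [|a] /=; first exact: mcvg_cst.
by case: insubP => [u _ _|_]; [apply: h | apply: mcvg_cst].
Qed.

Lemma moment_space_herm n (S : 'rV['M[R[i]]_p]_n) : moment_space S ->
  herm_tuples S /\ psd_hankels (moment_seq S) n.
Proof.
case=> mu pmu h; split=> [l|].
  by rewrite h; apply/hermsymP; apply: (moment_herm pmu).
apply: psd_hankels_ext (moment_psd_hankels pmu n) => a an; apply/esym.
apply: moment_seq_ext an => [|l]; [exact: moment0 | exact: h].
Qed.

Lemma good_tuple_moment_space n (S : 'rV['M[R[i]]_p]_n) : herm_tuples S ->
  good (moment_seq S) n -> moment_space S.
Proof.
move=> hS G; rewrite [S]moment_seq_row; apply: good_moment_space => //.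
exact: moment_seq_herm.
Qed.

Lemma near_good_tuple n (S : 'rV['M[R[i]]_p]_n) : herm_tuples S ->
  good (moment_seq S) n ->
  within (@herm_tuples R p n) (nbhs S) [set T | good (moment_seq T) n].
Proof.
move=> hS G; pose F := within (@herm_tuples R p n) (nbhs S).
have FF : Filter F by apply: within_filter.
(* [near_good] asks every member of the family to be Hermitian; other tuples are replaced by the
   limit, which the restricted filter does not notice. *)
pose f T := if `[< herm_tuples T >] then T else S.
have nf : \forall T \near F, T = f T.
  by apply: (filterE (F := nbhs S)) => T hT; rewrite /f asboolT.
have cf : f @ F --> S.
  move=> A nA; have nA' : F A by apply: cvg_within nA.
  by apply: filterS2 nf nA' => T eT AT; rewrite /= -eT.
have hf T : herm_seq (moment_seq (f T)).
  by apply: moment_seq_herm; rewrite /f; case: asboolP.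
have h := near_good FF (scvg_moment_seq FF cf) (erefl _) hf (moment_seq_herm hS) G.
by apply: filterS2 nf h => T <-.
Qed.

Lemma cvg_mul_row n (S D : 'rV['M[R[i]]_p]_n) :
  (fun N => \row_l (S 0 l + ((N.+1%:R)^-1 : R)%:C%C *: D 0 l)) @ \oo --> S.
Proof.
apply/cvg_rowP => l; apply: (mcvg_ext (f := fun N => S 0 l + ((N.+1%:R)^-1 : R)%:C%C *: D 0 l)).
  by move=> N; rewrite mxE.
rewrite -[X in mcvg _ _ X]addr0 -[X in _ + X](scale0r (D 0 l)).
apply: mcvgD; first exact: mcvg_cst.
apply: mcvgZ; last exact: mcvg_cst.
apply: ccvg_complex => /=; last exact: cvg_cst.
exact: (@cvg_harmonic R).
Qed.

Lemma mix_cancel (F : numFieldType) m (x y : 'M[F]_m) N :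
  x = N.+2%:R^-1 *: y + (1 - N.+2%:R^-1) *: (x + N.+1%:R^-1 *: (x - y)).
Proof.
apply/matrixP => a b; rewrite !mxE.
have N1 : 1 + N%:R != 0 :> F by rewrite addrC natr1 pnatr_eq0.
have N2 : 2 + N%:R != 0 :> F by rewrite -natrD pnatr_eq0.
rewrite -[N.+2]add2n -[N.+1]add1n !natrD; field.
by rewrite N1 N2.
Qed.

(** At an interior point $S$, the point $S+(S-c)/(N+1)$, beyond it on the ray from a good center
    $c$, is still a moment tuple for some $N$. Its Hankel forms are nonnegative, and $S$ is its
    mixture with $c$ taken with weight $1/(N+2)$, hence good. The converse combines openness of
    [good] with quadrature. *)
Lemma herm_interior_moment_space n (S : 'rV['M[R[i]]_p]_n) :
  herm_interior (@moment_space R p n) S <-> herm_tuples S /\ good (moment_seq S) n.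
Proof.
split=> [[hS iS]|[hS G]].
  split=> //; have [c [c0 hc gc _]] := center_exists R[i] p n.
  pose D := \row_(l < n) (S 0 l - c l.+1).
  pose f (N : nat) := \row_l (S 0 l + ((N.+1%:R)^-1 : R)%:C%C *: D 0 l).
  have hf N : herm_tuples (f N).
    move=> l; apply/hermsymP; rewrite !mxE ctrD ctrZ ctrB hc.
    by rewrite (hermsymP _).1 ?hS // conjCE /= oppr0.
  have : \forall N \near \oo, moment_space (f N).
    have := @cvg_mul_row n S D; rewrite -/f => cf.
    have iS' : nbhs S [set T | herm_tuples T -> moment_space T] by exact: iS.
    have nB : \forall N \near \oo, herm_tuples (f N) -> moment_space (f N) := cf _ iS'.
    by apply: filterS nB => N /(_ (hf N)).
  move=> [N _ /(_ N (leqnn N))] /moment_space_herm [_ psf].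
  pose e : R[i] := N.+2%:R^-1.
  have e0 : 0 < e by rewrite invr_gt0 ltr0n.
  have e1 : e <= 1 by rewrite invf_le1 ?ler1n ?ltr0n.
  have G := mix_good c0 (erefl _) hc (moment_seq_herm (hf N)) e0 e1 gc psf.
  apply: good_ext G => a an; apply/esym; move: a an; apply: moment_seq_ext => [|l].
    by rewrite /mix c0 /= -scalerDl addrC subrK scale1r.
  rewrite /mix moment_seq_lt !mxE fmorphV rmorph_nat -/(_.+1).
  exact: mix_cancel.
split=> //.
have nB : \forall T \near S, herm_tuples T -> good (moment_seq T) n := near_good_tuple hS G.
have nC : \forall T \near S, herm_tuples T -> moment_space T.
  by apply: filterS nB => T h hT; apply: good_tuple_moment_space (h hT).
exact: nC.
Qed.

End TupleTopology.

Section RateFunction.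
Variables (R : realType) (p : nat).
Implicit Types (s : nat -> 'M[R[i]]_p).

Lemma psd_tuple_herm n (S : psd_tuple R p n) : herm_tuples (psd_tuple_val S).
Proof. by move=> j; have /set_mem h := svalP S; have [] := h j. Qed.

Lemma moment_rate_good k (S : psd_tuple R p k) : (0 < k)%N ->
  good (moment_seq (psd_tuple_val S)) k ->
  moment_rate S = (- p%:R * ln (rdet (gap (moment_seq (psd_tuple_val S)) k.+1))
                   - 2 * k%:R * p%:R ^+ 2 * ln 2)%:E.
Proof.
case: k S => [|k] S // _ G; rewrite /moment_rate asboolT.
  by rewrite S_plusE S_minusE gapE.
apply/herm_interior_moment_space; split=> // j; apply: (psd_tuple_herm S j).
Qed.

Lemma moment_rate_bad k (S : psd_tuple R p k) :
  ~ good (moment_seq (psd_tuple_val S)) k -> moment_rate S = +oo%E.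
Proof.
by move=> G; rewrite /moment_rate asboolF // => /herm_interior_moment_space [].
Qed.

(** The additive constant of the rate comes from the largest determinant, so that the rate vanishes
    at the center. *)
Lemma max_gap k : (2 * k%:R * p%:R ^+ 2 * ln 2 : R) = - p%:R * ln (((4 ^+ p)^-1) ^+ k).
Proof.
rewrite lnXn ?invr_gt0 ?exprn_gt0 // lnV ?posrE ?exprn_gt0 // lnXn //.
have -> : (4 : R) = 2 ^+ 2 by rewrite -natrX.
by rewrite lnXn //; ring.
Qed.

Lemma rdet_gap_le k s : s 0%N = 1%:M -> herm_seq s -> good s k ->
  0 < rdet (gap s k.+1) <= ((4 ^+ p)^-1) ^+ k.
Proof.
move=> s0 hs G; have [e ->] := pd_rdet (pd_gap s0 hs G).
have := det_gap_le s0 hs G; rewrite e.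
have -> : ((4 ^+ p)^-1) ^+ k = ((((4 ^+ p)^-1) ^+ k : R))%:C%C.
  by rewrite !(rmorphXn, fmorphV, rmorph_nat).
by rewrite lecR.
Qed.

End RateFunction.

Lemma iintD (R : realType) (I : choiceType) (s : seq I) (f g : coords R I -> \bar R) (x : coords R I) :
  (forall y, 0 <= f y)%E -> (forall y, 0 <= g y)%E ->
  measurable_fun setT f -> measurable_fun setT g ->
  (iint s (fun y => f y + g y) x = iint s f x + iint s g x)%E.
Proof.
move=> f0 g0 mf mg; elim: s x => [|i s IH] x //.
rewrite !iint_cons -ge0_integralD //.
- by apply: eq_integral => t _; rewrite IH.
- by move=> t _; apply: iint_ge0.
- exact: measurableT_comp (iint_measurable s f0 mf) (measurable_upd x i).
- by move=> t _; apply: iint_ge0.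
- exact: measurableT_comp (iint_measurable s g0 mg) (measurable_upd x i).
Qed.

Lemma measurable_ind d (T : measurableType d) (R : realType) (A : set T) : measurable A ->
  measurable_fun setT (fun y : T => (\1_A y : R)%:E).
Proof. by move=> mA; apply/measurable_EFinP; apply: measurable_indic. Qed.

(** * Volume of the moment space and negligibility of its boundary *)

Section MomentSpaceVolume.
Variables (R : realType) (p : nat).
Local Notation idx := (nat * ('I_p * 'I_p))%type.
Local Notation ind A := (fun y => (\1_A y : R)%:E).
Implicit Types (x y : coords R idx).

Definition good_coords n : set (coords R idx) := [set y | good (seq_of y) n].

Lemma measurable_good_coords n : measurable (good_coords n).
Proof.
have h : measurable_fun setT (ind (good_coords n)).
  apply: eq_measurable_fun (measurable_dens 0 n) => y _.
  by rewrite dens0.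
have := h measurableT [set 1%:E] (emeasurable_set1 _); rewrite setTI.
congr measurable; apply/seteqP; split=> y /=; rewrite indicE.
  by case: (boolP (y \in _)) => [/set_mem //|_ [/eqP]]; rewrite eq_sym oner_eq0.
by move=> h'; rewrite mem_set.
Qed.

Definition volume n := iint (blocks p 0 n) (ind (good_coords n)) (fun=> 0%R).

(** All blocks are integrated out; since $D_1=I_p$ the remaining density is $1$ and only the beta
    constants are left. *)
Lemma volume_bounds n : exists2 v : R, 0 < v & volume n = v%:E.
Proof.
have [c c0 h] := fiber_marginal R p 0 n 0.
have := h (fun=> 0%R); rewrite dens_good; last exact: good0.
rewrite gap1 // /rdet det1 /= expr1n mulr1 => e; exists c => //.
by rewrite -e; apply: eq_iint => y; rewrite dens0.
Qed.

(** The homothety of ratio $1-e$ towards [c], written as a shear with constant offsets so that its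
    Jacobian is already known. *)
Definition contract n (c : nat -> 'M[R[i]]_p) (e : R) : coords R idx -> coords R idx :=
  shear (fun=> 1 - e) (fun i _ => e * coord_of (c i.1.+1) i.2) (blocks p 0 n).

Lemma coord_ofZ (r : R) (A : 'M[R[i]]_p) ab : coord_of (r%:C%C *: A) ab = r * coord_of A ab.
Proof. by rewrite /coord_of; case: ifP => _; rewrite mxE ?cReM ?cImM /=; ring. Qed.

Lemma seq_of_contract n c e x : herm_seq c -> c 0%N = 1%:M ->
  forall a, (a <= n)%N -> seq_of (contract n c e x) a = mix e%:C%C c (seq_of x) a.
Proof.
move=> hc c0 [|l] ln; first by rewrite /mix c0 -scalerDl addrC subrK scale1r.
have hm : (mix e%:C%C c (seq_of x) l.+1)^t* = mix e%:C%C c (seq_of x) l.+1.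
  rewrite /mix ctrD !ctrZ hc seq_of_herm -[1]/(1%:C%C) -rmorphB.
  by rewrite !conjCE /= oppr0.
rewrite -(@herm_at_coord_of _ _ (fun l => mix e%:C%C c (seq_of x) l.+1) l hm).
apply: herm_at_ext => ab; rewrite /contract /shear mem_blocks /= ln /mix coord_ofD.
rewrite -[1 in X in _ = X]/(1%:C%C) -rmorphB !coord_ofZ coord_of_herm_at.
by rewrite addrC.
Qed.

Lemma contract_iint n c e (A : set (coords R idx)) x : 0 < e < 1 -> measurable A ->
  iint (blocks p 0 n) (ind A \o contract n c e) x =
  (((1 - e)^-1 ^+ size (blocks p 0 n))%:E * iint (blocks p 0 n) (ind A) x)%E.
Proof.
move=> /andP[e0 e1] mA; rewrite iint_shear //.
- by rewrite big_const_seq count_predT iter_mulr_1.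
- exact: blocks_uniq.
- by move=> _; rewrite subr_gt0.
- by elim: (blocks _ _ _) => //= a s IH; split.
- exact: measurable_ind.
Qed.

Lemma moment_seq_row_of n x a : (a <= n)%N -> moment_seq (row_of n x) a = seq_of x a.
Proof. by move: a; apply: moment_seq_ext => // l; rewrite mxE. Qed.

Lemma row_of_herm n x : herm_tuples (row_of n x).
Proof. by move=> l; apply/hermsymP; rewrite mxE herm_at_adj. Qed.

Lemma good_row_of n x : good (moment_seq (row_of n x)) n <-> good (seq_of x) n.
Proof. by split; apply: good_ext => a an; rewrite moment_seq_row_of. Qed.

Section Boundary.
Variables (n : nat) (c : nat -> 'M[R[i]]_p).
Hypotheses (c0 : c 0%N = 1%:M) (hc : herm_seq c) (gc : good c n).

Let ratio (m : nat) : R := m.+2%:R^-1.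

Let ratio01 m : 0 < ratio m < 1.
Proof. by rewrite invr_gt0 ltr0n /= invf_lt1 ?ltr1n ?ltr0n. Qed.

(* The contraction of a moment sequence towards c is good, so the moment space
   lies in the hull; but the hull has at most (1 - ratio m)^-N times the volume
   of the set of good sequences for all m, so the boundary is negligible. *)
Definition in_hull s := forall m, good (mix (ratio m)%:C%C c s) n.

Definition hull : set (coords R idx) := [set x | in_hull (seq_of x)].

Lemma in_hull_ext s t : (forall a, (a <= n)%N -> s a = t a) -> in_hull s -> in_hull t.
Proof.
by move=> st h m; apply: good_ext (h m) => a an; rewrite /mix st.
Qed.

Lemma measurable_hull : measurable hull.
Proof.
rewrite (_ : hull = \bigcap_m (contract n c (ratio m) @^-1` good_coords n)).
  apply: bigcap_measurable => [|m _]; first by exists 0%N.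
  rewrite -[X in measurable X]setTI; apply: measurable_shear => //.
  exact: measurable_good_coords.
apply/seteqP; split=> x h m; have := h m.
  by move=> {}h _; apply: good_ext h => a an; rewrite seq_of_contract.
by move=> /(_ Logic.I); apply: good_ext => a an; rewrite seq_of_contract.
Qed.

Lemma psd_hankels_hull s : s 0%N = 1%:M -> herm_seq s -> psd_hankels s n -> in_hull s.
Proof.
move=> s0 hs h m; have /andP[e0 e1] := ratio01 m.
by apply: mix_good => //; rewrite ?ltcR ?lecR //; exact: ltW.
Qed.

Lemma hull_volume : (iint (blocks p 0 n) (ind hull) (fun=> 0%R) <= volume n)%E.
Proof.
have [v v0 ev] := volume_bounds n; rewrite ev.
have le m : (iint (blocks p 0 n) (ind hull) (fun=> 0%R) <=
    ((1 - ratio m)^-1 ^+ size (blocks p 0 n) * v)%:E)%E.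
  rewrite EFinM -ev -(@contract_iint n c) //; last exact: measurable_good_coords.
  apply: iint_le => y; first by rewrite lee_fin indicE.
  rewrite lee_fin /= !indicE; case: (boolP (y \in hull)) => [/set_mem h|_]; last first.
    by case: (_ \in _).
  have G : good_coords n (contract n c (ratio m) y).
    by apply: good_ext (h m) => a an; rewrite seq_of_contract.
  by rewrite (mem_set G).
have : iint (blocks p 0 n) (ind hull) (fun=> 0%R) \is a fin_num.
  rewrite ge0_fin_numE; first by apply: le_lt_trans (le 0%N) _; rewrite ltry.
  by apply: iint_ge0 => y; rewrite lee_fin indicE.
move=> /fineK e; move: le; rewrite -e => le; rewrite lee_fin.
have cv : (1 - ratio m)^-1 ^+ size (blocks p 0 n) * v @[m --> \oo] --> v.
  rewrite -[X in _ --> X]mul1r; apply: cvgM; last exact: cvg_cst.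
  rewrite -[X in _ --> X](expr1n _ (size (blocks p 0 n))); apply: cvg_exprn.
  rewrite -[X in _ --> X]invr1; apply: cvgV; first exact: oner_neq0.
  rewrite -[X in _ --> X]subr0; apply: cvgB; first exact: cvg_cst.
  have := @cvg_harmonic R; rewrite -cvg_shiftS; exact.
rewrite -(cvg_lim _ cv) //; apply: limr_ge; first by apply/cvg_ex; exists v.
by apply: nearW => m; rewrite -lee_fin; apply: le.
Qed.

(** A detour through a representing measure: good sequences are moments, and moments have
    nonnegative Hankel forms. *)
Lemma good_hull : good_coords n `<=` hull.
Proof.
move=> x G; apply: psd_hankels_hull => //; first exact: seq_of_herm.
have G' : good (moment_seq (row_of n x)) n by apply/good_row_of.
have [_ h] := moment_space_herm (good_tuple_moment_space (@row_of_herm n x) G').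
by apply: psd_hankels_ext h => a an; rewrite moment_seq_row_of.
Qed.

Lemma hull_null : iint (blocks p 0 n) (ind (hull `\` good_coords n)) (fun=> 0%R) = 0%E.
Proof.
have [v v0 ev] := volume_bounds n.
have mG := measurable_good_coords n.
have mD : measurable (hull `\` good_coords n) by apply: measurableD; first exact: measurable_hull.
have p0 (A : set (coords R idx)) y : (0 <= (\1_A y : R)%:E)%E by rewrite lee_fin indicE.
have := hull_volume; rewrite (_ : ind hull = fun y => (ind (good_coords n) y + ind (hull `\` good_coords n) y)%E).
  rewrite iintD //; [|exact: measurable_ind|exact: measurable_ind].
  rewrite -/(volume n) ev -[leRHS]adde0 leeD2lE // => h.
  by apply/le_anti; rewrite h iint_ge0.
apply/funext => y; rewrite -EFinD; congr EFin; rewrite !indicE.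
have := @good_hull y; rewrite in_setD.
case: (boolP (y \in good_coords n)) => [/set_mem h /(_ h) h'|_ _].
  by rewrite (mem_set h') /= addr0.
by rewrite andbT add0r.
Qed.

End Boundary.

(** The part of the moment space in [B] lies between [E1] and [E2], which differ at most by the
    negligible part of the hull; monotonicity of the volume then decides, whether or not the set
    itself is measurable. *)
Lemma herm_volume_moment_space n (B : set 'rV['M[R[i]]_p]_n) :
  let D := good_coords n `&` row_of n @^-1` B in measurable D ->
  herm_volume (B `&` @moment_space R p n) = iint (blocks p 0 n) (ind D) (fun=> 0%R).
Proof.
move=> D mD; have [c [c0 hc gc _]] := center_exists R[i] p n.
pose N := hull n c `\` good_coords n.
have mN : measurable N.
  by apply: measurableD; [apply: measurable_hull | apply: measurable_good_coords].
have p0 (A : set (coords R idx)) y : (0 <= (\1_A y : R)%:E)%E by rewrite lee_fin indicE.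
pose E1 := [set S : 'rV['M[R[i]]_p]_n | [/\ B S, herm_tuples S & good (moment_seq S) n]].
pose E2 := [set S : 'rV['M[R[i]]_p]_n | E1 S \/
   (in_hull n c (moment_seq S) /\ ~ good (moment_seq S) n)].
have E1E y : E1 (row_of n y) <-> D y.
  split; first by move=> [b _ /good_row_of g]; split.
  by move=> [g b]; split; [exact: b|exact: row_of_herm|apply/good_row_of; exact: g].
have E2E y : E2 (row_of n y) <-> (D `|` N) y.
  split.
    move=> [/E1E|[h g]]; [by left|right; split; last by move/good_row_of].
    by apply: in_hull_ext h => a an; rewrite moment_seq_row_of.
  move=> [/E1E|[h g]]; [by left|right; split; last by move/good_row_of].
  by apply: in_hull_ext h => a an; rewrite moment_seq_row_of.
have indE (E : set 'rV['M[R[i]]_p]_n) (D' : set (coords R idx)) : (forall y, E (row_of n y) <-> D' y) ->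
    measurable (D' : set (coords R idx)) -> herm_volume E = iint (blocks p 0 n) (ind D') (fun=> 0%R).
  move=> ED mD'.
  have e : (fun y => (\1_E (row_of n y) : R)%:E) = ind D'.
    apply/funext => y; rewrite !indicE; have [h1 h2] := ED y.
    case: (boolP (y \in _)) => [/set_mem /h2 h|h]; first by rewrite mem_set.
    by rewrite memNset // => /h1 /mem_set; exact/negP.
  rewrite (@herm_volumeE _ _ _ _ (fun=> 0%R)) e //.
  exact: measurable_ind.
apply/le_anti/andP; split; last first.
  rewrite -(indE _ _ E1E mD); apply: herm_volume_le => S [b h g]; split=> //.
  exact: good_tuple_moment_space.
have mU : measurable (D `|` N) by apply: measurableU.
apply: (@le_trans _ _ (herm_volume E2)).
  apply: herm_volume_le => S [b mS]; have [hS ps] := moment_space_herm mS.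
  have [g|g] := pselect (good (moment_seq S) n); first by left.
  right; split; last exact: g.
  exact: (psd_hankels_hull c0 hc gc (erefl _) (moment_seq_herm hS) ps).
rewrite (indE _ _ E2E mU).
apply: (@le_trans _ _ (iint (blocks p 0 n) (fun y => (ind D y + ind N y)%E) (fun=> 0%R))).
  apply: iint_le => // y; rewrite -EFinD lee_fin !indicE in_setU.
  by case: (_ \in D); case: (_ \in N); rewrite //= ?addr0 ?add0r // lerDl.
rewrite iintD //; [|exact: measurable_ind|exact: measurable_ind].
by rewrite hull_null // adde0.
Qed.

End MomentSpaceVolume.

Section TupleSpace.
Variables (R : realType) (p : nat).
Implicit Types (n k : nat).

Lemma cvg_psd_tuple n T (F : set_system T) (f : T -> psd_tuple R p n) S : Filter F ->
  (fun x => psd_tuple_val (f x)) @ F --> psd_tuple_val S -> f @ F --> S.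
Proof.
move=> FF h A [_ [[U opU <-] US] UA].
have nU : nbhs (psd_tuple_val S) U by apply: open_nbhs_nbhs.
have FU : \forall x \near F, U (psd_tuple_val (f x)) := h _ nU.
by apply: filterS FU => x Ux; apply: UA.
Qed.

Lemma psd_tuple_val_continuous n : continuous (@psd_tuple_val R p n).
Proof. exact: initial_continuous. Qed.

Lemma psd_tuple_val_inj n : injective (@psd_tuple_val R p n).
Proof. exact: val_inj. Qed.

Lemma hausdorff_tuple n : hausdorff_space 'rV['M[R[i]]_p]_n.
Proof.
rewrite ball_hausdorff => A B /eqP AB.
have : exists l a b, A 0 l a b != B 0 l a b.
  apply: contrapT => h; apply: AB; apply/rowP => l; apply/matrixP => a b.
  by apply: contrapT => /eqP e; apply: h; exists l, a, b.
move=> [l [a [b ne]]].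
pose e : R[i] := `|A 0 l a b - B 0 l a b| / 2.
have e0 : 0 < e by rewrite divr_gt0 // normr_gt0 subr_eq0.
exists (PosNum e0, PosNum e0); apply/eqP; rewrite -subset0 => T [[_ /(_ 0 l) [_ /(_ a b)]]].
rewrite /ball /= => h1 [_ /(_ 0 l) [_ /(_ a b)]]; rewrite /ball /= => h2.
have h := ler_distD (T 0 l a b) (A 0 l a b) (B 0 l a b).
rewrite (distrC (T 0 l a b)) in h.
have := le_lt_trans h (ltrD h1 h2).
by rewrite -splitr ltxx.
Qed.

Lemma hausdorff_psd_tuple n : hausdorff_space (psd_tuple R p n).
Proof.
move=> S T h; apply: psd_tuple_val_inj; apply: (@hausdorff_tuple n) => A B nA nB.
have [U [UA UB]] := h _ _ (psd_tuple_val_continuous nA) (psd_tuple_val_continuous nB).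
by exists (psd_tuple_val U).
Qed.

Lemma first_coords_continuous n k : continuous (@first_coords R p n k).
Proof.
move=> S; apply: (cvg_psd_tuple (nbhs_filter S)); apply/(cvg_rowP _ _ (nbhs_filter S)) => l /=.
have /cvg_rowP h := @psd_tuple_val_continuous n S.
rewrite mxE; case E: (insub (val l)) => [j|].
  by apply: mcvg_ext (h j) => T; rewrite mxE E.
by apply: mcvg_ext (mcvg_cst _ _) => T; rewrite mxE E.
Qed.

Lemma sigma_open_preimage (U V : topologicalType) (f : U -> V) (A : set V) :
  continuous f -> <<s open >> A -> <<s open >> (f @^-1` A).
Proof.
move=> cf; pose C := [set B | <<s (@open U) >> (f @^-1` B)].
have [s0 sC sU] := smallest_sigma_algebra setT (@open U).
have : <<s (@open V) >> `<=` C.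
  apply: smallest_sub => [|B oB]; last by apply: sub_sigma_algebra; apply: open_comp.
  split; first exact: s0.
    by move=> B CB; exact: sC.
  by move=> B CB; rewrite /C /= preimage_bigcup; apply: sU.
exact.
Qed.

End TupleSpace.

(** * Events in coordinates and the law of the first moments *)

Section CoordinatesToTuples.
Variables (R : realType) (p k : nat).
Local Notation idx := (nat * ('I_p * 'I_p))%type.
Implicit Types (x y : coords R idx) (A : set (psd_tuple R p k)).

Lemma good_psd_tuples n x : good (seq_of x) n -> psd_tuples (row_of n x).
Proof.
move=> G l; rewrite mxE -[herm_at x l]/(seq_of x l.+1); apply: pd_psd.
have G' : good (seq_of x) l.+1 by apply: good_le G.
exact: (good_pd (erefl _) (seq_of_herm x) G').1.
Qed.

(* Arbitrary where the coordinates do not define nonnegative matrices. *)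
Definition of_coords x : psd_tuple R p k :=
  match pselect (psd_tuples (row_of k x)) with
  | left h => exist (fun T => T \in psd_tuples (n:=k)) _ (mem_set h)
  | right _ => point
  end.

Lemma of_coordsE x : good (seq_of x) k -> psd_tuple_val (of_coords x) = row_of k x.
Proof. by move=> /good_psd_tuples h; rewrite /of_coords; case: pselect. Qed.

Lemma cvg_of_coords x : good (seq_of x) k -> of_coords @ cnear x --> of_coords x.
Proof.
move=> G; have FF := cnear_Filter x; have e := of_coordsE G.
have h : (fun y => psd_tuple_val (of_coords y)) @ cnear x --> row_of k x.
  apply/(cvg_rowP _ _ FF) => l.
  have h : mcvg (cnear x) (fun y => herm_at y l) (row_of k x 0 l).
    by rewrite mxE; apply: mcvg_herm_at.
  apply: (mcvg_near FF _ h); apply: filterS (near_good_seq_of G) => y Gy.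
  by rewrite (of_coordsE Gy) mxE.
rewrite -e in h; exact: (cvg_psd_tuple FF h).
Qed.

Definition coords_event A : set (coords R idx) :=
  good_coords k `&` of_coords @^-1` A.

(** The sets with measurable event form a sigma-algebra; the event of an open set is open in the
    coordinates, since [of_coords] is continuous at good points. *)
Lemma measurable_coords_event A : <<s open >> A -> measurable (coords_event A).
Proof.
pose C := [set B | measurable (coords_event B)].
have mG := @measurable_good_coords R p k.
suff : <<s (@open (psd_tuple R p k)) >> `<=` C by apply.
apply: smallest_sub => [|B oB].
  split.
  - by rewrite /C /= /coords_event preimage_set0 setI0.
  - move=> B CB; rewrite /C /= /coords_event setTD.
    rewrite (_ : _ `&` _ = good_coords k `\` coords_event B); first exact: measurableD.
    apply/seteqP; split=> x [g h]; first by split; [exact: g | case].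
    by split; [exact: g | move=> Bx; apply: h; split].
  - move=> B CB; rewrite /C /= /coords_event preimage_bigcup setI_bigcupr.
    by apply: bigcup_measurable => i _; apply: CB.
apply: measurable_open_coords => x [G Bx].
have FF := cnear_Filter x; apply: filterI; first exact: near_good_seq_of.
by apply: (cvg_of_coords G); apply: open_nbhs_nbhs.
Qed.

End CoordinatesToTuples.

Section Marginals.
Variables (R : realType) (p k : nat).
Local Notation idx := (nat * ('I_p * 'I_p))%type.
Implicit Types (x y : coords R idx) (A : set (psd_tuple R p k)) (m n : nat).

Lemma of_coords_ext n x y : row_of n x = row_of n y :> 'rV['M[R[i]]_p]_n ->
  of_coords n x = of_coords n y.
Proof. by rewrite /of_coords => ->. Qed.

Lemma first_coords_of_coords n y : (k <= n)%N -> good (seq_of y) n ->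
  first_coords k (of_coords n y) = of_coords k y.
Proof.
move=> kn G; apply: psd_tuple_val_inj.
rewrite (of_coordsE (good_le kn G)).
have -> : psd_tuple_val (first_coords k (of_coords n y)) =
  first_coords_row k (psd_tuple_val (of_coords n y)) by [].
rewrite (of_coordsE G); apply/rowP => l; rewrite !mxE.
case: insubP => [j _ e|]; first by rewrite mxE e.
by rewrite (leq_trans (ltn_ord l) kn).
Qed.

Lemma coords_event_ext A x y : row_of k x = row_of k y -> coords_event A x -> coords_event A y.
Proof.
move=> e [G Ax]; split; last by rewrite /= -(of_coords_ext e).
by apply/good_row_of; rewrite -e; apply/good_row_of.
Qed.

(* Up to a constant, the volume of the part of M_{k+m} that lies over A. *)
Definition marginal A m : \bar R :=
  iint (blocks p 0 k) (fun x => (\1_(coords_event A) x * dens m k x)%:E) (fun=> 0).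

Lemma measurable_marginal A m : <<s open >> A ->
  measurable_fun setT (fun x => (\1_(coords_event A) x * dens m k x : R)%:E).
Proof.
move=> mA; apply/measurable_EFinP; apply: measurable_funM.
  by apply: measurable_indic; apply: measurable_coords_event.
by apply/measurable_EFinP; apply: measurable_dens.
Qed.

Lemma marginal_ge0 A m y : (0 <= (\1_(coords_event A) y * dens m k y : R)%:E)%E.
Proof. by rewrite lee_fin mulr_ge0 ?dens_ge0 // indicE. Qed.

Lemma uniform_marginal m : exists2 c : R, 0 < c & forall A, <<s open >> A ->
  herm_volume ((@psd_tuple_val R p (k + m) @` (first_coords k @^-1` A))
               `&` @moment_space R p (k + m)) = (c%:E * marginal A m)%E.
Proof.
have [c c0 hc] := fiber_marginal R p k m 0; exists c => // A mA.
set n := (k + m)%N; pose A' := first_coords k @^-1` A : set (psd_tuple R p n).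
have mA' : <<s open >> A' by apply: sigma_open_preimage mA; apply: first_coords_continuous.
have kn : (k <= n)%N by apply: leq_addr.
have eD : good_coords n `&` row_of n @^-1` (@psd_tuple_val R p n @` A') = coords_event A'.
  apply/seteqP; split=> y [G h]; split; first exact: G.
  - case: h => S AS e; have eS : S = of_coords n y.
      by apply: psd_tuple_val_inj; rewrite e (of_coordsE G).
    by rewrite /= -eS.
  - exact: G.
  - by exists (of_coords n y); [exact: h | exact: of_coordsE].
rewrite herm_volume_moment_space eD; last exact: measurable_coords_event.
have e y : (\1_(coords_event A') y : R)%:E =
    ((\1_(coords_event A) y : R)%:E * (dens 0 n y)%:E)%E.
  rewrite dens0 -EFinM !indicE; have [G|G] := pselect (good (seq_of y) n); last first.
    rewrite (memNset (_ : ~ coords_event A' y)); last by case.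
    have G' : ~ [set z : coords R idx | good (seq_of z) n] y by exact: G.
    by rewrite (memNset G') mulr0.
  have G' : [set z : coords R idx | good (seq_of z) n] y by exact: G.
  rewrite (mem_set G') mulr1.
  have eA : coords_event A' y <-> coords_event A y.
    have ef := first_coords_of_coords kn G.
    split=> -[_ h]; split; [exact: good_le G| |exact: G|].
      by have : A (first_coords k (of_coords n y)) := h; rewrite ef.
    by rewrite /= /A' /= ef.
  by case: eA => h1 h2; case: (boolP (y \in coords_event A')) => [/set_mem/h1/mem_set ->|] //;
    move=> h; rewrite memNset // => /h2 /mem_set; exact/negP.
rewrite (eq_iint _ _ e) blocks_cat iint_cat add0n.
rewrite /marginal -iintZ; [|exact: marginal_ge0|exact: measurable_marginal|exact: ltW].
apply: eq_iint => y; rewrite iint_factor.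
- by rewrite hc add0n -!EFinM mulrCA.
- by move=> z; rewrite lee_fin dens_ge0.
- exact: measurable_dens.
- by rewrite indicE.
- move=> z hz.
  have er : row_of k z = row_of k y.
    apply/rowP => l; rewrite !mxE; apply: herm_at_ext => ab; apply: hz.
    by rewrite mem_blocks /= leqNgt ltn_ord.
  have [Ey|Ey] := pselect (coords_event A y).
    by rewrite !indicE (mem_set Ey) (mem_set (coords_event_ext (esym er) Ey)).
  have Ez : ~ coords_event A z := fun Ez => Ey (coords_event_ext er Ez).
  by rewrite !indicE (memNset Ey) (memNset Ez).
Qed.

Definition det_gap x : R := rdet (gap (seq_of x) k.+1).

(** Regrouping $\det^{pm}=(\det^p)^m$ makes the bound geometric in $m$. *)
Lemma marginal_le A m (K : R) : <<s open >> A -> 0 <= K ->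
  (forall x, coords_event A x -> det_gap x ^+ p <= K) ->
  (marginal A m <= (K ^+ m)%:E * volume R p k)%E.
Proof.
move=> mA K0 h; rewrite /volume -iintZ.
- apply: iint_le => x; first exact: marginal_ge0.
  rewrite -EFinM lee_fin; have [Ax|Ax] := pselect (coords_event A x); last first.
    by rewrite indicE (memNset Ax) mul0r mulr_ge0 ?exprn_ge0 // indicE.
  have [G _] := Ax; rewrite !indicE (mem_set Ax) (mem_set (G : good_coords k x)) mulr1 mul1r.
  rewrite (dens_good m G) exprM; have /andP[g0 _] := rdet_gap_le (erefl _) (@seq_of_herm _ _ x) G.
  apply: lerXn2r; [by rewrite nnegrE exprn_ge0 // ltW | by rewrite nnegrE | exact: (h x Ax)].
- by move=> x; rewrite lee_fin indicE.
- by apply: measurable_ind; apply: measurable_good_coords.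
- exact: exprn_ge0.
Qed.

Definition to_coords (S : psd_tuple R p k) : coords R idx :=
  fun c => coord_of (moment_seq (psd_tuple_val S) c.1.+1) c.2.

Lemma seq_of_to_coords S a : seq_of (to_coords S) a = moment_seq (psd_tuple_val S) a.
Proof.
case: a => // l; apply: (@herm_at_coord_of _ _ (fun l => moment_seq (psd_tuple_val S) l.+1)).
exact: (moment_seq_herm (@psd_tuple_herm _ _ _ S)).
Qed.

Lemma to_coordsK S : good (moment_seq (psd_tuple_val S)) k -> of_coords k (to_coords S) = S.
Proof.
move=> G; apply: psd_tuple_val_inj; rewrite of_coordsE; last first.
  by apply: good_ext G => a _; rewrite seq_of_to_coords.
by apply/rowP => l; rewrite mxE -[herm_at _ _]/(seq_of _ l.+1) seq_of_to_coords moment_seq_lt.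
Qed.

Lemma coord_of0 ab : coord_of (0 : 'M[R[i]]_p) ab = 0.
Proof. by rewrite /coord_of; case: ifP; rewrite mxE. Qed.

Lemma to_coords_off S l ab : (k <= l)%N -> to_coords S (l, ab) = 0.
Proof. by move=> kl; rewrite /to_coords (moment_seq_ge _ kl) coord_of0. Qed.

(** By continuity $\det^p$ exceeds [K] on a coordinate neighbourhood that [of_coords] sends into
    [A]; the volume of a box in it does not depend on [m]. *)
Lemma marginal_ge A S (K : R) : good (moment_seq (psd_tuple_val S)) k -> nbhs S A ->
  0 <= K < rdet (gap (moment_seq (psd_tuple_val S)) k.+1) ^+ p ->
  exists2 v : R, 0 < v & forall m, ((K ^+ m * v)%:E <= marginal A m)%E.
Proof.
move=> G nA /andP[K0 Kg]; set x := to_coords S.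
have Gx : good (seq_of x) k by apply: good_ext G => a _; rewrite seq_of_to_coords.
have eg : gap (seq_of x) k.+1 = gap (moment_seq (psd_tuple_val S)) k.+1.
  by apply: gap_ext => // a _; rewrite seq_of_to_coords.
have FF := cnear_Filter x.
pose V : set (coords R idx) := [set y | [/\ good (seq_of y) k, A (of_coords k y) & K < det_gap y ^+ p]].
have nV : cnear x V.
  have h1 := near_good_seq_of Gx.
  have nA' : nbhs (of_coords k x) A by rewrite to_coordsK.
  have h2 : cnear x [set y | A (of_coords k y)] := cvg_of_coords Gx nA'.
  have h3 : cnear x [set y | K < det_gap y ^+ p].
    have cg := cvg_exprn (n := p) FF (cvg_gap_seq_of Gx).
    by apply: (cvgr_gt _ cg); rewrite eg.
  by apply: filterS3 h1 h2 h3 => y a b c; split.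
have [v v0 hv] := iint_ge_near (blocks_uniq p 0 k) nV.
exists v; first exact: v0.
move=> m; rewrite /marginal.
(* [marginal] is taken at the zero base point, and [to_coords] vanishes beyond the first [k] blocks,
   so [x] may serve as base point instead. *)
have off (c : idx) : c \notin blocks p 0 k -> (fun=> 0 : R) c = x c.
  case: c => l ab; rewrite mem_blocks /= -leqNgt => kl.
  exact: (esym (to_coords_off S ab kl)).
rewrite (iint_indep _ off); apply: hv; first exact: exprn_ge0.
  by move=> y; apply: marginal_ge0.
move=> y [Gy Ay gy] _; have Ey : coords_event A y := conj Gy Ay.
rewrite indicE (mem_set Ey) mul1r lee_fin (dens_good m Gy) exprM.
have g0 : 0 <= det_gap y ^+ p := le_trans K0 (ltW gy).
by apply: lerXn2r; [rewrite nnegrE; exact: K0 | rewrite nnegrE; exact: g0 | exact: ltW gy].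
Qed.

End Marginals.

(** * Large deviations *)

Section ExponentialSpeed.
Variable R : realType.
Local Open Scope ereal_scope.
Implicit Types (u Q : nat -> \bar R).

Lemma limn_esup_le_near u c : (\forall n \near \oo, u n <= c) -> limn_esup u <= c.
Proof.
move=> h; apply: (@le_trans _ _ (ereal_sup (u @` [set n | u n <= c]))).
  by apply: ereal_inf_lbound; exists [set n | u n <= c].
by apply: ge_ereal_sup => _ [n /= le <-].
Qed.

Lemma limn_einf_ge_near u c : (\forall n \near \oo, c <= u n) -> c <= limn_einf u.
Proof.
move=> h; rewrite /limn_einf leeNr; apply: limn_esup_le_near.
by apply: filterS h => n; rewrite leeN2.
Qed.

Lemma near_shift k (P : nat -> Prop) : (\forall m \near \oo, P (k + m)%N) ->
  \forall n \near \oo, P n.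
Proof.
case=> N _ h; exists (k + N)%N => // n /= hn.
rewrite -(subnKC (leq_trans (leq_addr _ _) hn)); apply: h => /=.
by rewrite leq_subRL // (leq_trans (leq_addr _ _) hn).
Qed.

Lemma near_div_le (c e : R) : (0 < e)%R -> \forall n \near \oo, (c / n.+1%:R <= e)%R.
Proof.
move=> e0; have : (fun n => c * n.+1%:R^-1)%R @ \oo --> (c * 0 : R)%R.
  by apply: cvgM; [exact: cvg_cst | exact: cvg_harmonic].
by rewrite mulr0 => /(cvgr_le _); apply.
Qed.

(** $\frac{c+ml}{k+1+m}-l=\frac{c-(k+1)l}{k+1+m}\to0$: neither a constant factor nor the shift of
    the index affects the exponential rate. *)
Lemma scaled_log_le k (c l e : R) : (0 < e)%R -> \forall m \near \oo,
  ((k.+1 + m)%:R^-1 * (c + m%:R * l) <= l + e)%R.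
Proof.
move=> e0; have := near_div_le `|c - k.+1%:R * l|%R e0; apply: filterS => m hm.
have n0 : (0 < (k.+1 + m)%:R :> R)%R by rewrite ltr0n.
rewrite mulrC ler_pdivrMr //.
have h : (`|c - k.+1%:R * l| <= e * (k.+1 + m)%:R)%R.
  apply: (@le_trans _ _ (e * m.+1%:R)%R); first by rewrite -ler_pdivrMr ?ltr0n.
  by rewrite ler_pM2l // ler_nat addSn ltnS leq_addl.
have := le_trans (ler_norm _) h; rewrite natrD; lra.
Qed.

Lemma speed_le Q k (C K e : R) : (0 < C)%R -> (0 < K)%R -> (0 < e)%R ->
  (forall n, 0 <= Q n) ->
  (\forall m \near \oo, Q (k.+1 + m)%N <= (C * K ^+ m)%:E) ->
  \forall n \near \oo, n%:R^-1%:E * lne (Q n) <= (ln K + e)%:E.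
Proof.
move=> C0 K0 e0 Q0 hQ; apply: (near_shift (k := k.+1)).
have := scaled_log_le k (ln C) (ln K) e0; apply: filterS2 hQ => m hQ hm.
have CK : (0 < C * K ^+ m)%R by rewrite mulr_gt0 ?exprn_gt0.
apply: (@le_trans _ _ ((k.+1 + m)%:R^-1%:E * lne (C * K ^+ m)%:E)).
  rewrite lee_pmul2l ?lte_fin ?invr_gt0 ?ltr0n // lee_lne // in_itv /= ?Q0 ?leey //.
  by rewrite lee_fin ltW.
rewrite lne_EFin // -EFinM lee_fin lnM ?posrE ?exprn_gt0 // lnXn // -[(ln K *+ m)%R]mulr_natl.
exact: hm.
Qed.

Lemma speed_ge Q k (C K e : R) : (0 < C)%R -> (0 < K)%R -> (0 < e)%R ->
  (forall n, 0 <= Q n) ->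
  (\forall m \near \oo, (C * K ^+ m)%:E <= Q (k.+1 + m)%N) ->
  \forall n \near \oo, (ln K - e)%:E <= n%:R^-1%:E * lne (Q n).
Proof.
move=> C0 K0 e0 Q0 hQ; apply: (near_shift (k := k.+1)).
have := scaled_log_le k (- ln C) (- ln K) e0; apply: filterS2 hQ => m hQ hm.
have CK : (0 < C * K ^+ m)%R by rewrite mulr_gt0 ?exprn_gt0.
apply: (@le_trans _ _ ((k.+1 + m)%:R^-1%:E * lne (C * K ^+ m)%:E)); last first.
  rewrite lee_pmul2l ?lte_fin ?invr_gt0 ?ltr0n // lee_lne // in_itv /= ?Q0 ?leey //.
  by rewrite lee_fin ltW.
rewrite lne_EFin // -EFinM lee_fin lnM ?posrE ?exprn_gt0 // lnXn // -[(ln K *+ m)%R]mulr_natl.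
by move: hm; rewrite mulrN -opprD mulrN; lra.
Qed.

End ExponentialSpeed.

Section MarginalRatio.
Variables (R : realType) (p k : nat).
Local Notation idx := (nat * ('I_p * 'I_p))%type.
Implicit Types (x y : coords R idx) (A : set (psd_tuple R p k)) (m n : nat).
Implicit Types (S : psd_tuple R p k).
Local Notation total m := (marginal (setT : set (psd_tuple R p k)) m).

Definition tuple_gap S : R := rdet (gap (moment_seq (psd_tuple_val S)) k.+1).

(** The maximum of $\det(D_{k+1})^p$ over good tuples, hence the exponential rate of the normalising
    volume. *)
Definition peak : R := (((4 ^+ p)^-1) ^+ k) ^+ p.

Lemma peak_gt0 : 0 < peak.
Proof. by rewrite !exprn_gt0 // invr_gt0 exprn_gt0. Qed.

Lemma tuple_gap_bounds S : good (moment_seq (psd_tuple_val S)) k ->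
  0 < tuple_gap S ^+ p <= peak.
Proof.
move=> G; have hS := moment_seq_herm (@psd_tuple_herm _ _ _ S).
have /andP[g0 gle] := rdet_gap_le (erefl _) hS G.
by rewrite exprn_gt0 // lerXn2r // nnegrE ltW // (lt_le_trans g0 gle).
Qed.

Lemma tuple_gap_of_coords x : good (seq_of x) k ->
  good (moment_seq (psd_tuple_val (of_coords k x))) k /\ tuple_gap (of_coords k x) = det_gap k x.
Proof.
move=> G; have e a : (a <= k)%N -> moment_seq (psd_tuple_val (of_coords k x)) a = seq_of x a.
  by move=> ak; rewrite (of_coordsE G) moment_seq_row_of.
split; first by apply: good_ext G => a ak; rewrite e.
have eg : gap (moment_seq (psd_tuple_val (of_coords k x))) k.+1 = gap (seq_of x) k.+1.
  by apply: gap_ext => [//|a]; rewrite ltnS; apply: e.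
exact: (congr1 (@rdet R p) eg).
Qed.

Lemma center_tuple : exists2 S, good (moment_seq (psd_tuple_val S)) k & tuple_gap S ^+ p = peak.
Proof.
have [s [s0 hs G es]] := center_exists R[i] p k.
pose x : coords R idx := fun c => coord_of (s c.1.+1) c.2.
have ex a : seq_of x a = s a.
  case: a => [|l]; first exact: (esym s0).
  exact: (@herm_at_coord_of _ _ (fun l => s l.+1) l (hs _)).
have Gx : good (seq_of x) k by apply: good_ext G => a _; rewrite ex.
have [GS eS] := tuple_gap_of_coords Gx.
exists (of_coords k x); first exact: GS.
rewrite eS /det_gap (gap_ext (ltn0Sn k) (t := s)); last by move=> a _; rewrite ex.
rewrite /rdet es /peak; congr (_ ^+ p).
by rewrite -[4 in LHS](rmorph_nat (real_complex R)) -rmorphXn -fmorphV -rmorphXn.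
Qed.

Lemma sigma_setT (T : topologicalType) : <<s (@open T) >> setT.
Proof. by apply: sub_sigma_algebra; apply: openT. Qed.

Lemma coords_event_gap A x : coords_event A x ->
  [/\ A (of_coords k x), good (moment_seq (psd_tuple_val (of_coords k x))) k
    & det_gap k x = tuple_gap (of_coords k x)].
Proof. by move=> [G Ax]; have [GS eS] := tuple_gap_of_coords G; split; [exact: Ax|exact: GS|exact: (esym eS)]. Qed.

Lemma marginal_le_peak A m : <<s open >> A ->
  (marginal A m <= (peak ^+ m)%:E * volume R p k)%E.
Proof.
move=> mA; apply: marginal_le => //; first exact: ltW peak_gt0.
move=> x /coords_event_gap[_ G ->].
by have /andP[] := tuple_gap_bounds G.
Qed.

Lemma fine_marginal A m : <<s open >> A -> marginal A m = (fine (marginal A m))%:E.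
Proof.
move=> mA; rewrite fineK // ge0_fin_numE; last first.
  by apply: iint_ge0 => y; apply: marginal_ge0.
have [v v0 ev] := volume_bounds R p k.
by apply: le_lt_trans (marginal_le_peak m mA) _; rewrite ev -EFinM ltry.
Qed.

(** The numerator is at most $K^mw$, and the denominator is bounded below near the center; the
    factor [expR (- e)] appears because a whole neighbourhood only nearly attains the peak. *)
Lemma ratio_le A K e : <<s open >> A -> 0 < K -> 0 < e ->
  (forall S, A S -> good (moment_seq (psd_tuple_val S)) k -> tuple_gap S ^+ p <= K) ->
  exists2 C : R, 0 < C & forall m,
    fine (marginal A m) / fine (total m) <= C * (K / (peak * expR (- e))) ^+ m.
Proof.
move=> mA K0 e0 hK; have [S GS eS] := center_tuple.
have [w w0 ew] := volume_bounds R p k.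
have L0 : 0 < peak * expR (- e) by rewrite mulr_gt0 ?peak_gt0 ?expR_gt0.
have LS : 0 <= peak * expR (- e) < tuple_gap S ^+ p.
  rewrite ltW // eS -[ltRHS]mulr1 ltr_pM2l ?peak_gt0 //.
  by rewrite -expR0 ltr_expR oppr_lt0.
have [v v0 hv] := marginal_ge GS (@filterT _ (nbhs S) _) LS.
exists (w / v); first exact: divr_gt0.
move=> m; have h1 : fine (marginal A m) <= K ^+ m * w.
  rewrite -lee_fin -fine_marginal // EFinM -ew; apply: marginal_le => //; first exact: ltW.
  by move=> x /coords_event_gap[Ax G ->]; apply: hK.
have h2 : (peak * expR (- e)) ^+ m * v <= fine (total m).
  by rewrite -lee_fin -fine_marginal //; apply: sigma_setT.
have L1 : 0 < (peak * expR (- e)) ^+ m * v by rewrite mulr_gt0 ?exprn_gt0.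
rewrite ler_pdivrMr; last exact: lt_le_trans h2.
apply: le_trans h1 _; rewrite expr_div_n.
apply: (@le_trans _ _ (w / v * (K ^+ m / (peak * expR (- e)) ^+ m) * ((peak * expR (- e)) ^+ m * v))).
  rewrite le_eqVlt; apply/orP; left; apply/eqP.
  have : (peak * expR (- e)) ^+ m != 0 by rewrite gt_eqF ?exprn_gt0.
  have : v != 0 by rewrite gt_eqF.
  by move: ((peak * expR (- e)) ^+ m) => a v1 a1; field; rewrite a1 v1.
by rewrite ler_pM2l // !mulr_gt0 ?invr_gt0 ?exprn_gt0.
Qed.

Lemma ratio_ge A S K : <<s open >> A -> nbhs S A -> good (moment_seq (psd_tuple_val S)) k ->
  0 < K < tuple_gap S ^+ p ->
  exists2 C : R, 0 < C & forall m,
    C * (K / peak) ^+ m <= fine (marginal A m) / fine (total m).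
Proof.
move=> mA nA GS /andP[K0 KS].
have [w w0 ew] := volume_bounds R p k.
have KS' : 0 <= K < tuple_gap S ^+ p by rewrite ltW.
have [v v0 hv] := marginal_ge GS nA KS'.
have [v' v'0 hv'] := marginal_ge GS (@filterT _ (nbhs S) _) KS'.
exists (v / w); first exact: divr_gt0.
move=> m; have h1 : fine (total m) <= peak ^+ m * w.
  rewrite -lee_fin -fine_marginal; last exact: sigma_setT.
  by rewrite EFinM -ew; apply: marginal_le_peak; apply: sigma_setT.
have h2 : K ^+ m * v <= fine (marginal A m) by rewrite -lee_fin -fine_marginal.
have h3 : 0 < fine (total m).
  apply: lt_le_trans (_ : K ^+ m * v' <= _); first by rewrite mulr_gt0 ?exprn_gt0.
  by rewrite -lee_fin -fine_marginal //; apply: sigma_setT.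
have P0 := peak_gt0.
rewrite ler_pdivlMr // expr_div_n; apply: le_trans h2.
apply: (@le_trans _ _ (v / w * (K ^+ m / peak ^+ m) * (peak ^+ m * w))).
  by rewrite ler_pM2l // !mulr_gt0 ?invr_gt0 ?exprn_gt0.
rewrite le_eqVlt; apply/orP; left; apply/eqP.
have : peak ^+ m != 0 by rewrite gt_eqF ?exprn_gt0.
have : w != 0 by rewrite gt_eqF.
by move: (peak ^+ m) => a v1 a1; field; rewrite a1 v1.
Qed.

Lemma uniform_law m (Q : set (psd_tuple R p (k + m)) -> \bar R) A :
  uniform_on_moment_space Q -> <<s open >> A ->
  Q (first_coords k @^-1` A) = (fine (marginal A m) / fine (total m))%:E.
Proof.
move=> hQ mA; rewrite hQ; last first.
  by apply: sigma_open_preimage mA; apply: first_coords_continuous.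
have [c c0 hc] := uniform_marginal R p k m.
have eT : herm_volume (@moment_space R p (k + m)) = (c%:E * total m)%E.
  rewrite -hc; last exact: sigma_setT.
  have eD : good_coords (k + m) `&` row_of (k + m) @^-1` (@psd_tuple_val R p (k + m) @` (first_coords k @^-1` setT)) =
      good_coords (k + m) `&` row_of (k + m) @^-1` setT.
    apply/seteqP; split=> y [G _]; split=> //.
    by exists (of_coords (k + m) y); [by [] | exact: of_coordsE].
  have mG : measurable (good_coords (k + m) `&` row_of (k + m) @^-1` (setT : set 'rV['M[R[i]]_p]_(k + m))).
    by rewrite preimage_setT setIT; apply: measurable_good_coords.
  rewrite -[X in herm_volume X = _]setTI (herm_volume_moment_space mG).
  by rewrite herm_volume_moment_space eD.
rewrite hc // eT (fine_marginal m mA) (fine_marginal m (@sigma_setT _)) -!EFinM /=.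
by rewrite -mulf_div divff ?mul1r // gt_eqF.
Qed.

End MarginalRatio.

(** * Level sets of the rate function *)

Section LevelSets.
Variables (R : realType) (p k : nat).
Hypotheses (p0 : (0 < p)%N) (k0 : (0 < k)%N).
Local Notation idx := (nat * ('I_p * 'I_p))%type.
Implicit Types (x y : coords R idx) (S : psd_tuple R p k).
Local Notation peak := (peak R p k).

Lemma moment_rateE S : good (moment_seq (psd_tuple_val S)) k ->
  moment_rate S = (ln peak - ln (tuple_gap S ^+ p))%:E.
Proof.
move=> G; rewrite (moment_rate_good k0 G) max_gap; congr EFin.
have [e g0] := pd_rdet (pd_gap (erefl _) (moment_seq_herm (@psd_tuple_herm _ _ _ S)) G).
have -> : ln (tuple_gap S ^+ p) = p%:R * ln (tuple_gap S) by rewrite lnXn // mulr_natl.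
have -> : ln peak = p%:R * ln (((4 ^+ p)^-1) ^+ k).
  by rewrite lnXn ?exprn_gt0 ?invr_gt0 ?exprn_gt0 // mulr_natl.
by rewrite !mulNr opprK addrC.
Qed.

(** Level sets become superlevel sets of $\det^p$ among good tuples; compactness and the upper bound
    both start from this form. *)
Lemma moment_rate_le S (a : R) : (moment_rate S <= a%:E)%E <->
  good (moment_seq (psd_tuple_val S)) k /\ peak * expR (- a) <= tuple_gap S ^+ p.
Proof.
have P0 := peak_gt0 R p k.
have key : good (moment_seq (psd_tuple_val S)) k ->
    (moment_rate S <= a%:E)%E = (peak * expR (- a) <= tuple_gap S ^+ p).
  move=> G; have /andP[g0 _] := tuple_gap_bounds G.
  rewrite (moment_rateE G) lee_fin -[in RHS]ler_ln ?posrE ?mulr_gt0 ?expR_gt0 //.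
  rewrite lnM ?posrE ?expR_gt0 // expRK.
  by apply/idP/idP; lra.
split=> [h|[G]]; last by rewrite key.
have [G|G] := pselect (good (moment_seq (psd_tuple_val S)) k); first by rewrite -key.
by move: h; rewrite (moment_rate_bad G).
Qed.

Lemma moment_rate_ge0 S : (0 <= moment_rate S)%E.
Proof.
have [G|G] := pselect (good (moment_seq (psd_tuple_val S)) k); last first.
  by rewrite (moment_rate_bad G).
rewrite (moment_rateE G) lee_fin subr_ge0; have /andP[g0 gle] := tuple_gap_bounds G.
by rewrite ler_ln // posrE peak_gt0.
Qed.

Lemma to_coords_le1 S c : good (moment_seq (psd_tuple_val S)) k -> `|to_coords S c| <= 1.
Proof.
case: c => l ab G; have [lk|kl] := ltnP l k; last first.
  by rewrite (to_coords_off S ab kl) normr0.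
have hS := moment_seq_herm (@psd_tuple_herm _ _ _ S).
have G' : good (moment_seq (psd_tuple_val S)) l.+1 := good_le lk G.
have h1 := (good_pd (erefl _) hS G').1.
exact: pd_coord_le1 h1 (good_pd_le1 (erefl _) hS G').
Qed.

Lemma good_to_coords S : good (moment_seq (psd_tuple_val S)) k -> good (seq_of (to_coords S)) k.
Proof. by apply: good_ext => a _; rewrite seq_of_to_coords. Qed.

Lemma det_gap_to_coords S : det_gap k (to_coords S) = tuple_gap S.
Proof.
have eg : gap (seq_of (to_coords S)) k.+1 = gap (moment_seq (psd_tuple_val S)) k.+1.
  by apply: gap_ext => [//|a _]; apply: seq_of_to_coords.
exact: (congr1 (@rdet R p) eg).
Qed.

Lemma det_gap_expr_le x : good (seq_of x) k -> det_gap k x ^+ p <= det_gap k x.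
Proof.
move=> G; have /andP[g0 gle] := rdet_gap_le (erefl _) (seq_of_herm x) G.
rewrite -[leRHS]expr1; apply: ler_wiXn2l => //; first exact: ltW.
apply: le_trans gle _; apply: exprn_ile1; first by rewrite invr_ge0 exprn_ge0.
by rewrite invf_le1 ?exprn_gt0 // exprn_ege1 // ler1n.
Qed.

Lemma cvg_cnear T (F : set_system T) (f : T -> coords R idx) x : Filter F ->
  (forall c, (fun t => f t c) @ F --> x c) -> f @ F --> cnear x.
Proof.
move=> FF h A [s [e [e0 hA]]].
have : \forall t \near F, forall c, c \in s -> `|f t c - x c| < e.
  elim: s {hA} => [|c s IH]; first by apply: filterE.
  have h1 : \forall t \near F, `|f t c - x c| < e.
    by have /cvgrPdist_lt /(_ e e0) := h c; apply: filterS => t; rewrite distrC.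
  apply: filterS2 h1 IH => t h1 h2 c'; rewrite inE => /orP[/eqP->//|]; exact: h2.
by apply: filterS => t ht; apply: hA.
Qed.

(** Along an ultrafilter every coordinate converges, being bounded by $1$; [cvg_good] then keeps the
    limit away from the boundary. *)
Lemma compact_level (a : R) : compact [set S : psd_tuple R p k | (moment_rate S <= a%:E)%E].
Proof.
rewrite compact_ultra => F UF FL.
have PF : ProperFilter F by exact: ultra_proper.
have FF : Filter F by exact _.
have FG : \forall S \near F, good (moment_seq (psd_tuple_val S)) k /\
    peak * expR (- a) <= tuple_gap S ^+ p.
  by apply: filterS FL => S /moment_rate_le.
have lims c : exists r : R, (fun S => to_coords S c) @ F --> r.
  have GI : ((fun S => to_coords S c) @ F) `[-1, 1]%classic.
    apply: filterS FG => S [G _] /=; rewrite in_itv /= -ler_norml.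
    exact: to_coords_le1.
  have PG : ProperFilter ((fun S => to_coords S c) @ F) := fmap_proper_filter _ PF.
  have [r [_ hr]] := @segment_compact R (-1) 1 _ PG GI; exists r => V nV.
  have [//|nFV] := in_ultra_setVsetC ((fun S => to_coords S c) @^-1` V) UF.
  by have [y [/= nVy Vy]] := hr _ _ (nFV : ((fun S => to_coords S c) @ F) (~` V)) nV.
have [x hx] := choice lims.
have cx : @to_coords R p k @ F --> cnear x by apply: cvg_cnear.
have FS (P : coords R idx -> Prop) : cnear x P -> \forall S \near F, P (to_coords S) := cx P.
have sx : scvg F (fun S => seq_of (to_coords S)) (seq_of x).
  by move=> b i j e e0; exact: (FS (fun y => `|seq_of y b i j - seq_of x b i j| < e) (@scvg_seq_of _ _ x b i j e e0)).
pose K := peak * expR (- a).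
have K0 : 0 < K by rewrite mulr_gt0 ?peak_gt0 ?expR_gt0.
have Kdet S : good (moment_seq (psd_tuple_val S)) k -> K <= tuple_gap S ^+ p ->
    forall j, (0 < j <= k)%N ->
    K%:C%C <= \det (lower_gap (seq_of (to_coords S)) j) /\
    K%:C%C <= \det (upper_gap (seq_of (to_coords S)) j).
  move=> G KS j /andP[j0 jk]; have G' := good_to_coords G.
  have Gj : good (seq_of (to_coords S)) j := good_le jk G'.
  (* Gap determinants decrease with the index, and $\det^p\le\det$ because they are at most $1$. *)
  have h : K%:C%C <= \det (gap (seq_of (to_coords S)) j.+1).
    apply: le_trans (det_gap_anti (erefl _) (seq_of_herm _) G' jk).
    rewrite (pd_rdet (pd_gap (erefl _) (seq_of_herm _) G')).1 lecR.
    apply: le_trans KS _; rewrite -(det_gap_to_coords S).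
    exact: det_gap_expr_le.
  have [h1 h2] := det_gap_le_gaps (erefl _) (seq_of_herm _) j0 Gj.
  by split; [exact: le_trans h h1 | exact: le_trans h h2].
have Gx : good (seq_of x) k.
  apply: (cvg_good FF sx PF (erefl _) (seq_of_herm x) (c := K%:C%C)).
    by rewrite ltcR.
  apply: filterS FG => S [G KS]; split; last exact: Kdet.
  by apply: good_ext G => b _; rewrite seq_of_to_coords.
have [GT eT] := tuple_gap_of_coords Gx.
exists (of_coords k x); split.
  apply/moment_rate_le; split; first exact: GT.
  rewrite eT leNgt; apply/negP => lt.
  have nx : cnear x [set y | det_gap k y ^+ p < K].
    have FFx := cnear_Filter x.
    have cg := cvg_exprn (n := p) FFx (cvg_gap_seq_of Gx).
    by apply: (cvgr_lt _ cg); exact: lt.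
  have [S [/= h1 [G h2]]] := filter_ex (filterI (FS _ nx) FG).
  move: h2; rewrite leNgt => /negP; apply; apply: le_lt_trans h1.
  by rewrite det_gap_to_coords.
have cS : (fun S => psd_tuple_val S) @ F --> psd_tuple_val (of_coords k x).
  rewrite (of_coordsE Gx); apply/(cvg_rowP _ _ FF) => l.
  have h : mcvg F (fun S => seq_of (to_coords S) l.+1) (row_of k x 0 l).
    by rewrite mxE; apply: sx.
  by apply: mcvg_ext h => S; rewrite seq_of_to_coords moment_seq_lt.
exact: (cvg_psd_tuple FF cS).
Qed.

End LevelSets.

Lemma ereal_between (R : realType) (x y : \bar R) : (x < y)%E ->
  exists2 b : R, (x < b%:E)%E & (b%:E < y)%E.
Proof.
case: x => [r| |]; case: y => [s| |] // h.
- move: h; rewrite lte_fin => h; exists ((r + s) / 2); rewrite lte_fin; lra.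
- by exists (r + 1); rewrite ?ltry // lte_fin ltrDl.
- by exists (s - 1); rewrite ?ltNyr // lte_fin gtrBl.
- by exists 0; rewrite ?ltNyr ?ltry.
Qed.

Section LargeDeviations.
Variables (R : realType) (p k : nat).
Hypotheses (p0 : (0 < p)%N) (k0 : (0 < k)%N).
Implicit Types (S : psd_tuple R p k) (A : set (psd_tuple R p k)).
Local Notation rate := (@moment_rate R p k).
Local Notation peak := (peak R p k).
Local Notation total m := (marginal (setT : set (psd_tuple R p k)) m).

Lemma lower_semicontinuous_rate : lower_semicontinuous rate.
Proof.
apply/lower_semicontinuousP => a.
have : closed [set S | (rate S <= a%:E)%E].
  by apply: compact_closed; [exact: hausdorff_psd_tuple | exact: compact_level].
rewrite -openC; congr open; apply/seteqP; split=> S /=; last by rewrite ltNge => /negP.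
by move=> /negP; rewrite -ltNge.
Qed.

Section Law.
Variable Q : nat -> set (psd_tuple R p k) -> \bar R.
Hypothesis Q0 : forall n A, (0 <= Q n A)%E.
Hypothesis law : forall m A, <<s open >> A ->
  Q (k.+1 + m) A = (fine (marginal A m.+1) / fine (total m.+1))%:E.

Lemma limsup_bound A (b e : R) : <<s open >> A -> 0 < e ->
  (b%:E < ereal_inf (rate @` closure A))%E ->
  (limn_esup (fun n => n%:R^-1%:E * lne (Q n A)) <= (- b + (e + e))%:E)%E.
Proof.
move=> mA e0 hb; have P0 := peak_gt0 R p k.
(* Points of [A] have rate above [b], so at the good ones $\det^p$ is at most this [K]. *)
pose K := peak * expR (- b).
have K0 : 0 < K by rewrite mulr_gt0 ?expR_gt0.
have hK S : A S -> good (moment_seq (psd_tuple_val S)) k -> tuple_gap S ^+ p <= K.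
  move=> AS G; have : (b%:E < rate S)%E.
    by apply: lt_le_trans hb _; apply: ereal_inf_lbound; exists S => //; apply: subset_closure.
  rewrite ltNge => /negP h; rewrite leNgt; apply/negP => lt; apply: h.
  by apply/moment_rate_le => //; split=> //; apply: ltW.
have [C C0 hC] := ratio_le mA K0 e0 hK.
set q := K / _ in hC.
have q0 : 0 < q by rewrite divr_gt0 // mulr_gt0 ?expR_gt0.
have lq : ln q = - b + e.
  rewrite /q ln_div ?posrE ?mulr_gt0 ?expR_gt0 //.
  by rewrite !lnM ?posrE ?expR_gt0 // !expRK; ring.
apply: limn_esup_le_near; rewrite addrA -lq.
(* At index $k+1+m$ the law involves [marginal] with $m+1$, so one factor [q] moves into the
   constant. *)
apply: (@speed_le _ (fun n => Q n A) k (C * q) q e) => //; first exact: mulr_gt0.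
apply: nearW => m; rewrite law // lee_fin -mulrA -exprS; exact: hC.
Qed.

Lemma liminf_bound A S (e : R) : <<s open >> A -> 0 < e -> nbhs S A ->
  good (moment_seq (psd_tuple_val S)) k ->
  ((ln (tuple_gap S ^+ p) - ln peak - (e + e))%:E
    <= limn_einf (fun n => n%:R^-1%:E * lne (Q n A)))%E.
Proof.
move=> mA e0 nA G; have P0 := peak_gt0 R p k.
have /andP[g0 gle] := tuple_gap_bounds G.
(* One [e] pays for the neighbourhood of [S], the other for the convergence of the scaled
   logarithm. *)
pose K := tuple_gap S ^+ p * expR (- e).
have K0 : 0 < K by rewrite mulr_gt0 ?expR_gt0.
have KS : 0 < K < tuple_gap S ^+ p.
  by rewrite K0 -[ltRHS]mulr1 ltr_pM2l // -expR0 ltr_expR oppr_lt0.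
have [C C0 hC] := ratio_ge mA nA G KS.
have q0 : 0 < K / peak by rewrite divr_gt0.
have lq : ln (K / peak) = ln (tuple_gap S ^+ p) - ln peak - e.
  by rewrite ln_div ?posrE // lnM ?posrE ?expR_gt0 // expRK; ring.
apply: limn_einf_ge_near; rewrite opprD addrA -lq.
apply: (@speed_ge _ (fun n => Q n A) k (C * (K / peak)) (K / peak) e) => //.
  exact: mulr_gt0.
apply: nearW => m; rewrite law // lee_fin -mulrA -exprS; exact: hC.
Qed.

Lemma moment_ldp : large_deviation_principle Q rate.
Proof.
split.
- exact: hausdorff_psd_tuple.
- by move=> S; apply: moment_rate_ge0.
- exact: lower_semicontinuous_rate.
move=> A mA; split.
  rewrite leeNl; apply: le_ereal_inf_tmp => _ [S intS <-]; rewrite leeNl.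
  have [G|G] := pselect (good (moment_seq (psd_tuple_val S)) k); last first.
    by rewrite (moment_rate_bad G) leNye.
  rewrite (moment_rateE k0 G) -EFinN opprB.
  apply/lee_addgt0Pr => e e0; rewrite -leeBlDr // -EFinB [e]splitr.
  by apply: liminf_bound => //; rewrite divr_gt0.
rewrite leeNr leNgt; apply/negP => lt.
(* A real level in between is required because either side may be infinite. *)
have [b hb1 hb2] := ereal_between lt.
move: hb1; rewrite ltNge => /negP; apply; rewrite leeNr -EFinN.
apply/lee_addgt0Pr => e e0; rewrite -EFinD [e]splitr.
by apply: limsup_bound => //; rewrite divr_gt0.
Qed.

End Law.

End LargeDeviations.

Theorem corollary2p7 (R : realType) (p : nat) (hp : (1 <= p)%N)
    (k : nat) (hk : (1 <= k)%N)
    (d : nat -> measure_display) (Omega : forall n, measurableType (d n))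
    (P : forall n, probability (Omega n) R)
    (S : forall n, {RV (P n) >-> borel_of (psd_tuple R p n)})
    (hS : forall n, (k < n)%N ->
       uniform_on_moment_space (distribution (P n) (S n))) :
  large_deviation_principle
    (fun n => pushforward (P n)
       (first_coords k \o S n : Omega n -> borel_of (psd_tuple R p k)))
    (@moment_rate R p k)
  /\ good_rate_function (@moment_rate R p k).
Proof.
split; last by move=> a; apply: compact_level.
apply: moment_ldp => // [n A|m A mA].
  by rewrite /pushforward; apply: measure_ge0.
(* The type of [Q] depends on [n], and [k.+1 + m] is not convertible to [k + m.+1]; generalising
   over [n] permits the substitution. *)
have law n (Q : set (psd_tuple R p n) -> \bar R) : n = (k + m.+1)%N ->
    uniform_on_moment_space Q ->
    Q (first_coords k @^-1` A) =
    (fine (marginal A m.+1) / fine (marginal (setT : set (psd_tuple R p k)) m.+1))%:E.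
  by move=> en; subst n => hQ; apply: uniform_law.
by apply: (law _ _ _ (hS (k.+1 + m)%N _)); [rewrite addnS | rewrite addSn ltnS leq_addr].
Qed.
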